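(* Let $0<a<1$ and let $u$ be a global odd solution in $H^1(\mathbb{R})$ of the defocusing Hartree equation $$iu_t+u_{xx}=\big(|x|^{-a}*|u|^2\big)u,\qquad (t,x)\in\mathbb{R}\times\mathbb{R}.$$ Then for every bounded interval $I\subset\mathbb{R}$, $$\lim_{t\to\infty}\Big(\|u(t)\|_{L^2(I)}+\|u(t)\|_{L^\infty(I)}\Big)=0.$$
   Context: $u$ is complex-valued and $*$ denotes convolution in $x$. A global odd solution in $H^1(\mathbb{R})$ is a function $u\in C(\mathbb{R};H^1(\mathbb{R}))$ satisfying the equation (in $H^{-1}(\mathbb{R})$) for all $t\in\mathbb{R}$, such that $u(t,-x)=-u(t,x)$ for all $t,x$. *)

(* Defs.v *)
From mathcomp Require Import all_boot all_order all_algebra.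
From mathcomp Require Import all_classical all_reals all_analysis.
From mathcomp Require Export complex.

Set Implicit Arguments.
Unset Strict Implicit.
Unset Printing Implicit Defensive.
Import Order.TTheory GRing.Theory Num.Theory numFieldNormedType.Exports.
Local Open Scope classical_set_scope.
Local Open Scope ring_scope.
Local Open Scope complex_scope.

(* Functions R -> R[i] are Borel representatives of Lebesgue classes: the norms,
   weak derivatives, H^1 and H^{-1} below are invariant under Borel modification
   on a null set.  Norms take values in \bar R, so that no junk value is
   assigned to functions (or functionals) of infinite norm. *)

Section Sobolev.
Context {R : realType}.
Local Notation mu := (@lebesgue_measure R).
Implicit Types (f g phi psi : R -> R[i]) (eta : R -> R) (I : set R).

Definition cabs (z : R[i]) : R := Normc.normc z.

(* Complex Lebesgue integral over R. *)
Definition cintegral f : R[i] :=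
  (\int[mu]_x complex.Re (f x)) +i* (\int[mu]_x complex.Im (f x)).

(* Norm of f in L^p(I), obtained by extending f by 0 outside I. *)
Definition Lnorm_on (p : \bar R) I f : \bar R :=
  ('N[mu]_p[EFin \o ((cabs \o f) \_ I)])%E.

Definition cmeasurable f : Prop :=
  measurable_fun [set: R] (fun x => complex.Re (f x)) /\
  measurable_fun [set: R] (fun x => complex.Im (f x)).

Definition L2 f : Prop := cmeasurable f /\ (Lnorm_on 2%:E [set: R] f < +oo)%E.

Definition clocally_integrable f : Prop :=
  locally_integrable [set: R] (fun x => complex.Re (f x)) /\
  locally_integrable [set: R] (fun x => complex.Im (f x)).

(* eta \in C_c^\infty(R; R). *)
Definition test_function eta : Prop :=
  (forall n x, derivable (derive1n n eta) x 1) /\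
  compact (closure [set x | eta x != 0]).

Definition weak_derivative f g : Prop :=
  [/\ clocally_integrable f, clocally_integrable g &
   forall eta, test_function eta ->
     cintegral (fun x => f x * (derive1 eta x)%:C) =
     - cintegral (fun x => g x * (eta x)%:C)].

(* The weak derivative of f, unique up to a null set when it exists. *)
Definition weakD f : R -> R[i] :=
  xget (fun=> 0) [set g | weak_derivative f g].

Definition H1 f : Prop :=
  L2 f /\ exists2 g, weak_derivative f g & L2 g.

Definition H1norm f : \bar R :=
  ((\int[mu]_x (cabs (f x) ^+ 2 + cabs (weakD f x) ^+ 2)%:E) `^ 2^-1)%E.

(* H^{-1}(R) is the dual of H^1(R): its elements are functionals, of which only
   the values on H^1 matter. *)
Definition Hm1norm (T : (R -> R[i]) -> R[i]) : \bar R :=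
  ereal_sup [set (cabs (T phi))%:E | phi in
               [set phi | H1 phi /\ (H1norm phi <= 1)%E]].

Definition Hm1 (T : (R -> R[i]) -> R[i]) : Prop :=
  (forall (c : R[i]) phi psi, H1 phi -> H1 psi ->
     T (fun x => c * phi x + psi x) = c * T phi + T psi) /\
  (Hm1norm T < +oo)%E.

(* The element of H^{-1} given by a function; the pairing is bilinear, without
   conjugation, and so extends the usual embedding into distributions. *)
Definition Hm1_of f : (R -> R[i]) -> R[i] :=
  fun phi => cintegral (fun x => f x * phi x).

(* f_xx as an element of H^{-1}, for f in H^1. *)
Definition Hm1_dxx f : (R -> R[i]) -> R[i] :=
  fun phi => - cintegral (fun x => weakD f x * weakD phi x).

Definition continuous_H1 (u : R -> R -> R[i]) : Prop :=
  (forall t, H1 (u t)) /\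
  forall t0, H1norm (fun x => u t x - u t0 x) @[t --> t0] --> 0%E.

(* ut is the time derivative of u at t, in the norm of H^{-1}. *)
Definition is_time_derivative (u : R -> R -> R[i]) (t : R)
    (ut : (R -> R[i]) -> R[i]) : Prop :=
  Hm1 ut /\
  Hm1norm (fun phi =>
    Hm1_of (fun x => (h^-1)%:C * (u (t + h) x - u t x)) phi - ut phi)
    @[h --> 0^'] --> 0%E.

(* (|x|^{-a} * |f|^2)(x); the integrand takes the value 0 at the singularity
   y = x when a != 0, which does not affect the integral. *)
Definition hartree_potential (a : R) f (x : R) : R :=
  \int[mu]_y (`|x - y| `^ (- a) * cabs (f y) ^+ 2).

(* i u_t + u_xx = (|x|^{-a} * |u|^2) u in H^{-1}(R), for all t. *)
Definition hartree_equation (a : R) (u : R -> R -> R[i]) : Prop :=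
  forall t, exists2 ut, is_time_derivative u t ut &
    forall phi, H1 phi ->
      'i%C * ut phi + Hm1_dxx (u t) phi =
      Hm1_of (fun x => (hartree_potential a (u t) x)%:C * u t x) phi.

(* The pointwise oddness is that of the continuous representative of u t, or of
   any other odd one. *)
Definition global_odd_H1_solution (a : R) (u : R -> R -> R[i]) : Prop :=
  [/\ continuous_H1 u, hartree_equation a u &
   forall t x, u t (- x) = - u t x].

End Sobolev.

(* Main.v *)
Require Import Defs.
From mathcomp Require Import all_boot all_order all_algebra.
From mathcomp Require Import all_classical all_reals all_analysis.
From mathcomp Require Import measurable_realfun ess_sup_inf ring lra.

(* Write u = p + i q, m = |u|^2, V = |x|^-a * m and w = 1 / (1 + |x|), and let
   phi = x w, so that phi' = w^2. The virial functional
   B = int phi (q p_x - p q_x) satisfies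
     B' = - 2 int phi' |u_x|^2 - int phi'' (p p_x + q q_x) + int phi V_x m,
   and the last term is nonpositive because the kernel decreases with |x| while
   phi is increasing. Since u vanishes at 0, sgn(x) u is again in H^1, and
   integrating (w^3 p^2 sgn x)_x, (w^3 q^2 sgn x)_x over R gives
   - B' >= 1/3 int w^2 |u_x|^2 + 1/2 int w^4 m. Conservation of mass and energy
   bounds u in H^1, hence B, while M = int w^4 m satisfies 0 <= M <= - 12 B' and
   |M'| <= - 12 B'; therefore M tends to 0, and the H^1 bound upgrades this to
   uniform convergence on bounded sets.
   As u is only in H^1, u_x is first replaced by the difference quotient
   (u(x + d) - u(x)) / d, and d tends to 0 in the differentiated identities. *)

(** Oddness enters only through $u(t,0)=0$: without it the jump of sgn at 0 would leave a multiple
    of $|u(t,0)|^2$ in the integrated identities, and the term $\int w^4 m$ could not be gained. The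
    kernel is never differentiated, since $|x|^{-a-1}$ is not locally integrable: $V_x$ is the
    potential of $m_x$, and the sign of $\int\phi V_x m$ is read off from the symmetric difference
    $V(x+d)-V(x-d)$. As $|x|^{-a}$ is neither integrable nor bounded, it is split at $|x|=1$; the
    near part acts on $L^2$ by Young's inequality, the far part maps $L^1$ to bounded functions.
    Time derivatives exist only in $H^{-1}$, so whatever is paired with one has to lie in $H^1$. For
    fixed $d$ the difference quotient of $u$ does, and the limit in $d$ is exchanged with the time
    derivative by the mean value theorem and convergence jointly in $d$ and $t$. *)

Set Implicit Arguments.
Unset Strict Implicit.
Unset Printing Implicit Defensive.
Import Order.TTheory GRing.Theory Num.Theory numFieldNormedType.Exports.
Local Open Scope classical_set_scope.
Local Open Scope ring_scope.

(** * Integration on the real line *)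

Section LebesgueAffine.
Context {R : realType}.
Local Notation mu := (@lebesgue_measure R).
Local Notation RR := (measurableTypeR R).

Lemma measurable_shift (d : R) : measurable_fun setT (fun x : RR => (x + d : RR)).
Proof. exact: measurable_funD. Qed.

Lemma pushforward_shift (d : R) (A : set RR) : measurable A ->
  mu A = pushforward mu (fun x : RR => (x + d : RR)) A.
Proof.
move=> mA.
apply: (@lebesgue_measure_unique R
  (measure_function_pushforward__canonical__measure_function_Measure mu
     (measurable_shift d))) => //.
move=> _ /ocitvP[->|[[a b] /= ab ->]]; first by rewrite !measure0.
rewrite /pushforward/=.
rewrite (_ : _ @^-1` _ = `]a - d, b - d]%classic); last first.
  by apply/seteqP; split => x /=; rewrite !in_itv/= ltrBlDr lerBrDr.
rewrite !lebesgue_measure_itv/= !lte_fin ab ltrD2r ab.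
by rewrite -!EFinB; congr EFin; ring.
Qed.

Lemma pushforward_opp (A : set RR) : measurable A ->
  mu A = pushforward mu (fun x : RR => (- x : RR)) A.
Proof.
move=> mA.
have mo : measurable_fun setT (fun x : RR => (- x : RR)) by exact: measurable_funN.
apply: (@lebesgue_measure_unique R
  (measure_function_pushforward__canonical__measure_function_Measure mu mo))
  => //.
move=> _ /ocitvP[->|[[a b] /= ab ->]]; first by rewrite !measure0.
rewrite /pushforward/=.
rewrite (_ : _ @^-1` _ = `[- b, - a[%classic); last first.
  by apply/seteqP; split => x /=; rewrite !in_itv/= ltrNr lerNl andbC.
by rewrite !lebesgue_measure_itv/= !lte_fin ab ltrN2 ab -!EFinB opprK addrC.
Qed.

Lemma ge0_integral_shift (f : R -> \bar R) (d : R) :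
  measurable_fun setT f -> (forall x, 0 <= f x)%E ->
  (\int[mu]_x f (x + d)%R = \int[mu]_x f x)%E.
Proof.
move=> mf f0; apply/esym.
transitivity (\int[pushforward mu (fun x : RR => (x + d : RR)%R)]_x f x)%E.
  apply: eq_measure_integral; first exact: measurable_shift.
  by move=> ms A mA _; exact: (pushforward_shift d mA).
rewrite ge0_integral_pushforward//; exact: measurable_shift.
Qed.

Lemma integral_shift (f : R -> \bar R) (d : R) :
  measurable_fun setT f ->
  (\int[mu]_x f (x + d)%R = \int[mu]_x f x)%E.
Proof.
move=> mf; rewrite integralE [RHS]integralE; congr (_ - _)%E.
  rewrite -[RHS](ge0_integral_shift d)//; last exact: measurable_funepos.
  by apply: eq_integral => x _; rewrite !funeposE.
rewrite -[RHS](ge0_integral_shift d)//; last exact: measurable_funeneg.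
by apply: eq_integral => x _; rewrite !funenegE.
Qed.

(** This lets an almost everywhere identity between an odd function and its continuous
    representative be used at $x$ and at $-x$ simultaneously. *)
Lemma negligible_opp (A : set R) : mu.-negligible A ->
  mu.-negligible [set x | A (- x)].
Proof.
move=> [N [mN N0 AN]]; exists [set x | N (- x)]; split.
- by rewrite -[X in measurable X]setTI; apply: measurable_funN.
- by rewrite -N0 [RHS]pushforward_opp.
- by move=> x /AN.
Qed.

End LebesgueAffine.

Section L1L2.
Context {R : realType}.
Local Notation mu := (@lebesgue_measure R).
Implicit Types f g h : R -> R.

Definition mfun f := measurable_fun [set: R] f.
Definition L1 f := mu.-integrable [set: R] (EFin \o f).
Definition intg f : R := \int[mu]_x f x.

Lemma mfunD f g : mfun f -> mfun g -> mfun (fun x => f x + g x).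
Proof. exact: measurable_funD. Qed.
Lemma mfunB f g : mfun f -> mfun g -> mfun (fun x => f x - g x).
Proof. exact: measurable_funB. Qed.
Lemma mfunN f : mfun f -> mfun (fun x => - f x).
Proof. exact: measurable_funN. Qed.
Lemma mfunM f g : mfun f -> mfun g -> mfun (fun x => f x * g x).
Proof. exact: measurable_funM. Qed.
Lemma mfun_cst (c : R) : mfun (fun=> c).
Proof. exact: measurable_cst. Qed.
Lemma mfunX f n : mfun f -> mfun (fun x => f x ^+ n).
Proof. exact: measurable_funX. Qed.
Lemma mfun_abs f : mfun f -> mfun (fun x => `|f x|).
Proof. by move=> mf; apply: measurableT_comp. Qed.
Lemma mfun_comp f g : mfun f -> mfun g -> mfun (fun x => f (g x)).
Proof. by move=> mf mg; apply: measurableT_comp. Qed.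
Lemma mfun_id : mfun (fun x => x).
Proof. exact: measurable_id. Qed.
Lemma mfun_sh f d : mfun f -> mfun (fun x => f (x + d)).
Proof.
by move=> mf; apply: (mfun_comp mf); apply: mfunD; [exact: mfun_id|exact: mfun_cst].
Qed.

Lemma L1_mfun f : L1 f -> mfun f.
Proof. by move=> /integrableP[/measurable_EFinP]. Qed.

Lemma L1P f : mfun f -> (\int[mu]_x `|f x|%:E < +oo)%E -> L1 f.
Proof. by move=> mf fi; apply/integrableP; split => //; apply/measurable_EFinP. Qed.

Lemma L1D f g : L1 f -> L1 g -> L1 (fun x => f x + g x).
Proof. by move=> f1 g1; apply: (integrableD _ f1 g1). Qed.
Lemma L1B f g : L1 f -> L1 g -> L1 (fun x => f x - g x).
Proof. by move=> f1 g1; apply: (integrableB _ f1 g1). Qed.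
Lemma L1Z (c : R) f : L1 f -> L1 (fun x => c * f x).
Proof. by move=> f1; apply: (integrableZl _ c f1). Qed.
Lemma L1N f : L1 f -> L1 (fun x => - f x).
Proof. by move=> f1; apply: (integrableN f1). Qed.
Lemma L1_abs f : L1 f -> L1 (fun x => `|f x|).
Proof. by move=> f1; apply: integrable_norm. Qed.
Lemma L1_le f g : mfun f -> (forall x, `|f x| <= g x) -> L1 g -> L1 f.
Proof.
move=> mf fg g1; apply: (le_integrable measurableT _ _ g1).
  exact/measurable_EFinP.
by move=> x _ /=; rewrite lee_fin (le_trans (fg x))// ler_norm.
Qed.
Lemma L1_0 : L1 (fun=> 0).
Proof. by apply: (@L1_le _ (fun=> 0)) => [|x|]; [exact: mfun_cst|rewrite normr0|exact: integrable0]. Qed.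
Lemma L1_sh f d : L1 f -> L1 (fun x => f (x + d)).
Proof.
move=> f1; have mf := L1_mfun f1; apply: L1P; first exact: mfun_sh.
rewrite (ge0_integral_shift (f := fun x => `|f x|%:E))//.
  by case/integrableP : f1.
by apply/measurable_EFinP; exact: mfun_abs.
Qed.

Lemma intgD f g : L1 f -> L1 g -> intg (fun x => f x + g x) = intg f + intg g.
Proof. by move=> f1 g1; rewrite /intg RintegralD. Qed.
Lemma intgB f g : L1 f -> L1 g -> intg (fun x => f x - g x) = intg f - intg g.
Proof. by move=> f1 g1; rewrite /intg RintegralB. Qed.
Lemma intgZ (c : R) f : L1 f -> intg (fun x => c * f x) = c * intg f.
Proof. by move=> f1; rewrite /intg RintegralZl. Qed.
Lemma intgN f : L1 f -> intg (fun x => - f x) = - intg f.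
Proof.
move=> f1; rewrite -[RHS]mulN1r -intgZ//.
by congr intg; apply/funext => x; rewrite mulN1r.
Qed.
Lemma intg0 : intg (fun=> 0) = 0.
Proof. by rewrite /intg /Rintegral integral0. Qed.
Lemma intg_sh f d : mfun f -> intg (fun x => f (x + d)) = intg f.
Proof.
move=> mf; rewrite /intg /Rintegral (integral_shift (f := EFin \o f))//.
exact/measurable_EFinP.
Qed.
Lemma intg_ge0 f : (forall x, 0 <= f x) -> 0 <= intg f.
Proof. by move=> f0; apply: Rintegral_ge0. Qed.
Lemma intg_le f g : L1 f -> L1 g -> (forall x, f x <= g x) -> intg f <= intg g.
Proof. by move=> f1 g1 fg; apply: le_Rintegral. Qed.
Lemma intg_abs f : L1 f -> `|intg f| <= intg (fun x => `|f x|).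
Proof. by move=> f1; apply: le_normr_Rintegral. Qed.
Lemma intgE f : L1 f -> (\int[mu]_x (f x)%:E)%E = (intg f)%:E.
Proof. by move=> f1; rewrite /intg /Rintegral fineK//; exact: integrable_fin_num. Qed.

Lemma ae_sub (A B : set R) : A `<=` B ->
  almost_everywhere mu A -> almost_everywhere mu B.
Proof. by move=> AB; apply: negligibleS => x /= nB /AB. Qed.

Lemma ae_and (P Q : R -> Prop) : ( \forall x \ae mu, P x) ->
  (\forall x \ae mu, Q x) -> \forall x \ae mu, P x /\ Q x.
Proof.
move=> aP aQ; apply: negligibleS (negligibleU aP aQ) => x /= nPQ.
by have [Px|] := pselect (P x); [right => Qx; exact: nPQ|left].
Qed.

Definition aeq f g := \forall x \ae mu, f x = g x.

Lemma aeq_intg f g : mfun f -> mfun g -> aeq f g -> intg f = intg g.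
Proof.
move=> mf mg fg; rewrite /intg /Rintegral; congr fine.
apply: ae_eq_integral => //; try exact/measurable_EFinP.
by apply: (ae_sub _ fg) => x /= ->.
Qed.
Lemma aeq_L1 f g : mfun g -> aeq f g -> L1 f -> L1 g.
Proof.
move=> mg fg f1; apply: L1P => //.
rewrite -(@ge0_ae_eq_integral _ _ _ mu setT (fun x => `|f x|%:E))//.
- by case/integrableP : f1.
- by apply/measurable_EFinP; apply: mfun_abs; exact: L1_mfun.
- by apply/measurable_EFinP; exact: mfun_abs.
- by apply: (ae_sub _ fg) => x /= ->.
Qed.

Definition l2 f := mfun f /\ L1 (fun x => f x ^+ 2).

Lemma l2_mfun f : l2 f -> mfun f. Proof. by case. Qed.
Lemma l2_sq f : l2 f -> L1 (fun x => f x ^+ 2). Proof. by case. Qed.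

Lemma l2M f g : l2 f -> l2 g -> L1 (fun x => f x * g x).
Proof.
move=> [mf f2] [mg g2]; apply: (@L1_le _ (fun x => f x ^+ 2 + g x ^+ 2)).
- exact: mfunM.
- move=> x; rewrite normrM -(real_normK (num_real (f x))) -(real_normK (num_real (g x))).
  by have := sqr_ge0 (`|f x| - `|g x|); have := normr_ge0 (f x); have := normr_ge0 (g x); nra.
- exact: L1D.
Qed.

Lemma l2_le f g : mfun f -> (forall x, `|f x| <= `|g x|) -> l2 g -> l2 f.
Proof.
move=> mf fg [mg g2]; split => //; apply: (L1_le _ _ g2); first exact: mfunX.
move=> x; rewrite normrX -(real_normK (num_real (g x))).
by rewrite ler_pXn2r// nnegrE.
Qed.

Lemma l2D f g : l2 f -> l2 g -> l2 (fun x => f x + g x).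
Proof.
move=> f2 g2; have [mf f2'] := f2; have [mg g2'] := g2.
split; first exact: mfunD.
have -> : (fun x => (f x + g x) ^+ 2) =
    (fun x => (f x ^+ 2 + 2 * (f x * g x)) + g x ^+ 2).
  by apply/funext => x; ring.
by apply: L1D => //; apply: L1D => //; apply: L1Z; exact: l2M.
Qed.
Lemma l2Z (c : R) f : l2 f -> l2 (fun x => c * f x).
Proof.
move=> [mf f2]; split; first by apply: mfunM => //; exact: mfun_cst.
have -> : (fun x => (c * f x) ^+ 2) = (fun x => c ^+ 2 * (f x ^+ 2)).
  by apply/funext => x; ring.
exact: L1Z.
Qed.
Lemma l2N f : l2 f -> l2 (fun x => - f x).
Proof.
move=> /(l2Z (-1)); have -> // : (fun x => -1 * f x) = (fun x => - f x).
by apply/funext => x; ring.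
Qed.
Lemma l2B f g : l2 f -> l2 g -> l2 (fun x => f x - g x).
Proof. by move=> f2 g2; apply: l2D => //; exact: l2N. Qed.

Lemma l2Mb (C : R) h f : mfun h -> (forall x, `|h x| <= C) -> l2 f -> l2 (fun x => h x * f x).
Proof.
move=> mh hC f2; apply: (l2_le _ _ (l2Z C f2)).
  by apply: mfunM => //; exact: l2_mfun.
move=> x; rewrite !normrM ler_wpM2r//.
by rewrite (le_trans (hC x))// ler_norm.
Qed.
Lemma l2_sh f d : l2 f -> l2 (fun x => f (x + d)).
Proof. by move=> [mf f2]; split; [exact: mfun_sh|exact: (L1_sh d f2)]. Qed.
Lemma aeq_l2 f g : mfun g -> aeq f g -> l2 f -> l2 g.
Proof.
move=> mg fg [mf f2]; split => //; apply: (aeq_L1 _ _ f2); first exact: mfunX.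
by apply: (ae_sub _ fg) => x /= ->.
Qed.

Definition ip f g := intg (fun x => f x * g x).
Definition n2 f := Num.sqrt (ip f f).

Lemma ip_ge0 f : 0 <= ip f f.
Proof. by apply: intg_ge0 => x; rewrite -expr2 sqr_ge0. Qed.
Lemma n2_ge0 f : 0 <= n2 f. Proof. exact: sqrtr_ge0. Qed.
Lemma n2E f : n2 f ^+ 2 = ip f f.
Proof. by rewrite sqr_sqrtr// ip_ge0. Qed.
Lemma n2E' f : n2 f ^+ 2 = intg (fun x => f x ^+ 2).
Proof. exact: n2E. Qed.

Lemma ipC f g : ip f g = ip g f.
Proof. by rewrite /ip; congr intg; apply/funext => x; rewrite mulrC. Qed.
Lemma ipDl f1 f2 g : l2 f1 -> l2 f2 -> l2 g ->
  ip (fun x => f1 x + f2 x) g = ip f1 g + ip f2 g.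
Proof.
move=> h1 h2 hg; rewrite /ip -intgD; [|exact: l2M..].
by congr intg; apply/funext => x; ring.
Qed.
Lemma ipBl f1 f2 g : l2 f1 -> l2 f2 -> l2 g ->
  ip (fun x => f1 x - f2 x) g = ip f1 g - ip f2 g.
Proof.
move=> h1 h2 hg; rewrite /ip -intgB; [|exact: l2M..].
by congr intg; apply/funext => x; ring.
Qed.
Lemma ipZl c f g : l2 f -> l2 g -> ip (fun x => c * f x) g = c * ip f g.
Proof.
move=> hf hg; rewrite /ip -intgZ; [|exact: l2M].
by congr intg; apply/funext => x; ring.
Qed.
Lemma ipNl f g : l2 f -> l2 g -> ip (fun x => - f x) g = - ip f g.
Proof.
move=> hf hg; rewrite /ip -intgN; [|exact: l2M].
by congr intg; apply/funext => x; ring.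
Qed.
Lemma ipDr f1 f2 g : l2 f1 -> l2 f2 -> l2 g ->
  ip g (fun x => f1 x + f2 x) = ip g f1 + ip g f2.
Proof. by move=> *; rewrite ipC ipDl// !(ipC g). Qed.
Lemma ipBr f1 f2 g : l2 f1 -> l2 f2 -> l2 g ->
  ip g (fun x => f1 x - f2 x) = ip g f1 - ip g f2.
Proof. by move=> *; rewrite ipC ipBl// !(ipC g). Qed.
Lemma ipZr c f g : l2 f -> l2 g -> ip g (fun x => c * f x) = c * ip g f.
Proof. by move=> *; rewrite ipC ipZl// (ipC g). Qed.

(** Cauchy-Schwarz, from $0 \le \|f - s g\|^2$ for every real $s$. *)
Lemma ip_le_n2 f g : l2 f -> l2 g -> `|ip f g| <= n2 f * n2 g.
Proof.
move=> hf hg.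
have key s : 0 <= ip f f - 2 * s * ip f g + s ^+ 2 * ip g g.
  have -> : ip f f - 2 * s * ip f g + s ^+ 2 * ip g g =
      ip (fun x => f x - s * g x) (fun x => f x - s * g x).
    have hs := l2Z s hg.
    rewrite ipBl ?ipBr//; try exact: l2B.
    by rewrite !ipZl ?ipZr// (ipC g f); ring.
  exact: ip_ge0.
have A0 := ip_ge0 f; have B0 := ip_ge0 g.
suff : ip f g ^+ 2 <= ip f f * ip g g.
  move=> H; rewrite -(@ler_pXn2r _ 2)// ?nnegrE ?mulr_ge0 ?n2_ge0//.
  by rewrite real_normK ?num_real// exprMn !n2E.
have [B0'|Bn0] := eqVneq (ip g g) 0.
  rewrite B0' mulr0 in key *.
  have [->|C0] := eqVneq (ip f g) 0; first by rewrite expr0n.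
  (* If $\|g\| = 0$ the expression is affine in $s$; this $s$ gives it the value $-1$. *)
  have := key ((ip f f + 1) / (2 * ip f g)).
  rewrite mulr0 addr0 -mulrA [_ * ip f g]mulrC.
  have -> : 2 * (ip f g * ((ip f f + 1) / (2 * ip f g))) = ip f f + 1 by field.
  by move=> ?; exfalso; lra.
(* The minimiser in $s$. *)
have := key (ip f g / ip g g).
have Bp : 0 < ip g g by rewrite lt_def Bn0.
have -> : ip f f - 2 * (ip f g / ip g g) * ip f g + (ip f g / ip g g) ^+ 2 * ip g g
  = (ip f f * ip g g - ip f g ^+ 2) / ip g g by field.
by rewrite pmulr_lge0 ?invr_gt0// subr_ge0.
Qed.

Lemma n2D f g : l2 f -> l2 g -> n2 (fun x => f x + g x) <= n2 f + n2 g.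
Proof.
move=> hf hg; have hfg := l2D hf hg.
rewrite -(@ler_pXn2r _ 2)// ?nnegrE ?addr_ge0 ?n2_ge0//.
rewrite n2E ipDl// !ipDr// sqrrD !n2E (ipC g f).
have := ip_le_n2 hf hg; have := ler_norm (ip f g); lra.
Qed.
Lemma n2Z c f : l2 f -> n2 (fun x => c * f x) = `|c| * n2 f.
Proof.
move=> hf; rewrite /n2 ipZl ?ipZr//; last exact: l2Z.
by rewrite mulrA -expr2 sqrtrM ?sqr_ge0// sqrtr_sqr.
Qed.
Lemma n2N f : l2 f -> n2 (fun x => - f x) = n2 f.
Proof.
move=> hf; rewrite -[RHS]mul1r -(normrN1 R) -n2Z//; congr n2.
by apply/funext => x; ring.
Qed.
Lemma n2B f g : l2 f -> l2 g -> n2 (fun x => f x - g x) <= n2 f + n2 g.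
Proof. by move=> hf hg; rewrite -[X in _ + X]n2N//; apply: n2D => //; exact: l2N. Qed.
Lemma n2_0 : n2 (fun=> 0) = 0.
Proof. by rewrite /n2 /ip (_ : (fun x => 0 * 0) = (fun=> 0)) ?intg0 ?sqrtr0//; apply/funext => x; rewrite mul0r. Qed.
Lemma n2_sh f d : l2 f -> n2 (fun x => f (x + d)) = n2 f.
Proof.
move=> [mf f2]; rewrite /n2 /ip (intg_sh (f := fun x => f x * f x))//.
exact: mfunM.
Qed.
Lemma n2_le f g : mfun f -> l2 g -> (forall x, `|f x| <= `|g x|) -> n2 f <= n2 g.
Proof.
move=> mf hg fg; have hf := l2_le mf fg hg.
rewrite /n2 ler_sqrt; last exact: ip_ge0.
apply: intg_le; [exact: l2M..|move=> x].
by rewrite -!expr2 -(real_normK (num_real (f x))) -(real_normK (num_real (g x))) ler_pXn2r// nnegrE.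
Qed.
Lemma n2Mb (C : R) h f : mfun h -> (forall x, `|h x| <= C) -> l2 f ->
  n2 (fun x => h x * f x) <= C * n2 f.
Proof.
move=> mh hC f2.
have C0 : 0 <= C := le_trans (normr_ge0 _) (hC 0).
rewrite -[X in _ <= X * _](ger0_norm C0) -n2Z//; apply: n2_le.
- by apply: mfunM => //; exact: l2_mfun.
- exact: l2Z.
- by move=> x; rewrite !normrM ler_wpM2r// (ger0_norm C0).
Qed.
Lemma aeq_n2 f g : mfun f -> mfun g -> aeq f g -> n2 f = n2 g.
Proof.
move=> mf mg fg; rewrite /n2; congr Num.sqrt; apply: aeq_intg; [exact: mfunM..|].
by apply: (ae_sub _ fg) => x /= ->.
Qed.

End L1L2.

Section ConvTonelli.
Context {R : realType}.
Local Notation mu := (@lebesgue_measure R).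
Local Notation RR := (measurableTypeR R).
Implicit Types k f g : R -> R.

Lemma measurable_conv k f : mfun k -> mfun f ->
  measurable_fun setT (fun z : RR * RR => (k (z.1 - z.2) * f z.2)%:E).
Proof.
move=> mk mf; apply/measurable_EFinP; apply: measurable_funM.
  apply: (@measurableT_comp _ _ _ _ _ _ (k : RR -> R)) => //.
  by apply: measurable_funB; [exact: measurable_fst|exact: measurable_snd].
by apply: (@measurableT_comp _ _ _ _ _ _ (f : RR -> R)) => //; exact: measurable_snd.
Qed.

(** After exchanging the integrals, translation invariance makes the inner one independent of
    $y$. *)
Lemma conv_tonelli k f : mfun k -> mfun f -> (forall x, 0 <= k x) ->
  (forall x, 0 <= f x) ->
  (\int[mu]_x \int[mu]_y (k (x - y) * f y)%:E =
   (\int[mu]_x (k x)%:E) * (\int[mu]_x (f x)%:E))%E.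
Proof.
move=> mk mf k0 f0.
have mz := measurable_conv mk mf.
have z0 (z : RR * RR) : (0 <= (k (z.1 - z.2) * f z.2)%:E)%E.
  by rewrite lee_fin mulr_ge0.
rewrite (@fubini_tonelli _ _ RR RR R mu mu _ mz z0)/=.
transitivity (\int[mu]_y ((\int[mu]_x (k x)%:E) * (f y)%:E))%E; last first.
  rewrite ge0_integralZl//; first exact/measurable_EFinP.
  - by move=> x _; rewrite lee_fin.
  - by apply: integral_ge0 => x _; rewrite lee_fin.
apply: eq_integral => y _.
under eq_integral do rewrite EFinM.
rewrite ge0_integralZr//.
- congr (_ * _)%E.
  rewrite (ge0_integral_shift (f := fun x => (k x)%:E))//.
  exact/measurable_EFinP.
- by apply/measurable_EFinP; exact: (@mfun_sh _ _ (- y) mk).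
- by move=> x _; rewrite lee_fin.
- by rewrite lee_fin.
Qed.

Lemma measurable_econv k f : mfun k -> mfun f -> (forall x, 0 <= k x) ->
  (forall x, 0 <= f x) ->
  measurable_fun [set: R] (fun x => \int[mu]_y (k (x - y) * f y)%:E)%E.
Proof.
move=> mk mf k0 f0.
apply: (@measurable_fun_fubini_tonelli_F _ _ RR RR R mu
  (fun z => (k (z.1 - z.2) * f z.2)%:E) (measurable_conv mk mf)).
by move=> z; rewrite lee_fin mulr_ge0.
Qed.

(** The integral is split into those of the positive and negative parts, to each of which Tonelli
    applies; this covers the points where the integral diverges. *)
Lemma measurable_rconv k f : mfun k -> mfun f ->
  mfun (fun x => intg (fun y => k (x - y) * f y)).
Proof.
move=> mk mf; rewrite /mfun /intg /Rintegral.
apply: measurableT_comp => //.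
have mz := measurable_conv mk mf.
have -> : (fun x => \int[mu]_y (k (x - y) * f y)%:E)%E =
  (fun x => (\int[mu]_y ((fun z => (k (z.1 - z.2) * f z.2)%:E)^\+ (x, y))) -
     \int[mu]_y ((fun z => (k (z.1 - z.2) * f z.2)%:E)^\- (x, y)))%E.
  by apply/funext => x; rewrite integralE; congr (_ - _)%E;
    apply: eq_integral => y _; rewrite ?funeposE ?funenegE.
apply: emeasurable_funB.
  apply: (@measurable_fun_fubini_tonelli_F _ _ RR RR R mu _
    (measurable_funepos mz)) => z; exact: funepos_ge0.
apply: (@measurable_fun_fubini_tonelli_F _ _ RR RR R mu _
    (measurable_funeneg mz)) => z; exact: funeneg_ge0.
Qed.

End ConvTonelli.

Section RadonRiesz.
Context {R : realType}.
Local Notation mu := (@lebesgue_measure R).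
Local Notation RR := (measurableTypeR R).
Implicit Types f g : R -> R.

(** Turns Fatou's inequality into an eventual bound: the infima of the tails increase to the lower
    limit, so one of them already exceeds $l$. *)
Lemma limn_einf_gt (u : (\bar R)^nat) (l : \bar R) :
  (l < limn_einf u)%E -> \forall n \near \oo, (l < u n)%E.
Proof.
have nd : nondecreasing_seq (einfs u) by exact: nondecreasing_einfs.
rewrite limn_einf_lim (cvg_lim _ (ereal_nondecreasing_cvgn nd))// => H.
have [_ [n _ <-] lu] := ereal_sup_gt H.
exists n => // m /= nm; apply: (lt_le_trans lu).
by apply: ereal_inf_lbound; exists m.
Qed.

(* Brezis-Lieb / Radon-Riesz: Fatou applied to 2 f^2 + 2 f_n^2 - (f_n - f)^2. *)
Lemma radon_riesz (f_ : nat -> R -> R) f :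
  (forall n, l2 (f_ n)) -> l2 f -> (forall n, n2 (f_ n) <= n2 f) ->
  {ae mu, forall x : RR, f_ n x @[n --> \oo] --> (f x : R)} ->
  n2 (fun x => f_ n x - f x) @[n --> \oo] --> (0 : R).
Proof.
move=> hf_ hf bnd [N [mN N0 fN]].
pose h n x : R := 2 * f x ^+ 2 + 2 * f_ n x ^+ 2 - (f_ n x - f x) ^+ 2.
have h1 n : L1 (h n).
  apply: L1B; last by apply: l2_sq; exact: l2B.
  by apply: L1D; apply: L1Z; exact: l2_sq.
have h0 n x : 0 <= h n x by rewrite /h; have := sqr_ge0 (f x + f_ n x); lra.
have mh n : measurable_fun setT (EFin \o h n).
  by apply/measurable_EFinP; exact: L1_mfun.
have := @fatou _ _ _ mu (setT `\` N) (measurableD measurableT mN)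
  (fun n x => (h n x)%:E).
have -> : (\int[mu]_(x in setT `\` N) limn_einf (fun n => (h n x)%:E) =
  (4 * n2 f ^+ 2)%:E)%E.
  transitivity (\int[mu]_(x in setT `\` N) (4 * f x ^+ 2)%:E)%E.
    apply: eq_integral => x; rewrite inE/= => -[_ Nx].
    have fx : f_ n x @[n --> \oo] --> f x by apply: contrapT => H; apply: Nx; exact: fN.
    have hx : h n x @[n --> \oo] --> 4 * f x ^+ 2.
      have -> : 4 * f x ^+ 2 = 2 * f x ^+ 2 + 2 * f x ^+ 2 - (f x - f x) ^+ 2 by ring.
      apply: cvgB; last first.
        by rewrite expr2; under eq_fun do rewrite expr2; apply: cvgM; apply: cvgB => //; exact: cvg_cst.
      apply: cvgD; first exact: cvg_cst.
      apply: cvgM; first exact: cvg_cst.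
      by rewrite expr2; under eq_fun do rewrite expr2; exact: cvgM.
    have hx' : (h n x)%:E @[n --> \oo] --> (4 * f x ^+ 2)%:E.
      by apply: cvg_EFin => //; exact: nearW.
    by have [-> _] := cvg_limn_einf_sup hx'.
  rewrite -(@ge0_negligible_integral _ _ _ mu setT N)//; last 2 first.
  - apply/measurable_EFinP; apply: mfunM; first exact: mfun_cst.
    by apply: mfunX; exact: l2_mfun.
  - by move=> x _; rewrite lee_fin mulr_ge0// sqr_ge0.
  by rewrite n2E' -intgZ; [apply: intgE; apply: L1Z|]; exact: l2_sq.
have -> : (fun n => \int[mu]_(x in setT `\` N) (h n x)%:E)%E =
    (fun n => (2 * n2 f ^+ 2 + 2 * n2 (f_ n) ^+ 2 - n2 (fun x => f_ n x - f x) ^+ 2)%:E).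
  apply/funext => n.
  rewrite -(@ge0_negligible_integral _ _ _ mu setT N)//; last 2 first.
  - exact: mh.
  - by move=> x _; rewrite lee_fin.
  rewrite intgE// !n2E' /h intgB; last 2 first.
  - by apply: L1D; apply: L1Z; exact: l2_sq.
  - by apply: l2_sq; exact: l2B.
  by rewrite intgD ?intgZ//; try apply: L1Z; exact: l2_sq.
move=> F.
have {F} := F (fun n => measurable_funTS (mh n)) (fun n x _ => h0 n x).
set u := (X in limn_einf X) => F.
apply/cvgrPdist_lt => e e0.
(* Fatou gives $4\|f\|^2 - e^2 < 2\|f\|^2 + 2\|f_n\|^2 - \|f_n - f\|^2$ eventually. The right side
   is at most $4\|f\|^2 - \|f_n - f\|^2$ by the norm bound, whence $\|f_n - f\| < e$. *)
have : ((4 * n2 f ^+ 2 - e ^+ 2)%:E < limn_einf u)%E.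
  apply: lt_le_trans F; rewrite lte_fin ltrBlDr ltrDl; nra.
move=> /limn_einf_gt; apply: filterS => n; rewrite /u lte_fin => H.
rewrite sub0r normrN ger0_norm ?n2_ge0//.
have := bnd n; have := n2_ge0 (f_ n); have := n2_ge0 (fun x => f_ n x - f x).
have := n2_ge0 f; nra.
Qed.
End RadonRiesz.

(** * Strong, weak and absolutely continuous derivatives *)

Section DifferenceQuotients.
Context {R : realType}.
Local Notation mu := (@lebesgue_measure R).
Implicit Types f g : R -> R.

Definition sh (d : R) f := fun x => f (x + d).
Definition dq (d : R) f := fun x => (f (x + d) - f x) / d.

(* [sd f g]: [g] is the L^2 limit of the difference quotients of [f], a property of
   classes modulo null sets; [ftc f g]: [f] is moreover the continuous
   representative. *)
Definition sd f g := [/\ l2 f, l2 g &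
  n2 (fun x => dq d f x - g x) @[d --> 0^'] --> (0 : R)].

Definition ftc f g := [/\ l2 f, l2 g & forall x y, x <= y ->
  f y - f x = \int[mu]_(z in `[x, y]) g z].

Lemma l2_dq d f : l2 f -> l2 (dq d f).
Proof.
move=> hf; have -> : dq d f = (fun x => d^-1 * (sh d f x - f x)).
  by apply/funext => x; rewrite /dq mulrC.
by apply: l2Z; apply: l2B => //; exact: l2_sh.
Qed.

Lemma dqN d f x : d != 0 -> dq (- d) f x = dq d f (x - d).
Proof. by move=> d0; rewrite /dq subrK; field. Qed.

(** A real-valued indicator keeps restricted integrals and norms within [intg], [ip] and [n2]; it
    vanishes identically when $b < a$. *)
Definition ind (a b : R) : R -> R := \1_(`[a, b]%classic).

Lemma ind01 a b x : 0 <= ind a b x <= 1.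
Proof. by rewrite /ind indicE ler0n/=; case: (_ \in _). Qed.
Lemma indE a b x : ind a b x = (if a <= x <= b then 1 else 0).
Proof. by rewrite /ind indicE mem_setE in_itv/=; case: ifP. Qed.
Lemma mfun_ind a b : mfun (ind a b).
Proof. exact: measurable_indic. Qed.
Lemma int_ind a b : a <= b -> (\int[mu]_x (ind a b x)%:E = (b - a)%:E)%E.
Proof.
move=> ab; transitivity (mu `[a, b]%classic); first by rewrite integral_indic// setIT.
rewrite lebesgue_measure_itv/= lte_fin.
case: ltP => // ba.
by have -> : a = b; [apply/eqP; rewrite eq_le ab ba|rewrite subrr].
Qed.
Lemma L1_ind a b : L1 (ind a b).
Proof.
apply: L1P; first exact: mfun_ind.
under eq_integral => x _ do rewrite ger0_norm ?(andP (ind01 _ _ _)).1//.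
have [ab|ab] := leP a b; first by rewrite int_ind// ltry.
rewrite (eq_integral (cst 0)) ?integral0// => x _; rewrite indE.
case: ifP => // /andP[ax xb]; by move: (lt_le_trans ab (le_trans ax xb)); rewrite ltxx.
Qed.
Lemma intg_ind a b : a <= b -> intg (ind a b) = b - a.
Proof. by move=> ab; rewrite /intg /Rintegral int_ind. Qed.
Lemma ind_sq a b x : ind a b x * ind a b x = ind a b x.
Proof. by rewrite !indE; case: ifP; rewrite ?mulr1 ?mulr0. Qed.
Lemma l2_ind a b : l2 (ind a b).
Proof.
split; first exact: mfun_ind.
by under eq_fun do rewrite expr2 ind_sq; exact: L1_ind.
Qed.
Lemma l2_indM a b g : l2 g -> l2 (fun x => ind a b x * g x).
Proof.
move=> hg; apply: (@l2Mb _ 1) => //; first exact: mfun_ind.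
by move=> x; have /andP[i0 i1] := ind01 a b x; rewrite ger0_norm.
Qed.
Lemma Rintegral_ind a b g :
  \int[mu]_(z in `[a, b]) g z = intg (fun z => ind a b z * g z).
Proof.
rewrite Rintegral_mkcond; congr Rintegral; apply/funext => z.
by rewrite patchE /ind indicE; case: ifPn => _; rewrite ?mul1r ?mul0r.
Qed.

Lemma ftcE f g x y : ftc f g -> x <= y ->
  f y - f x = intg (fun z => ind x y z * g z).
Proof. by move=> [_ _ H] xy; rewrite H// Rintegral_ind. Qed.

Lemma n2_ind a b : a <= b -> n2 (ind a b) = Num.sqrt (b - a).
Proof.
move=> ab; rewrite /n2 /ip; under eq_fun do rewrite ind_sq.
by rewrite intg_ind.
Qed.

(** Cauchy-Schwarz on $[x, y]$. The norm of $g$ stays restricted to the interval because [n2_dq_le]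
    integrates its square in $x$. *)
Lemma ftc_holder f g x y : ftc f g -> x <= y ->
  `|f y - f x| <= Num.sqrt (y - x) * n2 (fun z => ind x y z * g z).
Proof.
move=> fg xy; have [_ hg _] := fg; rewrite (ftcE fg xy).
have -> : intg (fun z => ind x y z * g z) = ip (ind x y) (fun z => ind x y z * g z).
  by rewrite /ip; congr intg; apply/funext => z; rewrite mulrA ind_sq.
rewrite -n2_ind//; apply: ip_le_n2; [exact: l2_ind|exact: l2_indM].
Qed.

Lemma ftc_holder2 f g x y : ftc f g -> x <= y ->
  `|f y - f x| <= Num.sqrt (y - x) * n2 g.
Proof.
move=> fg xy; apply: (le_trans (ftc_holder fg xy)).
have [_ hg _] := fg.
rewrite ler_wpM2l ?sqrtr_ge0//.
rewrite -[leRHS]mul1r; apply: n2Mb => //; first exact: mfun_ind.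
by move=> z; have /andP[i0 i1] := ind01 x y z; rewrite ger0_norm.
Qed.

(** Pointwise $|f(x+d) - f(x)|^2 \le d\int_x^{x+d} g^2$; integrating in $x$ by Tonelli yields
    another factor $d$. Negative steps reduce to positive ones by translation. *)
Lemma n2_dq_le f g d : ftc f g -> d != 0 -> n2 (dq d f) <= n2 g.
Proof.
move=> fg; have [hf hg _] := fg.
wlog d0 : d / 0 < d.
  move=> H dn0; have [dp|dn] := ltP 0 d; first exact: H.
  have dn' : 0 < - d by rewrite oppr_gt0 lt_neqAle dn0.
  have := H _ dn' (lt0r_neq0 dn').
  have -> : dq (- d) f = (fun x => dq d f (x - d)).
    by apply/funext => x; rewrite dqN.
  by rewrite n2_sh//; exact: l2_dq.
(* With this $k$ the integral of $g^2$ over $[x, x+d]$ is the convolution of $k$ and $g^2$ at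
   $x$. *)
move=> _; pose k := ind (- d) 0.
rewrite /n2 ler_sqrt; last exact: ip_ge0.
have hd := l2_dq d hf.
have k0 x : 0 <= k x by case/andP : (ind01 (- d) 0 x).
have mg2 : mfun (fun x => g x ^+ 2) by apply: mfunX; exact: l2_mfun.
suff H : (\int[mu]_x (dq d f x * dq d f x)%:E <= \int[mu]_x (g x * g x)%:E)%E.
  rewrite -lee_fin -!intgE//; exact: l2M.
apply: (@le_trans _ _ (\int[mu]_x
   ((d^-1)%:E * \int[mu]_y (k (x - y) * g y ^+ 2)%:E))%E).
  apply: ge0_le_integral => //.
  - by move=> x _; rewrite lee_fin -expr2 sqr_ge0.
  - by apply/measurable_EFinP; exact: L1_mfun (l2M hd hd).
  - apply: measurable_funeM; exact: measurable_econv (mfun_ind _ _) mg2 k0 (fun x => sqr_ge0 _).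
  move=> x _.
  have kE y : k (x - y) = ind x (x + d) y.
    rewrite /k !indE; have -> // : (- d <= x - y <= 0) = (x <= y <= x + d).
    by apply/andP/andP => -[h1 h2]; split; lra.
  have hi := l2_indM x (x + d) hg.
  have -> : (\int[mu]_y (k (x - y) * g y ^+ 2)%:E =
      (n2 (fun z => ind x (x + d) z * g z) ^+ 2)%:E)%E.
    rewrite n2E' -intgE; last exact: l2_sq.
    apply: eq_integral => y _; rewrite kE exprMn; congr EFin.
    by rewrite [in RHS]expr2 ind_sq.
  rewrite -EFinM lee_fin -expr2 /dq expr_div_n.
  have := ftc_holder fg (x := x) (y := x + d) (ltac:(lra)).
  rewrite addrAC subrr add0r => H.
  have H2 : (f (x + d) - f x) ^+ 2 <= d * n2 (fun z : R => ind x (x + d) z * g z) ^+ 2.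
    rewrite -[X in X * _](sqr_sqrtr (ltW d0)) -exprMn -(real_normK (num_real (_ - _))).
    by rewrite ler_pXn2r// nnegrE// mulr_ge0// ?sqrtr_ge0 ?n2_ge0.
  rewrite ler_pdivrMr ?exprn_gt0//; apply: (le_trans H2).
  by rewrite le_eqVlt; apply/orP; left; apply/eqP; field; exact: lt0r_neq0.
rewrite ge0_integralZl//; last 3 first.
- exact: measurable_econv (mfun_ind _ _) mg2 k0 (fun x => sqr_ge0 _).
- by move=> x _; apply: integral_ge0 => y _; rewrite lee_fin mulr_ge0// sqr_ge0.
- by rewrite lee_fin invr_ge0 ltW.
rewrite conv_tonelli//; [|exact: mfun_ind|by move=> x; exact: sqr_ge0].
rewrite int_ind; last lra.
rewrite muleA -EFinM (_ : d^-1 * _ = 1); last by rewrite sub0r opprK mulVf// lt0r_neq0.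
by rewrite mul1e.
Qed.
End DifferenceQuotients.

Section StrongDerivative.
Context {R : realType}.
Local Notation mu := (@lebesgue_measure R).
Local Notation RR := (measurableTypeR R).
Implicit Types f g : R -> R.

Lemma l2_locally_integrable g : l2 g -> locally_integrable [set: R] g.
Proof.
move=> hg; split; [exact: l2_mfun|exact: openT|move=> K _ cK].
have mK : measurable K by exact: compact_measurable.
have bK : (mu K < +oo)%E by exact: compact_finite_measure.
have mg := l2_mfun hg.
apply: (@le_lt_trans _ _ (\int[mu]_(x in K) (1 + g x ^+ 2)%:E)%E).
  apply: ge0_le_integral => //.
  - by apply/measurable_EFinP; apply: measurable_funTS; exact: mfun_abs.
  - apply/measurable_EFinP; apply: measurable_funTS; apply: mfunD; first exact: mfun_cst.
    exact: mfunX.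
  move=> x _; rewrite lee_fin -(real_normK (num_real (g x))).
  by have := sqr_ge0 (`|g x| - 1); have := normr_ge0 (g x); nra.
under eq_integral do rewrite EFinD.
rewrite ge0_integralD//.
- rewrite lte_add_pinfty//; first by rewrite integral_cst// mul1e.
  case/integrableP : (l2_sq hg) => _; apply: le_lt_trans.
  rewrite [leRHS](_ : _ = \int[mu]_x (g x ^+ 2)%:E)%E; last first.
    by apply: eq_integral => x _; rewrite /= ger0_norm// sqr_ge0.
  apply: ge0_subset_integral => //.
  by apply/measurable_EFinP; apply: mfunX.
- by move=> x _; rewrite lee_fin sqr_ge0.
- by move=> x _; rewrite lee_fin sqr_ge0.
- by apply/measurable_EFinP; apply: measurable_funTS; apply: mfunX.
Qed.

Lemma l2_itv_integrable g a b : l2 g -> mu.-integrable `[a, b] (EFin \o g).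
Proof.
move=> hg; apply/integrable_mkcond => //.
have := l2M (l2_ind a b) hg; congr (mu.-integrable _ _); apply/funext => x /=.
by rewrite /patch /ind indicE; case: ifPn => _; rewrite ?mul1r ?mul0r.
Qed.

Lemma ftc_ae_deriv f g : ftc f g ->
  {ae mu, forall x : RR, dq d f x @[d --> 0^'] --> (g x : R)}.
Proof.
move=> fg; have [hf hg fgE] := fg.
have := lebesgue_differentiation (l2_locally_integrable hg).
apply: ae_sub => x /= gx.
have ax : x - 1 < x by lra.
(* Near $x$ the primitive based at $x - 1$ differs from $f$ by a constant. *)
have [] := @FTC1_lebesgue_pt R g (BLeft (x - 1)) x (x + 1) (ltac:(lra))
  (l2_itv_integrable (x - 1) (x + 1) hg) ax gx.
set F := (fun y => _) => /cvg_ex[l Fl] dF.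
have E : (fun h : R => h^-1 *: ((F \o shift x) (h *: 1) - F x)) =
    (fun h => h^-1 *: (F (h + x) - F x)).
  by apply/funext => h; rewrite /= /shift/= /GRing.scale/= mulr1.
rewrite E in Fl.
have El : l = g x by rewrite -dF; apply/esym/cvg_lim.
rewrite -El; apply: cvg_trans Fl.
suff H : {near 0^', (fun h => h^-1 *: (F (h + x) - F x)) =1 (fun d => dq d f x)}.
  exact: (near_eq_cvg H).
near=> h.
have h1 : `|h| < 1 by near: h; apply: dnbhs0_lt.
have FE y : x - 1 <= y -> F y = f y - f (x - 1) by move=> xy; rewrite fgE.
rewrite /dq /= [h + x]addrC !FE; last 2 first.
- by lra.
- by have := ler_norm (- h); rewrite normrN; lra.
by rewrite /GRing.scale/= [RHS]mulrC; congr (_ * _); ring.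
Unshelve. all: by end_near. Qed.

(** Almost everywhere convergence and the norm bound [n2_dq_le] together give strong convergence
    along every sequence of steps, by [radon_riesz]. *)
Lemma ftc_sd f g : ftc f g -> sd f g.
Proof.
move=> fg; have [hf hg _] := fg; split => //.
apply/cvgr_dnbhsP => u [u0 ucvg].
apply: radon_riesz => //.
- by move=> n; exact: l2_dq.
- by move=> n; exact: n2_dq_le.
apply: ae_sub (ftc_ae_deriv fg) => x /= H.
by move/cvgr_dnbhsP : H; apply.
Qed.

Lemma n2_shift_iter f e n : l2 f ->
  n2 (fun x => f (x + e *+ n) - f x) <= n%:R * n2 (fun x => f (x + e) - f x).
Proof.
move=> hf; have hs d : l2 (fun x => f (x + d) - f x) by apply: l2B => //; exact: l2_sh.
elim: n => [|n IH].
  rewrite mul0r (_ : (fun x => _) = (fun=> 0)) ?n2_0//.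
  by apply/funext => x; rewrite mulr0n addr0 subrr.
rewrite (_ : (fun x => _) = (fun x => (f (x + e *+ n + e) - f (x + e *+ n)) +
    (f (x + e *+ n) - f x))); last first.
  by apply/funext => x; rewrite mulrSr addrA; ring.
apply: (le_trans (n2D _ _)) => //; first exact: (l2_sh (e *+ n) (hs e)).
rewrite (n2_sh (e *+ n) (hs e)) -natr1 mulrDl mul1r addrC lerD2r//.
Qed.

(** A shift by $d$ is $n+1$ shifts by $d/(n+1)$, so the quotient of step $d$ is bounded in $L^2$ by
    that of step $d/(n+1)$, whose norm tends to $\|g\|$. This extends [n2_dq_le] to functions known
    only modulo null sets. *)
Lemma sd_bound f g d : sd f g -> n2 (dq d f) <= n2 g.
Proof.
(* At step 0 the quotient is 0, as the inverse of 0 is 0. *)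
move=> [hf hg fg]; have [->|d0] := eqVneq d 0.
  rewrite (_ : dq 0 f = (fun=> 0)) ?n2_0 ?n2_ge0//.
  by apply/funext => x; rewrite /dq invr0 mulr0.
have hd c : l2 (dq c f) by exact: l2_dq.
pose e (n : nat) := d / n.+1%:R.
have e0 n : e n != 0 by rewrite mulf_neq0// invr_eq0 pnatr_eq0.
have ecvg : e n @[n --> \oo] --> 0.
  rewrite -(mulr0 d); apply: cvgM; first exact: cvg_cst.
  exact: cvg_harmonic.
have H n : n2 (dq d f) <= n2 g + n2 (fun x => dq (e n) f x - g x).
  have H1 : n2 (dq d f) <= n2 (dq (e n) f).
    have hs c : l2 (fun x => f (x + c) - f x) by apply: l2B => //; exact: l2_sh.
    have E c : dq c f = (fun x => c^-1 * (f (x + c) - f x)).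
      by apply/funext => x; rewrite /dq mulrC.
    rewrite !E !n2Z//.
    have := n2_shift_iter (e n) n.+1 hf.
    rewrite (_ : e n *+ n.+1 = d); last by rewrite /e -mulr_natr divfK// pnatr_eq0.
    move=> H1; rewrite (le_trans (ler_wpM2l _ H1))//.
    rewrite mulrA ler_wpM2r ?n2_ge0// /e invfM invrK normrM.
    by rewrite (ger0_norm (ler0n R n.+1)).
  apply: (le_trans H1).
  rewrite [X in n2 X <= _](_ : _ = (fun x => g x + (dq (e n) f x - g x))); last first.
    by apply/funext => x; ring.
  by apply: n2D => //; apply: l2B.
have lim : n2 g + n2 (fun x => dq (e n) f x - g x) @[n --> \oo] --> n2 g + 0.
  apply: cvgD; first exact: cvg_cst.
  by move/cvgr_dnbhsP : fg; apply.
rewrite -[leRHS]addr0 -(cvg_lim _ lim)//; apply: limr_ge; first by apply/cvg_ex; eexists; exact: lim.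
by apply: nearW.
Qed.

End StrongDerivative.

(** * Strong and uniform convergence along a filter *)

Section NetConvergence.
Context {R : realType}.
Context {I : Type} (F : set_system I) {FF : Filter F}.

Lemma squeeze0 (u v : I -> R) : (forall i, 0 <= u i <= v i) ->
  v i @[i --> F] --> 0 -> u i @[i --> F] --> 0.
Proof.
move=> uv v0; apply: (squeeze_cvgr _ (cvg_cst 0) v0).
by apply: nearW.
Qed.

Lemma squeeze0' (u v : I -> R) (l : R) : v i @[i --> F] --> l -> l = 0 ->
  (forall i, 0 <= u i <= v i) -> u i @[i --> F] --> 0.
Proof. by move=> vl l0; rewrite l0 in vl => uv; exact: squeeze0 uv vl. Qed.

Lemma cvg_near_eq (u v : I -> R) (l : R) : (\forall i \near F, u i = v i) ->
  u i @[i --> F] --> l -> v i @[i --> F] --> l.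
Proof. by move=> uv; apply: cvg_trans; exact: near_eq_cvg. Qed.

Definition cv2 (f_ : I -> R -> R) (f : R -> R) := [/\ forall i, l2 (f_ i), l2 f &
  n2 (fun x => f_ i x - f x) @[i --> F] --> (0 : R)].

(** Uniform convergence to a bounded limit, with [e] as a majorant of the sup norm of the
    difference. Such nets multiply $L^2$-convergent ones, see [cvU_cv2]. *)
Definition cvU (h_ : I -> R -> R) (h : R -> R) := [/\ forall i, mfun (h_ i), mfun h,
  exists C : R, forall x, `|h x| <= C &
  exists2 e : I -> R, e i @[i --> F] --> (0 : R) &
    forall i x, `|h_ i x - h x| <= e i].

Lemma cv2_cst f : l2 f -> cv2 (fun=> f) f.
Proof.
move=> hf; split => //.
under eq_fun do (rewrite (_ : (fun x => _) = (fun=> 0)) ?n2_0; last by apply/funext => x; rewrite subrr).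
exact: cvg_cst.
Qed.

Lemma cv2D f_ g_ f g : cv2 f_ f -> cv2 g_ g ->
  cv2 (fun i x => f_ i x + g_ i x) (fun x => f x + g x).
Proof.
move=> [hf_ hf fc] [hg_ hg gc]; split => [i||]; [exact: l2D..|].
apply: (squeeze0' (cvgD fc gc) (addr0 _)) => i; rewrite n2_ge0/=.
rewrite (_ : (fun x => _) = (fun x => (f_ i x - f x) + (g_ i x - g x))); last first.
  by apply/funext => x; ring.
by apply: n2D; exact: l2B.
Qed.

Lemma cv2Z (c : R) f_ f : cv2 f_ f -> cv2 (fun i x => c * f_ i x) (fun x => c * f x).
Proof.
move=> [hf_ hf fc]; split => [i||]; [exact: l2Z..|].
apply: (squeeze0' (cvgM (cvg_cst `|c|) fc) (mulr0 _)) => i; rewrite n2_ge0/=.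
rewrite (_ : (fun x => _) = (fun x => c * (f_ i x - f x))); last first.
  by apply/funext => x; ring.
by rewrite n2Z//; exact: l2B.
Qed.

Lemma cv2N f_ f : cv2 f_ f -> cv2 (fun i x => - f_ i x) (fun x => - f x).
Proof.
move=> /(cv2Z (-1)); have -> : (fun i x => -1 * f_ i x) = (fun i x => - f_ i x).
  by apply/funext => i; apply/funext => x; ring.
by have -> : (fun x => -1 * f x) = (fun x => - f x) by apply/funext => x; ring.
Qed.

Lemma cv2B f_ g_ f g : cv2 f_ f -> cv2 g_ g ->
  cv2 (fun i x => f_ i x - g_ i x) (fun x => f x - g x).
Proof. by move=> hf /cv2N hg; exact: cv2D. Qed.

Lemma cv2_ip f_ g_ f g : cv2 f_ f -> cv2 g_ g ->
  ip (f_ i) (g_ i) @[i --> F] --> ip f g.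
Proof.
move=> [hf_ hf fc] [hg_ hg gc].
apply/subr_cvg0.
have E i : ip (f_ i) (g_ i) - ip f g =
   ip (fun x => f_ i x - f x) (fun x => g_ i x - g x) +
   (ip (fun x => f_ i x - f x) g + ip f (fun x => g_ i x - g x)).
  have hfi := hf_ i; have hgi := hg_ i.
  have hfB := l2B hfi hf; have hgB := l2B hgi hg.
  rewrite (ipBr hgi hg hfB) (ipBl hfi hf hgi) (ipBl hfi hf hg) (ipBr hgi hg hf).
  by ring.
under eq_fun do rewrite E.
pose v i := n2 (fun x => f_ i x - f x) * n2 (fun x => g_ i x - g x) +
  (n2 (fun x => f_ i x - f x) * n2 g + n2 f * n2 (fun x => g_ i x - g x)).
have v0 : v i @[i --> F] --> 0.
  have -> : 0 = 0 * 0 + (0 * n2 g + n2 f * 0) :> R by ring.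
  apply: cvgD; first exact: cvgM.
  by apply: cvgD; apply: cvgM => //; exact: cvg_cst.
apply/norm_cvg0P; apply: (squeeze0 _ v0) => i; rewrite normr_ge0/=.
rewrite (le_trans (ler_normD _ _))//; apply: lerD.
  by apply: ip_le_n2; exact: l2B.
rewrite (le_trans (ler_normD _ _))//; apply: lerD; apply: ip_le_n2 => //; exact: l2B.
Qed.

Lemma cvU_cst h C : mfun h -> (forall x, `|h x| <= C) -> cvU (fun=> h) h.
Proof.
move=> mh hC; split => //; first by exists C.
exists (fun=> 0); first exact: cvg_cst.
by move=> i x; rewrite subrr normr0.
Qed.

Lemma cvUD h_ k_ h k : cvU h_ h -> cvU k_ k ->
  cvU (fun i x => h_ i x + k_ i x) (fun x => h x + k x).
Proof.
move=> [mh_ mh [C hC] [e e0 he]] [mk_ mk [D kD] [d d0 kd]].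
split; [by move=> i; exact: mfunD|exact: mfunD| |].
  by exists (C + D) => x; rewrite (le_trans (ler_normD _ _))// lerD.
exists (fun i => e i + d i); first by rewrite -(addr0 0); exact: cvgD.
move=> i x; rewrite opprD addrACA (le_trans (ler_normD _ _))// lerD//.
Qed.

Lemma cvUM h_ k_ h k : cvU h_ h -> cvU k_ k ->
  cvU (fun i x => h_ i x * k_ i x) (fun x => h x * k x).
Proof.
move=> [mh_ mh [C hC] [e e0 he]] [mk_ mk [D kD] [d d0 kd]].
split; [by move=> i; exact: mfunM|exact: mfunM| |].
  by exists (C * D) => x; rewrite normrM ler_pM.
exists (fun i => e i * d i + (e i * D + C * d i)).
  have -> : 0 = 0 * 0 + (0 * D + C * 0) :> R by ring.
  apply: cvgD; first exact: cvgM.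
  by apply: cvgD; apply: cvgM => //; exact: cvg_cst.
move=> i x.
have -> : h_ i x * k_ i x - h x * k x = (h_ i x - h x) * (k_ i x - k x) +
  ((h_ i x - h x) * k x + h x * (k_ i x - k x)) by ring.
rewrite (le_trans (ler_normD _ _))// lerD//; first by rewrite normrM ler_pM.
by rewrite (le_trans (ler_normD _ _))// !normrM lerD// ler_pM.
Qed.

Lemma cvU_cv2 h_ f_ h f : cvU h_ h -> cv2 f_ f ->
  cv2 (fun i x => h_ i x * f_ i x) (fun x => h x * f x).
Proof.
move=> [mh_ mh [C hC] [e e0 he]] [hf_ hf fc].
have hiC i x : `|h_ i x| <= e i + C.
  have -> : h_ i x = (h_ i x - h x) + h x by ring.
  by rewrite (le_trans (ler_normD _ _))// lerD.
split.
- by move=> i; exact: (@l2Mb _ (e i + C)).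
- exact: (@l2Mb _ C).
have v0 : (e i + C) * n2 (fun x => f_ i x - f x) + e i * n2 f @[i --> F] --> 0.
  have -> : 0 = (0 + C) * 0 + 0 * n2 f :> R by ring.
  apply: cvgD; apply: cvgM => //; last exact: cvg_cst.
  by apply: cvgD => //; exact: cvg_cst.
apply: (squeeze0 _ v0) => i; rewrite n2_ge0/=.
rewrite (_ : (fun x => _) = (fun x => h_ i x * (f_ i x - f x) + (h_ i x - h x) * f x)); last first.
  by apply/funext => x; ring.
have hB : l2 (fun x => f_ i x - f x) by exact: l2B.
have md : mfun (fun x => h_ i x - h x) by exact: mfunB.
apply: (le_trans (n2D _ _)).
- exact: (@l2Mb _ (e i + C)).
- exact: (@l2Mb _ (e i)).
by rewrite lerD// ?n2Mb.
Qed.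

(** Convergence jointly in the step and the function: in $D_d f_i - g = D_d(f_i - f) + (D_d f - g)$
    the first term is at most $\|g_i - g\|$, whatever the step, by [sd_bound]. *)
Lemma cv2_dq (d : I -> R) (f_ g_ : I -> R -> R) (f g : R -> R) : d i @[i --> F] --> (0 : R)^' ->
  (forall i, sd (f_ i) (g_ i)) -> sd f g -> 
  (forall i, sd (fun x => f_ i x - f x) (fun x => g_ i x - g x)) ->
  cv2 g_ g -> cv2 (fun i => dq (d i) (f_ i)) g.
Proof.
move=> dc' sf_ sf sfB [hg_ hg gc].
have [hf _ fg] := sf.
have hf_ i : l2 (f_ i) by case: (sf_ i).
split => //; first by move=> i; exact: l2_dq.
have c1 := cvg_comp _ _ dc' fg.
apply: (squeeze0' (cvgD gc c1) (addr0 _)) => i; rewrite n2_ge0/=.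
have E : dq (d i) (f_ i) = (fun x => dq (d i) (fun y => f_ i y - f y) x + dq (d i) f x).
  by apply/funext => x; rewrite /dq -mulrDl; congr (_ / _); ring.
rewrite (_ : (fun x => _) =
    (fun x => dq (d i) (fun y => f_ i y - f y) x + (dq (d i) f x - g x))); last first.
  by rewrite E; apply/funext => x; ring.
apply: (le_trans (n2D _ _)).
- by apply: l2_dq; exact: l2B.
- by apply: l2B => //; exact: l2_dq.
by rewrite lerD2r; apply: sd_bound.
Qed.

End NetConvergence.

(** * Calculus of strong derivatives *)

Section SdAlgebra.
Context {R : realType}.
Implicit Types f g h : R -> R.

Lemma sdP f g : sd f g <-> [/\ l2 f, l2 g & cv2 (0 : R)^' (fun d => dq d f) g].
Proof.
split=> [[hf hg c]|[hf hg [_ _ c]]]; split => //; split => // d.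
exact: l2_dq.
Qed.

Lemma sdD f1 g1 f2 g2 : sd f1 g1 -> sd f2 g2 ->
  sd (fun x => f1 x + f2 x) (fun x => g1 x + g2 x).
Proof.
move=> /sdP[a1 b1 c1] /sdP[a2 b2 c2]; apply/sdP; split; [exact: l2D..|].
rewrite (_ : (fun d => _) = (fun d x => dq d f1 x + dq d f2 x)); first exact: cv2D.
apply/funext => d; apply/funext => x.
by rewrite /dq -mulrDl; congr (_ / _); ring.
Qed.

Lemma sdZ c f g : sd f g -> sd (fun x => c * f x) (fun x => c * g x).
Proof.
move=> /sdP[a1 b1 c1]; apply/sdP; split; [exact: l2Z..|].
rewrite (_ : (fun d => _) = (fun d x => c * dq d f x)); first exact: cv2Z.
apply/funext => d; apply/funext => x.
by rewrite /dq mulrA; congr (_ / _); ring.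
Qed.

Lemma sdN f g : sd f g -> sd (fun x => - f x) (fun x => - g x).
Proof.
move=> /(sdZ (-1)); have -> : (fun x => -1 * f x) = (fun x => - f x).
  by apply/funext => x; ring.
by have -> : (fun x => -1 * g x) = (fun x => - g x) by apply/funext => x; ring.
Qed.

Lemma sdB f1 g1 f2 g2 : sd f1 g1 -> sd f2 g2 ->
  sd (fun x => f1 x - f2 x) (fun x => g1 x - g2 x).
Proof. by move=> h1 /sdN h2; exact: sdD. Qed.

Lemma sd_sh c f g : sd f g -> sd (fun x => f (x + c)) (fun x => g (x + c)).
Proof.
move=> [a1 b1 c1]; split; [exact: l2_sh..|].
apply: cvg_trans c1; apply: near_eq_cvg; near=> d.
rewrite -(n2_sh c); last by apply: l2B => //; exact: l2_dq.
by congr n2; apply/funext => x; rewrite /dq addrAC.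
Unshelve. all: by end_near. Qed.

Lemma n2_sh_sub f g d : sd f g -> n2 (fun x => f (x + d) - f x) <= `|d| * n2 g.
Proof.
move=> fg; have [hf hg _] := fg.
have [->|d0] := eqVneq d 0.
  rewrite normr0 mul0r (_ : (fun x => _) = (fun=> 0)) ?n2_0//.
  by apply/funext => x; rewrite addr0 subrr.
have -> : (fun x => f (x + d) - f x) = (fun x => d * dq d f x).
  by apply/funext => x; rewrite /dq; field.
rewrite n2Z; last exact: l2_dq.
by rewrite ler_wpM2l//; exact: sd_bound.
Qed.

(** The shift costs $|d_i|$ times the norm of the derivative of $f_i$, hence the uniform bound on
    the $g_i$. *)
Lemma cv2_sh {I : Type} (F : set_system I) {FF : Filter F} (d : I -> R) (f_ g_ : I -> R -> R) f :
  d i @[i --> F] --> (0 : R) -> (forall i, sd (f_ i) (g_ i)) ->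
  cv2 F f_ f -> (exists C : R, forall i, n2 (g_ i) <= C) ->
  cv2 F (fun i x => f_ i (x + d i)) f.
Proof.
move=> dc sf [hf_ hf fc] [C gC]; split => //; first by move=> i; exact: l2_sh.
have v0 : `|d i| * C + n2 (fun x => f_ i x - f x) @[i --> F] --> 0.
  have -> : 0 = `|0 : R| * C + 0 by rewrite normr0; ring.
  by apply: cvgD => //; apply: cvgM; [exact: cvg_norm|exact: cvg_cst].
apply: (squeeze0 _ v0) => i; rewrite n2_ge0/=.
rewrite (_ : (fun x => _) = (fun x => (f_ i (x + d i) - f_ i x) + (f_ i x - f x))); last first.
  by apply/funext => x; ring.
apply: (le_trans (n2D _ _)).
- by apply: l2B => //; exact: l2_sh.
- exact: l2B.
rewrite lerD2r (le_trans (n2_sh_sub (d i) (sf i)))// ler_wpM2l//.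
Qed.

(** For $d \ne 0$ the sum $\langle D_d f_1, f_2(\cdot + d)\rangle + \langle f_1, D_d f_2\rangle$ is
    exactly 0 by translation invariance; then $d$ tends to 0. *)
Lemma sd_ibp f1 g1 f2 g2 : sd f1 g1 -> sd f2 g2 -> ip g1 f2 + ip f1 g2 = 0.
Proof.
move=> s1 s2; have /sdP[a1 b1 c1] := s1; have /sdP[a2 b2 c2] := s2.
have E d : d != 0 -> ip (dq d f1) (fun x => f2 (x + d)) + ip f1 (dq d f2) = 0.
  move=> d0.
  have E1 c f : dq c f = (fun x => c^-1 * (f (x + c) - f x)).
    by apply/funext => x; rewrite /dq mulrC.
  have hs c f : l2 f -> l2 (fun x => f (x + c)) by exact: l2_sh.
  have hs' c f : l2 f -> l2 (fun x => f (x + c) - f x) by move=> ?; apply: l2B => //; exact: hs.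
  rewrite !E1 ipZl ?ipZr; [|by auto..].
  rewrite ipBl ?ipBr; [|by auto..].
  have -> : ip (fun x => f1 (x + d)) (fun x => f2 (x + d)) = ip f1 f2.
    by rewrite /ip (intg_sh (f := fun x => f1 x * f2 x))//; apply: mfunM; exact: l2_mfun.
  by ring.
have sh2 : cv2 (0 : R)^' (fun d x => f2 (x + d)) f2.
  apply: (@cv2_sh R ((0 : R)^') _ id (fun=> f2) (fun=> g2)) => //.
  - exact: nbhs_dnbhs.
  - exact: cv2_cst.
  - by exists (n2 g2).
have L : ip (dq d f1) (fun x => f2 (x + d)) + ip f1 (dq d f2) @[d --> (0 : R)^']
    --> ip g1 f2 + ip f1 g2.
  apply: cvgD; first exact: (@cv2_ip R R ((0 : R)^') _ _ _ _ _ c1 sh2).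
  exact: (@cv2_ip R R ((0 : R)^') _ _ _ _ _ (cv2_cst a1) c2).
have Z : ip (dq d f1) (fun x => f2 (x + d)) + ip f1 (dq d f2) @[d --> (0 : R)^']
    --> (0 : R).
  apply: (@cvg_near_eq R R ((0 : R)^') _ (fun=> 0)); last exact: cvg_cst.
  by near=> d; rewrite E//; near: d; exact: nbhs_dnbhs_neq.
by rewrite -(cvg_lim (@Rhausdorff R) L) (cvg_lim (@Rhausdorff R) Z).
Unshelve. all: by end_near. Qed.
End SdAlgebra.

(** * Smooth cut-off functions *)

Section SmoothStep.
Context {R : realType}.
Implicit Types f g : R -> R.

Definition hasd f (x l : R) := is_derive (x : R^o) (1 : R^o) (f : R^o -> R^o) (l : R^o).

Lemma hasd_cst (c x : R) : hasd (fun=> c) x 0.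
Proof. exact: is_derive_cst. Qed.
Lemma hasd_id (x : R) : hasd (fun y => y) x 1.
Proof. exact: is_derive_id. Qed.
Lemma hasdD f g x a b : hasd f x a -> hasd g x b -> hasd (fun y => f y + g y) x (a + b).
Proof. exact: is_deriveD. Qed.
Lemma hasdM f g x a b : hasd f x a -> hasd g x b ->
  hasd (fun y => f y * g y) x (f x * b + g x * a).
Proof. exact: is_deriveM. Qed.
Lemma hasdN f x a : hasd f x a -> hasd (fun y => - f y) x (- a).
Proof. exact: is_deriveN. Qed.
Lemma hasdV f x a : f x != 0 -> hasd f x a -> hasd (fun y => (f y)^-1) x (- (f x) ^- 2 * a).
Proof. exact: is_deriveV. Qed.
Lemma hasd_comp f g x a b : hasd f (g x) a -> hasd g x b -> hasd (fun y => f (g y)) x (a * b).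
Proof. exact: is_derive1_comp. Qed.
Lemma hasd_eq f x a b : hasd f x a -> a = b -> hasd f x b.
Proof. by move=> ? <-. Qed.
Lemma hasd_near f g x a : (\forall y \near x, f y = g y) -> hasd f x a -> hasd g x a.
Proof. exact: near_eq_is_derive. Qed.
Lemma hasd_derive1 f x a : hasd f x a -> derive1 f x = a.
Proof. by move=> h; rewrite derive1E; apply: derive_val. Qed.
Lemma hasd_derivable f x a : hasd f x a -> derivable (f : R^o -> R^o) x 1.
Proof. by case. Qed.
Lemma hasd_continuous f x a : hasd f x a -> {for x, continuous f}.
Proof.
by case=> h _; apply: differentiable_continuous; apply/derivable1_diffP.
Qed.
Lemma hasdX f n x a : hasd f x a -> hasd (fun y => f y ^+ n) x (n%:R * f x ^+ n.-1 * a).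
Proof.
move=> h; elim: n => [|n IH].
  rewrite (_ : (fun y => _) = (fun=> 1)); last by apply/funext => y; rewrite expr0.
  by apply: hasd_eq; [exact: hasd_cst|rewrite !mul0r].
rewrite (_ : (fun y => _) = (fun y => f y * f y ^+ n)); last first.
  by apply/funext => y; rewrite exprS.
apply: hasd_eq; first exact: hasdM h IH.
by rewrite /=; case: n {IH} => [|n]; rewrite ?expr0 ?exprS/=; ring.
Qed.

(** Differentiability of order $n$ with the derivatives supplied as functions, which makes closure
    under sums, products and inverses an induction; [smoothn_derivable] returns to iterated
    [derive1]. *)
Fixpoint smoothn (n : nat) f : Prop :=
  if n is n.+1 then exists2 f' : R -> R, (forall x : R, hasd f x (f' x)) & smoothn n f'
  else True.

Lemma smoothnS n f : smoothn n.+1 f -> smoothn n f.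
Proof.
elim: n f => // n IH f [f' df sf]; exists f' => //; exact: IH.
Qed.

Lemma smoothn_derivable f : (forall n, smoothn n f) ->
  forall n x, derivable (derive1n n f : R^o -> R^o) x 1.
Proof.
move=> sf n x; move: (sf n.+1) => {sf}.
elim: n f => [|n IH] f [f' df sf]; first exact: hasd_derivable (df x).
rewrite /derive1n iterSr; apply: IH.
suff -> : derive1 f = f' by [].
by apply/funext => y; exact: hasd_derive1.
Qed.

Lemma smoothn_cst n (c : R) : smoothn n (fun=> c).
Proof. elim: n c => // n IH c; exists (fun=> 0) => // x; exact: hasd_cst. Qed.

Lemma smoothnD n f g : smoothn n f -> smoothn n g -> smoothn n (fun x => f x + g x).
Proof.
elim: n f g => // n IH f g [f' df sf] [g' dg sg].
exists (fun x => f' x + g' x); last exact: IH.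
by move=> x; apply: hasdD.
Qed.

Lemma smoothnM n f g : smoothn n f -> smoothn n g -> smoothn n (fun x => f x * g x).
Proof.
elim: n f g => // n IH f g sf sg; have [f' df sf'] := sf; have [g' dg sg'] := sg.
exists (fun x => f x * g' x + g x * f' x); first by move=> x; apply: hasdM.
by apply: smoothnD; apply: IH => //; exact: smoothnS.
Qed.

Lemma smoothnN n f : smoothn n f -> smoothn n (fun x => - f x).
Proof.
move=> /(smoothnM (smoothn_cst n (-1))); congr smoothn.
by apply/funext => x; rewrite mulN1r.
Qed.

Lemma smoothnV n f : (forall x, f x != 0) -> smoothn n f -> smoothn n (fun x => (f x)^-1).
Proof.
move=> f0; elim: n => // n IH sf; have [f' df sf'] := sf.
exists (fun x => - ((f x)^-1 * (f x)^-1) * f' x).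
  move=> x; apply: hasd_eq; first exact: hasdV (f0 x) (df x).
  by rewrite -invfM expr2.
apply: smoothnM => //; apply: smoothnN; apply: smoothnM; apply: IH; exact: smoothnS.
Qed.

Lemma smoothn_affine n f (k c : R) : smoothn n f -> smoothn n (fun x => f (k * x + c)).
Proof.
elim: n f => // n IH f [f' df sf].
exists (fun x => f' (k * x + c) * k).
  move=> x; have D : hasd (fun x => k * x + c) x k.
    apply: hasd_eq; first exact: hasdD (hasdM (hasd_cst k x) (hasd_id x)) (hasd_cst c x).
    by rewrite !mulr0 !addr0 mulr1.
  exact: (hasd_comp (df _) D).
by apply: smoothnM; [exact: IH|exact: smoothn_cst].
Qed.

(* x^-k exp(-1/x) for x > 0: closed under differentiation up to linear combinations. *)
Definition flat (k : nat) (x : R) : R := if 0 < x then x^-1 ^+ k * expR (- x^-1) else 0.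

Lemma flat_ge0 k x : 0 <= flat k x.
Proof.
rewrite /flat; case: ltP => // x0; rewrite mulr_ge0 ?expR_ge0//.
by rewrite exprn_ge0// invr_ge0 ltW.
Qed.

Lemma flat_gt0 k x : 0 < x -> 0 < flat k x.
Proof. by move=> x0; rewrite /flat x0 mulr_gt0 ?expR_gt0// exprn_gt0// invr_gt0. Qed.

Lemma flat_eq0 k x : x <= 0 -> flat k x = 0.
Proof. by rewrite /flat; case: ltP. Qed.

(** From $e^y \ge y^{k+2}/(k+2)!$ with $y = 1/x$. Being quadratic, the bound makes the derivative at
    0 exist and vanish. *)
Lemma flat_le k x : `|flat k x| <= (k.+2)`!%:R * x ^+ 2.
Proof.
rewrite ger0_norm ?flat_ge0// /flat; case: ltP => x0; last by rewrite mulr_ge0// sqr_ge0.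
set y := x^-1; have y0 : 0 < y by rewrite invr_gt0.
have := expR_ge1Dxn k.+1 (ltW y0) => H.
have F0 : 0 < (k.+2)`!%:R :> R by rewrite ltr0n fact_gt0.
have H2 : y ^+ k.+2 <= (k.+2)`!%:R * expR y.
  rewrite mulrC -ler_pdivrMr//; apply: le_trans H; lra.
have -> : x ^+ 2 = (y ^+ 2)^-1 by rewrite /y exprVn invrK.
rewrite expRN ler_pdivrMr ?expR_gt0// mulrAC ler_pdivlMr ?exprn_gt0//.
by rewrite -exprD addn2.
Qed.

Lemma hasd_flat k (x : R) : hasd (flat k) x (flat k.+2 x - k%:R * flat k.+1 x).
Proof.
have [x0|x0|->] := ltgtP x 0.
- rewrite !flat_eq0 ?ltW// mulr0 subr0.
  apply: (@hasd_near (fun=> 0)); last exact: hasd_cst.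
  near=> y; rewrite flat_eq0//; apply: ltW; near: y.
  exact: lt_nbhsl.
- apply: (@hasd_near (fun x => x^-1 ^+ k * expR (- x^-1))).
    near=> y; rewrite /flat ifT//; near: y; exact: lt_nbhsr.
  have dV : hasd (fun y : R => y^-1) x (- x ^- 2).
    by apply: hasd_eq; first (apply: hasdV (hasd_id x); rewrite gt_eqF//); rewrite mulr1.
  have dE : hasd (fun y : R => expR (- y^-1)) x (expR (- x^-1) * x ^- 2).
    have dN : hasd (fun y : R => - y^-1) x (x ^- 2).
      by apply: hasd_eq; [exact: (hasdN dV)|rewrite opprK].
    exact: (hasd_comp (is_derive_expR _) dN).
  apply: hasd_eq; first exact: (hasdM (hasdX k dV) dE).
  rewrite /flat x0 -!exprVn.
  case: k => [|k]; first by rewrite /=; ring.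
  by rewrite /= !exprS; ring.
rewrite !flat_eq0// mulr0 subr0.
have L : h^-1 *: (flat k (h *: (1 : R) + 0) - flat k 0) @[h --> (0 : R)^'] --> (0 : R).
  apply/norm_cvg0P.
  apply: (@squeeze0 R R ((0 : R)^') _ _ (fun h => `|(k.+2)`!%:R * h|)).
    move=> h; rewrite normr_ge0/= addr0 [flat k 0]flat_eq0// subr0 /GRing.scale/= mulr1.
    have [->|h0] := eqVneq h 0; first by rewrite invr0 mul0r normr0.
    rewrite normrM normfV ler_pdivrMl ?normr_gt0//.
    apply: (le_trans (flat_le k h)); rewrite le_eqVlt; apply/orP; left; apply/eqP.
    by rewrite normrM (ger0_norm (ler0n R _)) -(real_normK (num_real h)); ring.
  have H : (k.+2)`!%:R * h @[h --> (0 : R)^'] --> (k.+2)`!%:R * (0 : R).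
    by apply: cvgM; [exact: cvg_cst|exact: nbhs_dnbhs].
  by rewrite mulr0 in H; exact/norm_cvg0P.
constructor; first by apply/cvg_ex; exists 0.
exact: cvg_lim L.
Unshelve. all: by end_near. Qed.

Lemma smoothn_flat n k : smoothn n (flat k).
Proof.
elim: n k => // n IH k; exists (fun x => flat k.+2 x - k%:R * flat k.+1 x).
  exact: hasd_flat.
apply: smoothnD => //; apply: smoothnN; apply: smoothnM => //; exact: smoothn_cst.
Qed.

(** A smooth transition from 0 to 1 over $[0,1]$; the denominator is positive because $x$ and $1 -
    x$ are not both nonpositive. *)
Definition step (x : R) : R := flat 0 x / (flat 0 x + flat 0 (1 - x)).

Lemma step_denom x : 0 < flat 0 x + flat 0 (1 - x).
Proof.
have [x0|x0] := ltP 0 x.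
  by rewrite ltr_wpDr ?flat_ge0// flat_gt0.
by rewrite ltr_wpDl ?flat_ge0// flat_gt0//; lra.
Qed.

Lemma smooth_step n : smoothn n step.
Proof.
apply: smoothnM; first exact: smoothn_flat.
apply: smoothnV => [x|]; first by rewrite gt_eqF// step_denom.
apply: smoothnD; first exact: smoothn_flat.
have := smoothn_affine (-1) 1 (smoothn_flat n 0); congr smoothn.
by apply/funext => x; congr flat; ring.
Qed.

Lemma step_le0 x : x <= 0 -> step x = 0.
Proof. by move=> x0; rewrite /step flat_eq0// mul0r. Qed.
Lemma step_ge1 x : 1 <= x -> step x = 1.
Proof.
move=> x1; rewrite /step [flat 0 (1 - x)]flat_eq0; last lra.
by rewrite addr0 divff// gt_eqF// flat_gt0//; lra.
Qed.
Lemma step01 x : 0 <= step x <= 1.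
Proof.
rewrite /step divr_ge0 ?flat_ge0//=; last exact: ltW (step_denom x).
by rewrite ler_pdivrMr ?step_denom// mul1r lerDl flat_ge0.
Qed.

Definition dstep : R -> R := derive1 step.

Lemma hasd_step (x : R) : hasd step x (dstep x).
Proof. by have [f' df _] := smooth_step 1; rewrite /dstep (hasd_derive1 (df x)). Qed.

Lemma dstep_continuous : continuous dstep.
Proof.
have [f' df [f'' ddf _]] := smooth_step 2.
have -> : dstep = f' by apply/funext => x; exact: hasd_derive1.
by move=> x; exact: hasd_continuous (ddf x).
Qed.

Lemma dstep_out x : x <= 0 \/ 1 <= x -> dstep x = 0.
Proof.
have out y : y < 0 \/ 1 < y -> dstep y = 0.
  move=> H; apply: hasd_derive1; case: H => H.
    apply: (@hasd_near (fun=> 0)); last exact: hasd_cst.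
    by near=> z; rewrite step_le0//; apply: ltW; near: z; exact: lt_nbhsl.
  apply: (@hasd_near (fun=> 1)); last exact: hasd_cst.
  by near=> z; rewrite step_ge1//; apply: ltW; near: z; exact: lt_nbhsr.
(* At the end points [step] is not locally constant; there the derivative vanishes by continuity
   from outside. *)
have c x0 : x0 = 0 \/ x0 = 1 -> dstep x0 = 0.
  move=> H; apply: contrapT => /eqP d0.
  have /cvgrPdist_lt := @dstep_continuous x0.
  move=> /(_ `|dstep x0|); rewrite normr_gt0 => /(_ d0) -[e /= e0 He].
  case: H => xE.
    have := He (x0 - e / 2); rewrite (out (x0 - e / 2)) ?subr0 ?ltxx; last by left; lra.
    move=> H; suff : false by []; apply: H; rewrite /ball/= opprB addrC subrK gtr0_norm; lra.
  have := He (x0 + e / 2); rewrite (out (x0 + e / 2)) ?subr0 ?ltxx; last by right; lra.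
  move=> H; suff : false by []; apply: H; rewrite /ball/= opprD addrA subrr sub0r normrN gtr0_norm; lra.
rewrite !le_eqVlt => -[/orP[/eqP xE|]|/orP[/eqP xE|]]; [|by move=> ?; apply: out; left| |by move=> ?; apply: out; right].
- by apply: c; left.
- by apply: c; right.
Unshelve. all: by end_near. Qed.

Lemma dstep_bounded : exists2 C : R, 0 < C & forall x, `|dstep x| <= C.
Proof.
have c01 : compact `[0 : R, 1] by exact: segment_compact.
have cd : {within `[0 : R, 1], continuous dstep}.
  by apply: continuous_subspaceT; exact: dstep_continuous.
have [M0 [M0r H]] := compact_bounded (continuous_compact cd c01).
exists (`|M0| + 1); first by rewrite ltr_wpDl.
move=> x; have [x01|] := boolP (x \in `[0, 1]).
  apply: (H (`|M0| + 1)); first by rewrite (le_lt_trans (ler_norm _))// ltrDl.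
  by exists x.
rewrite in_itv/= negb_and -!ltNge => /orP[|] ?; rewrite dstep_out ?normr0 ?addr_ge0//.
  by left; exact: ltW.
by right; exact: ltW.
Qed.
End SmoothStep.

(** * One-sided mollification at Lebesgue points *)

Section Mollification.
Context {R : realType}.
Local Notation mu := (@lebesgue_measure R).
Local Notation RR := (measurableTypeR R).
Implicit Types f g h : R -> R.

Lemma dct (f_ : nat -> R -> R) f g : (forall n, mfun (f_ n)) -> mfun f -> L1 g ->
  (forall n x, `|f_ n x| <= g x) ->
  {ae mu, forall x : RR, f_ n x @[n --> \oo] --> (f x : R)} ->
  intg (f_ n) @[n --> \oo] --> intg f.
Proof.
move=> mf_ mf g1 fg fc.
have [f1 _ c] := @dominated_convergence _ _ R mu setT measurableT
  (fun n x => (f_ n x)%:E) (fun x => (f x)%:E) (fun x => (g x)%:E)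
  (fun n => (measurable_EFinP _ _).2 (mf_ n)) ((measurable_EFinP _ _).2 mf)
  (ltac:(by apply: ae_sub fc => x /= H _; apply: cvg_EFin => //; exact: nearW))
  g1 (ltac:(by apply: aeW => x n _; rewrite lee_fin)).
by rewrite /intg /Rintegral; apply: fine_cvg; rewrite fineK//; apply: integrable_fin_num.
Qed.

Lemma ae_neq (c : R) : {ae mu, forall x : RR, x != c}.
Proof.
exists [set c]; split => //; first exact: lebesgue_measure_set1.
by move=> x /= /negP; rewrite negbK => /eqP.
Qed.

Lemma ae_ex (P : R -> Prop) : {ae mu, forall x : RR, P x} -> exists x, P x.
Proof.
move=> [N [mN N0 PN]]; apply: contrapT => nP.
have NT : N = setT.
  by apply/seteqP; split => // x _; apply: PN => /= Px; apply: nP; exists x.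
have := lebesgue_measure_itv (R := R) `[0, 1]; rewrite /= lte_fin ltr01 oppr0 adde0 => H.
have sub : `[0 : R, 1]%classic `<=` N by rewrite NT.
have := @le_measure _ _ _ mu _ _ (mem_set (measurable_itv `[0 : R, 1])) (mem_set mN) sub.
move=> h; have : (mu `[(0 : R)%R, 1%R]%classic <= 0)%E by rewrite -N0; exact: h.
by rewrite H lee_fin ler10.
Qed.

Definition L1loc f := forall a b, L1 (fun x => ind a b x * f x).

Lemma L1loc_of f : locally_integrable [set: R] f -> L1loc f.
Proof.
move=> [mf _ H] a b; have mi := mfunM (mfun_ind a b) mf.
apply: L1P => //.
have := H _ (@subsetT _ _) (@segment_compact R a b); apply: le_lt_trans.
rewrite [leRHS]integral_mkcond; apply: ge0_le_integral => //.
- by apply/measurable_EFinP; exact: mfun_abs.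
- apply/(measurable_restrictT _ _).1 => //.
  by apply: measurable_funTS; apply/measurable_EFinP; exact: mfun_abs.
move=> x _; rewrite patchE /ind indicE; case: ifPn => _; rewrite ?mul1r//.
by rewrite mul0r normr0.
Qed.

Lemma L1loc_l2 f : l2 f -> L1loc f.
Proof. by move=> hf a b; apply: l2M => //; exact: l2_ind. Qed.

(** An approximate identity on $[0, e]$. Being the derivative of a rescaled [step], it is what the
    derivative of a trapezoidal test function consists of. *)
Definition rho (e w : R) := dstep (w / e) / e.

Lemma hasd_step_scale (e c z : R) : 
  hasd (fun z => step ((z - c) / e)) z (rho e (z - c)).
Proof.
have D : hasd (fun z => (z - c) / e) z (e^-1).
  apply: hasd_eq.
    exact: hasdM (hasdD (hasd_id z) (hasdN (hasd_cst c z))) (hasd_cst e^-1 z).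
  by rewrite !mulr0 oppr0 add0r addr0 mulr1.
exact: (hasd_comp (hasd_step _) D).
Qed.

Lemma rho_out (e w : R) : 0 < e -> ~~ (0 <= w <= e) -> rho e w = 0.
Proof.
move=> e0 H; rewrite /rho dstep_out ?mul0r//.
move: H; rewrite negb_and -!ltNge => /orP[H|H].
  by left; rewrite pmulr_lle0 ?invr_gt0// ltW.
by right; rewrite ler_pdivlMr// mul1r ltW.
Qed.

Lemma rho_bound : exists2 C : R, 0 < C &
  forall e w, 0 < e -> `|rho e w| <= C / e * ind 0 e w.
Proof.
have [C C0 HC] := @dstep_bounded R; exists C => // e w e0.
rewrite indE; case: ifPn => H; last by rewrite rho_out// normr0 mulr0.
by rewrite mulr1 /rho normrM normfV (gtr0_norm e0) ler_pM2r ?invr_gt0.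
Qed.

Lemma mfun_rho e c : mfun (fun z : R => rho e (z - c)).
Proof.
apply: mfunM; last exact: mfun_cst.
apply: (@mfun_comp _ dstep (fun z => (z - c) / e)).
  by apply: continuous_measurable_fun; exact: dstep_continuous.
apply: mfunM; last exact: mfun_cst.
by apply: mfunB; [exact: mfun_id|exact: mfun_cst].
Qed.

Lemma ind_shift a b c z : ind a b (z - c) = ind (a + c) (b + c) z :> R.
Proof.
by rewrite !indE; have -> : (a <= z - c <= b) = (a + c <= z <= b + c);
  [rewrite lerBrDr lerBlDr|].
Qed.

Lemma L1_rhoM f e c : 0 < e -> mfun f -> L1loc f -> L1 (fun z => f z * rho e (z - c)).
Proof.
move=> e0 mf lf; have [C C0 HC] := rho_bound.
apply: (@L1_le _ _ (fun z => (C / e) * `|ind (0 + c) (e + c) z * f z|)).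
- by apply: mfunM => //; exact: mfun_rho.
- move=> z; have := HC e (z - c) e0; rewrite ind_shift => H.
  rewrite (normrM (f z)) (normrM (ind _ _ _)) (ger0_norm (andP (ind01 _ _ _)).1).
  by rewrite mulrA [leRHS]mulrC ler_wpM2l.
- by apply: L1Z; apply: L1_abs; exact: lf.
Qed.

Lemma intg_rho e c : 0 < e -> intg (fun z => rho e (z - c)) = 1.
Proof.
move=> e0.
have -> : intg (fun z => rho e (z - c)) = \int[mu]_(z in `[c, c + e]) rho e (z - c).
  rewrite Rintegral_ind; congr intg; apply/funext => z.
  rewrite indE; case: ifPn => H; rewrite ?mul1r// mul0r rho_out//.
  by apply: contra H => /andP[h1 h2]; apply/andP; split; lra.
rewrite /Rintegral (@continuous_FTC2 _ _ (fun z => step ((z - c) / e)))//.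
- by rewrite [c + e]addrC addrK divff ?gt_eqF// subrr mul0r [step 0]step_le0// step_ge1//= subr0.
- by rewrite ltrDl.
- apply: continuous_subspaceT => z.
  have ct : {for z, continuous (fun z => (z - c) / e)}.
    by apply: hasd_continuous; apply: hasdM; [apply: hasdD; [exact: hasd_id|exact: hasd_cst]|exact: hasd_cst].
  apply: cvgM; last exact: cvg_cst.
  exact: (continuous_comp ct (@dstep_continuous R _)).
- have ct z : {for z, continuous (fun z => step ((z - c) / e))}.
    exact: hasd_continuous (hasd_step_scale e c z).
  split; first by move=> z _; exact: hasd_derivable (hasd_step_scale e c z).
    exact: cvg_at_right_filter (ct _).
  exact: cvg_at_left_filter (ct _).
- by move=> z _; exact: hasd_derive1 (hasd_step_scale e c z).
Qed.

(** As [rho] has integral 1, the error is at most $C/e$ times the integral of $|f - f(x)|$ over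
    $[x, x+e]$, a multiple of a mean that vanishes at a Lebesgue point. *)
Lemma mollify_lebesgue f x : mfun f -> L1loc f -> lebesgue_pt f x ->
  intg (fun z => f z * rho e (z - x)) @[e --> (0 : R)^'+] --> f x.
Proof.
move=> mf lf fx; have [C C0 HC] := rho_bound.
apply/cvgrPdist_lt => eps eps0.
(* The interval $[x, x+e]$ lies in the open ball of radius $2e$, of measure $4e$, and $|\rho| \le
   C/e$. *)
pose eta := eps / (4 * C).
have eta0 : 0 < eta by rewrite divr_gt0// mulr_gt0.
have N0 : nbhs (0 : \bar R)%E [set y | (y < eta%:E)%E].
  by exists eta => //= y; rewrite /ball_/= sub0r normrN lte_fin => /ltr_normlW.
have := fx _ N0; rewrite /nbhs/= => -[r /= r0 Hr].
exists (r / 2) => /=; first by rewrite divr_gt0.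
move=> e /=; rewrite sub0r normrN => er e0; rewrite (gtr0_norm e0) in er.
have dv : (davg f x (2 * e) < eta%:E)%E.
  by apply: Hr => /=; [rewrite sub0r normrN gtr0_norm; lra|lra].
have L1i : L1 (fun z => ind x (x + e) z * `|f z - f x|).
  apply: (@L1_le _ _ (fun z => `|ind x (x + e) z * f z| + `|f x| * ind x (x + e) z)).
  - apply: mfunM; first exact: mfun_ind.
    by apply: mfun_abs; apply: mfunB => //; exact: mfun_cst.
  - move=> z; rewrite !normrM normr_id (ger0_norm (andP (ind01 _ _ _)).1).
    rewrite [X in _ <= _ + X]mulrC -mulrDr ler_wpM2l//.
    by rewrite ler_normB.
  - by apply: L1D; [apply: L1_abs; exact: lf|apply: L1Z; exact: L1_ind].
have avg : intg (fun z => ind x (x + e) z * `|f z - f x|) < 4 * e * eta.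
  have le4 : (0 < (4 * e)%:E)%E by rewrite lte_fin mulr_gt0.
  rewrite -lte_fin -intgE//.
  apply: (@le_lt_trans _ _ (\int[mu]_(y in ball x (2 * e)) `|(f y - f x)%:E|)%E).
    rewrite [leRHS]integral_mkcond; apply: ge0_le_integral => //.
    - by move=> z _; rewrite lee_fin mulr_ge0//; case/andP: (ind01 x (x + e) z).
    - by apply/measurable_EFinP; exact: L1_mfun.
    - apply/(measurable_restrictT _ _).1; first exact: measurable_ball.
      apply: measurable_funTS; apply/measurable_EFinP; apply: mfun_abs.
      by apply: mfunB => //; exact: mfun_cst.
    move=> z _; rewrite patchE; case: ifPn => [_|].
      rewrite lee_fin ler_piMl//.
      by case/andP: (ind01 x (x + e) z).
    rewrite notin_setE/= /ball/= => H; rewrite lee_fin indE; case: ifPn => /=; last by rewrite mul0r.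
    move=> /andP[xz ze]; exfalso; apply: H; rewrite ltr_norml; apply/andP; split; lra.
  move: dv; rewrite /davg /iavg lebesgue_measure_ball; last lra.
  rewrite inver -mulr_natr ifF; last by apply/negbTE; rewrite gt_eqF//; lra.
  rewrite lte_pdivrMl; last lra.
  by rewrite -EFinM; congr (_ < (_)%:E)%E; ring.
have l1c : L1 (fun z => f x * rho e (z - x)).
  apply: L1_rhoM => //; first exact: mfun_cst.
  move=> a b; have := L1Z (f x) (L1_ind a b); congr L1.
  by apply/funext => z; rewrite mulrC.
have E : f x - intg (fun z => f z * rho e (z - x)) =
    intg (fun z => - ((f z - f x) * rho e (z - x))).
  rewrite -{1}[f x]mulr1 -(intg_rho x e0) -intgZ; last first.
    have -> : (fun z => rho e (z - x)) = (fun z => 1 * rho e (z - x)).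
      by apply/funext => z; rewrite mul1r.
    apply: L1_rhoM => //; first exact: mfun_cst.
    move=> a b; have := L1_ind a b; congr L1.
    by apply/funext => z; rewrite mulr1.
  rewrite -intgB//; last exact: L1_rhoM.
  by congr intg; apply/funext => z; ring.
have L1E : L1 (fun z => - ((f z - f x) * rho e (z - x))).
  apply: L1N; have := L1B (L1_rhoM x e0 mf lf) l1c; congr L1.
  by apply/funext => z; ring.
rewrite E; apply: (le_lt_trans (intg_abs L1E)).
apply: (@le_lt_trans _ _ (C / e * intg (fun z => ind x (x + e) z * `|f z - f x|))).
  rewrite -intgZ//; apply: intg_le; [exact: L1_abs|exact: L1Z|move=> z].
  rewrite normrN normrM; have := HC e (z - x) e0; rewrite ind_shift add0r [e + x]addrC => H.
  by rewrite mulrC mulrA ler_wpM2r.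
have -> : eps = C / e * (4 * e * eta).
  by rewrite /eta; field; rewrite !gt_eqF.
by rewrite ltr_pM2l// divr_gt0.
Qed.
End Mollification.

(** * Weak derivatives and the continuous representative *)

Section WeakDerivative.
Context {R : realType}.
Local Notation mu := (@lebesgue_measure R).
Local Notation RR := (measurableTypeR R).
Implicit Types f g h eta : R -> R.

Definition wd f g := [/\ locally_integrable [set: R] f, locally_integrable [set: R] g &
  forall eta, test_function eta ->
    intg (fun x => f x * derive1 eta x) = - intg (fun x => g x * eta x)].

Lemma test_of_smooth eta a b : (forall n, smoothn n eta) ->
  (forall z, ~~ (a <= z <= b) -> eta z = 0) -> test_function eta.
Proof.
move=> se oe; split; first exact: smoothn_derivable.
apply: (subclosed_compact _ (@segment_compact R a b)); first exact: closed_closure.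
have -> : `[a, b]%classic = closure `[a, b]%classic.
  by apply/closure_id; exact: itv_closed.
apply: closureS => z /= ez; rewrite in_itv/=; apply: contrapT => /negP H.
by move/eqP : ez; apply; exact: oe.
Qed.

Lemma smooth_dstep n : smoothn n (@dstep R).
Proof.
have [f' df sf] := @smooth_step R n.+1; suff -> : @dstep R = f' by [].
by apply/funext => x; exact: hasd_derive1.
Qed.

Lemma test_rho e c : 0 < e -> test_function (fun z : R => rho e (z - c)).
Proof.
move=> e0; apply: (@test_of_smooth _ c (c + e)) => [n|z H].
  apply: smoothnM; last exact: smoothn_cst.
  have -> : (fun z => dstep ((z - c) / e)) = (fun z => dstep (e^-1 * z + - c / e)).
    by apply/funext => z; congr dstep; ring.
  exact: smoothn_affine (smooth_dstep n).
by apply: rho_out => //; apply: contra H => /andP[h1 h2]; apply/andP; split; lra.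
Qed.

(** A smooth version of the indicator of $[x, y]$, rising on $[x, x+e]$ and falling on $[y, y+e]$;
    its derivative is a difference of two mollifiers, at $x$ and at $y$. *)
Definition trapezoid (e x y z : R) := step ((z - x) / e) - step ((z - y) / e).

Lemma trapezoid_lo e x y z : 0 < e -> x <= y -> z <= x -> trapezoid e x y z = 0.
Proof.
move=> e0 xy zx; rewrite /trapezoid !step_le0 ?subrr//.
  by rewrite pmulr_lle0 ?invr_gt0//; lra.
by rewrite pmulr_lle0 ?invr_gt0//; lra.
Qed.
Lemma trapezoid_hi e x y z : 0 < e -> x <= y -> y + e <= z -> trapezoid e x y z = 0.
Proof.
by move=> e0 xy zy; rewrite /trapezoid !step_ge1 ?subrr// ler_pdivlMr// mul1r; lra.
Qed.
Lemma trapezoid_mid e x y z : 0 < e -> x + e <= z -> z <= y -> trapezoid e x y z = 1.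
Proof.
move=> e0 xz zy; rewrite /trapezoid step_ge1; last by rewrite ler_pdivlMr// mul1r; lra.
by rewrite step_le0 ?subr0// pmulr_lle0 ?invr_gt0//; lra.
Qed.

Lemma smooth_step_scale n (e c : R) : smoothn n (fun z => step ((z - c) / e)).
Proof.
have := smoothn_affine e^-1 (- c / e) (@smooth_step R n); congr smoothn.
by apply/funext => z; congr step; ring.
Qed.

Lemma test_trapezoid e x y : 0 < e -> x <= y -> test_function (trapezoid e x y).
Proof.
move=> e0 xy; apply: (@test_of_smooth _ x (y + e)) => [n|z].
  by apply: smoothnD; [|apply: smoothnN]; exact: smooth_step_scale.
rewrite negb_and -!ltNge => /orP[H|H]; first by apply: trapezoid_lo => //; exact: ltW.
by apply: trapezoid_hi => //; exact: ltW.
Qed.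

Lemma derive1_trapezoid e x y z :
  derive1 (trapezoid e x y) z = rho e (z - x) - rho e (z - y).
Proof.
apply: hasd_derive1; apply: hasdD; first exact: hasd_step_scale.
by apply: hasdN; exact: hasd_step_scale.
Qed.

Lemma cvg_at_right0_harmonic (u : R -> R) (l : R) : u e @[e --> (0 : R)^'+] --> l ->
  u (n.+1%:R^-1) @[n --> \oo] --> l.
Proof.
move=> /cvg_at_rightP; apply; split; first by move=> n; rewrite invr_gt0 ltr0n.
exact: cvg_harmonic.
Qed.

(** Testing against mollifiers shrinking to a Lebesgue point recovers the value of $h$ there. *)
Lemma weak_zero h : locally_integrable [set: R] h ->
  (forall eta, test_function eta -> intg (fun x => h x * eta x) = 0) ->
  {ae mu, forall x : RR, h x = 0}.
Proof.
move=> lh H; have [mh _ _] := lh.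
have := lebesgue_differentiation lh; apply: ae_sub => x /= hx.
have := cvg_at_right0_harmonic (mollify_lebesgue mh (L1loc_of lh) hx).
have E n : intg (fun z => h z * rho n.+1%:R^-1 (z - x)) = 0.
  by apply: H; apply: test_rho; rewrite invr_gt0 ltr0n.
under eq_fun do rewrite E.
by move=> c; apply: (cvg_unique (@Rhausdorff R) c); exact: cvg_cst.
Qed.

Lemma locally_integrableB' g1 g2 : locally_integrable [set: R] g1 ->
  locally_integrable [set: R] g2 -> locally_integrable [set: R] (fun x => g1 x - g2 x).
Proof. by move=> h1 h2; exact: locally_integrableB. Qed.

Lemma test_bounded_support eta : test_function eta ->
  exists2 M, 0 < M & forall z, M < `|z| -> eta z = 0.
Proof.
move=> [_ /compact_bounded[M0 [_ HM]]]; exists (`|M0| + 1); first by rewrite ltr_wpDl.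
move=> z Mz; apply: contrapT => /eqP ez.
have := HM (`|M0| + 1); rewrite (le_lt_trans (ler_norm _)) ?ltrDl// => /(_ isT z).
move=> /(_ _)/= H; have : `|z| <= `|M0| + 1 by apply: H; exact: subset_closure.
by rewrite leNgt Mz.
Qed.

Lemma test_hasd eta x : test_function eta -> hasd eta x (derive1 eta x).
Proof.
move=> [de _]; have /derivableP := de 0%N x.
by rewrite /hasd derive1E.
Qed.

Lemma test_continuous eta : test_function eta -> continuous eta.
Proof. by move=> te x; exact: hasd_continuous (test_hasd x te). Qed.

Lemma test_derive1 eta : test_function eta -> test_function (derive1 eta).
Proof.
move=> te; have [M M0 HM] := test_bounded_support te.
have [de _] := te; split.
  by move=> n x; have := de n.+1 x; rewrite /derive1n iterSr.
apply: (subclosed_compact _ (@segment_compact R (- M) M)); first exact: closed_closure.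
have -> : `[- M, M]%classic = closure `[- M, M]%classic.
  by apply/closure_id; exact: itv_closed.
apply: closureS => z /= ez; rewrite in_itv/= -ler_norml leNgt; apply/negP => Mz.
move/eqP : ez; apply; apply: hasd_derive1.
apply: (@hasd_near _ (fun=> 0)); last exact: hasd_cst.
exists (`|z| - M); first by rewrite /= subr_gt0.
move=> y /= zy; rewrite HM//.
have := ler_normD y (z - y); rewrite (_ : y + (z - y) = z); last by ring.
by move=> ?; lra.
Qed.

Lemma test_bounded eta : test_function eta -> exists C, forall x, `|eta x| <= C.
Proof.
move=> te; have [M M0 HM] := test_bounded_support te.
have [C [_ HC]] := compact_bounded (continuous_compact
  (continuous_subspaceT (@test_continuous _ te)) (@segment_compact R (- M) M)).
exists (`|C| + 1) => x; have [xM|Mx] := leP `|x| M; last by rewrite HM// normr0 addr_ge0.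
apply: (HC (`|C| + 1)); first by rewrite (le_lt_trans (ler_norm _))// ltrDl.
by exists x => //; rewrite /= in_itv/= -ler_norml.
Qed.

Lemma test_l2 eta : test_function eta -> l2 eta.
Proof.
move=> te; have [M M0 HM] := test_bounded_support te; have [C HC] := test_bounded te.
apply: (l2_le _ _ (l2Z C (l2_ind (- M) M))).
  by apply: continuous_measurable_fun; exact: test_continuous.
move=> x; rewrite normrM (ger0_norm (andP (ind01 _ _ _)).1) indE -ler_norml.
case: ifPn => [_|]; first by rewrite mulr1 (le_trans (HC x))// ler_norm.
by rewrite -ltNge => /HM ->; rewrite normr0 mulr0.
Qed.

Lemma test_ftc eta : test_function eta -> ftc eta (derive1 eta).
Proof.
move=> te; have te' := test_derive1 te; split; [exact: test_l2..|move=> x y].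
rewrite le_eqVlt => /orP[/eqP ->|xy]; first by rewrite subrr set_itv1 Rintegral_set1.
rewrite /Rintegral (@continuous_FTC2 _ _ eta)//.
- by apply: continuous_subspaceT; exact: test_continuous.
- split; first by move=> z _; exact: hasd_derivable (test_hasd z te).
    by apply: cvg_at_right_filter; exact: test_continuous.
  by apply: cvg_at_left_filter; exact: test_continuous.
Qed.

Lemma sd_wd f g : sd f g -> wd f g.
Proof.
move=> fg; have [hf hg _] := fg.
split; [exact: l2_locally_integrable..|move=> eta te].
have := sd_ibp fg (ftc_sd (test_ftc te)); rewrite /ip => H.
by apply/eqP; rewrite -addr_eq0 addrC; apply/eqP.
Qed.

Lemma wd_unique f g1 g2 : wd f g1 -> wd f g2 -> aeq g1 g2.
Proof.
move=> [_ l1 h1] [_ l2 h2].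
have m1 : mfun g1 by case: l1. have m2 : mfun g2 by case: l2.
have L g eta : locally_integrable [set: R] g -> test_function eta -> L1 (fun x => g x * eta x).
  move=> lg te; have [M M0 HM] := test_bounded_support te; have [C HC] := test_bounded te.
  have mg : mfun g by case: lg.
  apply: (@L1_le _ _ (fun x => C * `|ind (- M) M x * g x|)).
  - by apply: mfunM => //; apply: continuous_measurable_fun; exact: test_continuous.
  - move=> x; rewrite !normrM (ger0_norm (andP (ind01 _ _ _)).1) indE -ler_norml.
    case: ifPn => [_|]; first by rewrite mul1r mulrC ler_wpM2r.
    by rewrite -ltNge => /HM ->; rewrite normr0 mul0r !mulr0.
  - by apply: L1Z; apply: L1_abs; exact: L1loc_of.
have : {ae mu, forall x : RR, g1 x - g2 x = 0}.
  apply: weak_zero; first exact: locally_integrableB'.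
  move=> eta te.
  have -> : (fun x => (g1 x - g2 x) * eta x) = (fun x => g1 x * eta x - g2 x * eta x).
    by apply/funext => x; rewrite mulrBl.
  rewrite intgB; [|exact: L..].
  by have := h1 _ te; rewrite (h2 _ te) => /eqP; rewrite eqr_opp => /eqP ->; rewrite subrr.
by apply: ae_sub => x /= /eqP; rewrite subr_eq0 => /eqP.
Qed.

(** The weak identity is tested against trapezoids of vanishing slope width: one side tends to $f(x)
    - f(y)$ at Lebesgue points, the other to minus the integral of $g$ over $[x, y]$. *)
Lemma wd_increment f g x y : wd f g -> l2 g -> lebesgue_pt f x -> lebesgue_pt f y ->
  x <= y -> f y - f x = intg (fun z => ind x y z * g z).
Proof.
move=> [lf lg H] hg fx fy xy; have [mf _ _] := lf; have mg := l2_mfun hg.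
pose e (n : nat) : R := n.+1%:R^-1.
have e0 n : 0 < e n by rewrite invr_gt0 ltr0n.
have e1 n : e n <= 1 by rewrite invf_le1 ?ltr0n// ler1n.
have c1 : intg (fun z => f z * rho (e n) (z - x)) - intg (fun z => f z * rho (e n) (z - y))
   @[n --> \oo] --> f x - f y.
  apply: cvgB; first exact: cvg_at_right0_harmonic (mollify_lebesgue mf (L1loc_of lf) fx).
  exact: cvg_at_right0_harmonic (mollify_lebesgue mf (L1loc_of lf) fy).
have c2 : intg (fun z => g z * trapezoid (e n) x y z) @[n --> \oo] -->
    intg (fun z => ind x y z * g z).
  (* As [e n <= 1], all trapezoids are supported in $[x, y+1]$. *)
  apply: (@dct _ _ _ (fun z => `|ind x (y + 1) z * g z|)).
  - move=> n; apply: mfunM => //; apply: continuous_measurable_fun.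
    exact: test_continuous (test_trapezoid (e0 n) xy).
  - by apply: mfunM => //; exact: mfun_ind.
  - by apply: L1_abs; exact: L1loc_l2.
  - move=> n z; rewrite !normrM mulrC ler_wpM2r//.
    rewrite (ger0_norm (andP (ind01 _ _ _)).1) indE; case: ifPn.
      move=> _; rewrite /trapezoid ler_norml.
      have := @step01 R ((z - x) / e n); have := @step01 R ((z - y) / e n).
      by move=> /andP[? ?] /andP[? ?]; apply/andP; split; lra.
    rewrite negb_and -!ltNge => /orP[h|h].
      by rewrite trapezoid_lo ?normr0//; exact: ltW.
    by rewrite trapezoid_hi ?normr0//; have := e1 n; lra.
  (* At $z = x$ every trapezoid is 0 while the indicator is 1. *)
  apply: ae_sub (ae_neq x) => z /= zx.
  have eN (r : R) : 0 < r -> \forall n \near \oo, e n <= r.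
    move=> r0; have : e n @[n --> \oo] --> (0 : R) by exact: cvg_harmonic.
    move=> /cvgrPdist_le /(_ _ r0); apply: filterS => n.
    by rewrite sub0r normrN ger0_norm// ltW.
  apply: (@cvg_near_eq _ _ _ _ (fun=> ind x y z * g z)); last exact: cvg_cst.
  have [zlx|xlz|zE] := ltgtP z x.
  - apply: nearW => n; rewrite trapezoid_lo ?mulr0//; last exact: ltW.
    by rewrite indE leNgt zlx mul0r.
  - have [zy|yz] := leP z y.
      have zx0 : 0 < z - x by lra.
      have := eN _ zx0; apply: filterS => n en.
      by rewrite trapezoid_mid//; [rewrite indE (ltW xlz) zy mulr1 mul1r|lra].
    have zy0 : 0 < z - y by lra.
    have := eN _ zy0; apply: filterS => n en.
    by rewrite trapezoid_hi//; [rewrite indE (leNgt z y) yz andbF mulr0 mul0r|lra].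
  - by rewrite zE eqxx in zx.
have E n : intg (fun z => f z * rho (e n) (z - x)) - intg (fun z => f z * rho (e n) (z - y)) =
    - intg (fun z => g z * trapezoid (e n) x y z).
  rewrite -H; last exact: test_trapezoid.
  rewrite -intgB; [|by apply: L1_rhoM => //; exact: L1loc_of..].
  by congr intg; apply/funext => z; rewrite derive1_trapezoid mulrBr.
have c3 : - intg (fun z => g z * trapezoid (e n) x y z) @[n --> \oo] -->
    - intg (fun z => ind x y z * g z) by apply: cvgN.
rewrite (funext E) in c1.
have h : f x - f y = - intg (fun z => ind x y z * g z).
  exact: (cvg_unique (@Rhausdorff R) c1 c3).
by rewrite -opprB h opprK.
Qed.

Lemma ind_chain g x y z : l2 g -> x <= y -> y <= z ->
  intg (fun w => ind x z w * g w) =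
  intg (fun w => ind x y w * g w) + intg (fun w => ind y z w * g w).
Proof.
move=> hg xy yz; rewrite -intgD; [|exact: L1loc_l2..].
have mg := l2_mfun hg; have mi a b := mfunM (mfun_ind a b) mg.
apply: aeq_intg => //; first exact: mfunD.
apply: ae_sub (ae_neq y) => w /= wy; rewrite -mulrDl; congr (_ * _).
rewrite !indE; have [wly|ylw|wE] := ltgtP w y.
- by rewrite (le_trans (ltW wly) yz) andbT addr0.
- by rewrite (le_trans xy (ltW ylw))/= add0r.
- by rewrite wE eqxx in wy.
Qed.

(* The primitive vanishing at [c], written without signed integrals. *)
Definition primitive g (c x : R) :=
  intg (fun z => ind c x z * g z) - intg (fun z => ind x c z * g z).

Lemma ind_gt g a b : b < a -> intg (fun z => ind a b z * g z) = 0.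
Proof.
move=> ba; rewrite -[RHS]intg0; congr intg; apply/funext => z; rewrite indE.
by case: ifPn => [/andP[az zb]|]; rewrite ?mul0r//; move: (lt_le_trans ba (le_trans az zb)); rewrite ltxx.
Qed.

Lemma ind_eq g a : mfun g -> intg (fun z => ind a a z * g z) = 0.
Proof.
move=> mg; rewrite -[RHS]intg0; apply: aeq_intg; last first.
  apply: ae_sub (ae_neq a) => z /= za; rewrite indE; case: ifPn; rewrite ?mul0r//.
  by rewrite -eq_le eq_sym (negbTE za).
exact: mfun_cst.
by apply: mfunM => //; exact: mfun_ind.
Qed.

Lemma primitiveB g c x y : l2 g -> x <= y ->
  primitive g c y - primitive g c x = intg (fun z => ind x y z * g z).
Proof.
move=> hg xy; have mg := l2_mfun hg; rewrite /primitive.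
have P a b : b <= a -> intg (fun z => ind a b z * g z) = 0.
  by rewrite le_eqVlt => /orP[/eqP ->|]; [exact: ind_eq|exact: ind_gt].
have [cx|/ltW xc] := leP c x.
  rewrite (P y c) ?(le_trans cx)// (P x c)// (ind_chain hg cx xy); ring.
have [cy|/ltW yc] := leP c y.
  rewrite (P y c)// (P c x)// (ind_chain hg xc cy); ring.
by rewrite (P c y)// (P c x)// (ind_chain hg xy yc); ring.
Qed.

Lemma primitive_continuous g c : l2 g -> continuous (primitive g c).
Proof.
move=> hg x; apply/cvgrPdist_lt => eps eps0.
have n0 : 0 < n2 g + 1 by rewrite ltr_wpDl// n2_ge0.
(* The modulus of continuity is $\sqrt r\,\|g\|$; the 1 keeps the quotient defined when $\|g\| =
   0$. *)
pose dl := (eps / (n2 g + 1)) ^+ 2.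
have dl0 : 0 < dl by rewrite exprn_gt0// divr_gt0.
have H a b : a <= b -> `|primitive g c b - primitive g c a| <= Num.sqrt (b - a) * n2 g.
  move=> ab; rewrite primitiveB//.
  have -> : intg (fun z => ind a b z * g z) = ip (ind a b) g by [].
  rewrite -n2_ind//; apply: ip_le_n2 => //; exact: l2_ind.
have K (r : R) : 0 <= r -> r < dl -> Num.sqrt r * n2 g < eps.
  move=> r0 rd; have sr : Num.sqrt r < eps / (n2 g + 1).
    rewrite -[ltRHS]ger0_norm; last by rewrite divr_ge0// ltW.
    by rewrite -sqrtr_sqr ltr_sqrt.
  rewrite ltr_pdivlMr// in sr.
  have := sqrtr_ge0 r; have := n2_ge0 g; nra.
exists dl => //= y; have [xy|/ltW yx] := leP x y.
  rewrite /= distrC => h; rewrite distrC; apply: (le_lt_trans (H _ _ xy)).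
  by apply: K; [rewrite subr_ge0|exact: le_lt_trans (ler_norm _) h].
move=> /= h; apply: (le_lt_trans (H _ _ yx)).
by apply: K; [rewrite subr_ge0|exact: le_lt_trans (ler_norm _) h].
Qed.

(** Anchored at one Lebesgue point $c$, the primitive of $g$ with value $f(c)$ agrees with $f$ at
    every Lebesgue point by [wd_increment]. *)
Lemma wd_ftc f g : wd f g -> l2 f -> l2 g -> exists2 F, ftc F g & aeq f F.
Proof.
move=> w hf hg; have [lf _ _] := w.
have lp := lebesgue_differentiation lf.
have [c fc] := ae_ex lp.
pose F x := f c + primitive g c x.
have cF : continuous F.
  by move=> x; apply: cvgD; [exact: cvg_cst|exact: primitive_continuous].
have mF : mfun F by exact: continuous_measurable_fun.
have fF : aeq f F.
  apply: ae_sub lp => x /= fx; rewrite /F /primitive.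
  have [cx|xc] := leP c x.
    rewrite -(wd_increment w hg fc fx cx).
    move: cx; rewrite le_eqVlt => /orP[/eqP ->|cx]; last by rewrite ind_gt//; ring.
    by rewrite ind_eq; [ring|exact: l2_mfun].
  by rewrite -(wd_increment w hg fx fc (ltW xc)) ind_gt//; ring.
exists F => //; split => //; first exact: aeq_l2 fF hf.
move=> x y xy; rewrite Rintegral_ind -(primitiveB c hg xy) /F; ring.
Qed.

End WeakDerivative.

(** * The Riesz potential *)

Section RieszKernel.
Context {R : realType}.
Local Notation mu := (@lebesgue_measure R).
Local Notation RR := (measurableTypeR R).
Implicit Types f g h : R -> R.

Lemma ge0_integral_opp (f : R -> \bar R) :
  measurable_fun setT f -> (forall x, 0 <= f x)%E ->
  (\int[mu]_x f (- x)%R = \int[mu]_x f x)%E.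
Proof.
move=> mf f0; apply/esym.
have mo : measurable_fun setT (fun x : RR => (- x : RR)) by exact: measurable_funN.
transitivity (\int[pushforward mu (fun x : RR => (- x : RR)%R)]_x f x)%E.
  by apply: eq_measure_integral => // A mA _; exact: (pushforward_opp mA).
by rewrite ge0_integral_pushforward.
Qed.

Definition riesz (a z : R) : R := `|z| `^ (- a).
Definition riesz_near (a z : R) : R := ind (-1) 1 z * riesz a z.
Definition riesz_far (a z : R) : R := (1 - ind (-1) 1 z) * riesz a z.

Lemma rieszE a z : riesz a z = riesz_near a z + riesz_far a z.
Proof. by rewrite /riesz_near /riesz_far -mulrDl addrCA subrr addr0 mul1r. Qed.
Lemma riesz_ge0 a z : 0 <= riesz a z. Proof. exact: powR_ge0. Qed.
Lemma rieszN a z : riesz a (- z) = riesz a z. Proof. by rewrite /riesz normrN. Qed.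
Lemma mfun_riesz a : mfun (riesz a).
Proof.
apply: (@mfun_comp _ (fun z => z `^ (- a)) (fun z => `|z|)); first exact: measurable_powR.
exact: mfun_abs (mfun_id).
Qed.
Lemma riesz_near_ge0 a z : 0 <= riesz_near a z.
Proof. by rewrite mulr_ge0 ?riesz_ge0//; case/andP: (ind01 (-1) 1 z). Qed.
Lemma riesz_far01 (a z : R) : 0 < a -> 0 <= riesz_far a z <= 1.
Proof.
move=> a0; rewrite /riesz_far indE; case: ifPn => [_|]; first by rewrite subrr mul0r lexx ler01.
rewrite subr0 mul1r riesz_ge0/= -ler_norml -ltNge => z1.
rewrite /riesz powRN invf_le1 ?powR_gt0//; last exact: lt_trans z1.
have -> : 1 = 1 `^ a :> R by rewrite powR1.
apply: ge0_ler_powR; rewrite ?nnegrE//; exact: ltW.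
Qed.
Lemma riesz_nearN a z : riesz_near a (- z) = riesz_near a z.
Proof.
rewrite /riesz_near rieszN !indE.
by have -> : (-1 <= - z <= 1) = (-1 <= z <= 1) by rewrite lerN2 lerNl andbC.
Qed.

Lemma mfun_riesz_near a : mfun (riesz_near a).
Proof. by apply: mfunM; [exact: mfun_ind|exact: mfun_riesz]. Qed.
Lemma mfun_riesz_far a : mfun (riesz_far a).
Proof.
apply: mfunM; last exact: mfun_riesz.
by apply: mfunB; [exact: mfun_cst|exact: mfun_ind].
Qed.

(** The antiderivative $z^{1-a}/(1-a)$ is available away from 0, and $a < 1$ makes the bound uniform
    in $e$, ready for monotone convergence. *)
Lemma riesz_itv (a e : R) : 0 < a -> a < 1 -> 0 < e -> e <= 1 ->
  (\int[mu]_z (ind e 1 z * riesz a z)%:E <= ((1 - a)^-1)%:E)%E.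
Proof.
move=> a0 a1 e0; rewrite le_eqVlt => /orP[/eqP ->|e1].
  rewrite (@ge0_ae_eq_integral _ _ _ mu setT _ (fun=> 0%E))//.
  - by rewrite integral0 lee_fin invr_ge0; lra.
  - apply/measurable_EFinP; apply: mfunM; [exact: mfun_ind|exact: mfun_riesz].
  - by move=> z _; rewrite lee_fin mulr_ge0 ?riesz_ge0//; case/andP: (ind01 1 1 z).
  - apply: ae_sub (ae_neq 1) => z /= z1 _; rewrite indE -eq_le eq_sym (negbTE z1).
    by rewrite mul0r.
have -> : (\int[mu]_z (ind e 1 z * riesz a z)%:E = \int[mu]_(z in `[e, 1%R]) (riesz a z)%:E)%E.
  rewrite [RHS]integral_mkcond; apply: eq_integral => z _.
  by rewrite patchE /ind indicE; case: ifPn => _; rewrite ?mul1r ?mul0r.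
have D (z : R) : 0 < z -> hasd (fun y => (1 - a)^-1 * y `^ (1 - a)) z (riesz a z).
  move=> z0; apply: hasd_eq.
    apply: hasdM (hasd_cst _ z) _; exact: (@is_derive1_powR R (1 - a) z z0).
  rewrite mulr0 addr0 /riesz gtr0_norm// mulrA mulVf ?mul1r; last by rewrite gt_eqF//; lra.
  by congr (_ `^ _); ring.
rewrite (@continuous_FTC2 _ _ (fun y => (1 - a)^-1 * y `^ (1 - a)))//.
- rewrite -EFinB lee_fin powR1 mulr1 lerBlDr lerDl mulr_ge0 ?powR_ge0// invr_ge0; lra.
- have cr : {in `[e, 1], continuous (riesz a)}.
    move=> z; rewrite in_itv/= => /andP[ez _]; have z0 : 0 < z by apply: lt_le_trans ez.
    have E : {near z, (fun y => y `^ (- a)) =1 riesz a}.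
      near=> y; rewrite /riesz gtr0_norm//; near: y; exact: lt_nbhsr.
    have := hasd_continuous (hasd_near E (@is_derive1_powR R (- a) z z0)).
    exact.
  by apply: continuous_in_subspaceT => z; rewrite inE => zI; exact: cr.
- have ct z : 0 < z -> {for z, continuous (fun y => (1 - a)^-1 * y `^ (1 - a))}.
    by move=> z0; exact: hasd_continuous (D z z0).
  split.
  + move=> z; rewrite in_itv/= => /andP[ez _]; exact: hasd_derivable (D z (lt_trans e0 ez)).
  + by apply: cvg_at_right_filter; exact: ct.
  + by apply: cvg_at_left_filter; apply: ct; lra.
- by move=> z; rewrite in_itv/= => /andP[ez _]; exact: hasd_derive1 (D z (lt_trans e0 ez)).
Unshelve. all: by end_near. Qed.

(** The truncations to $[1/(n+1), 1]$ increase to the kernel on $[0, 1]$; reflection covers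
    $[-1, 0]$. *)
Lemma L1_riesz_near (a : R) : 0 < a -> a < 1 -> L1 (riesz_near a).
Proof.
move=> a0 a1; apply: L1P; first exact: mfun_riesz_near.
pose F (n : nat) z : \bar R := (ind (n.+1%:R^-1) 1 z * riesz a z)%:E.
have i0 (b z : R) : 0 <= ind b 1 z * riesz a z.
  by rewrite mulr_ge0 ?riesz_ge0//; case/andP: (ind01 b 1 z).
have mF n : measurable_fun [set: R] (F n).
  by apply/measurable_EFinP; apply: mfunM; [exact: mfun_ind|exact: mfun_riesz].
pose G z : \bar R := (ind 0 1 z * riesz a z)%:E.
have mG : measurable_fun [set: R] G.
  by apply/measurable_EFinP; apply: mfunM; [exact: mfun_ind|exact: mfun_riesz].
have GI : (\int[mu]_z G z <= ((1 - a)^-1)%:E)%E.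
  have F0 n z : setT z -> (0 <= F n z)%E by move=> _; rewrite lee_fin.
  have Fnd z : setT z -> nondecreasing_seq (F ^~ z).
    move=> _ m n mn; rewrite lee_fin ler_wpM2r ?riesz_ge0// !indE.
    case: ifPn => [/andP[h1 h2]|_]; last by case: ifP => _; lra.
    have h3 : n.+1%:R^-1 <= z.
      by apply: le_trans h1; rewrite lef_pV2 ?posrE ?ltr0n// ler_nat.
    by rewrite h3 h2.
  have c := @cvg_monotone_convergence _ _ R mu setT measurableT F mF F0 Fnd.
  have GE z : G z = limn (F ^~ z).
    apply/esym/cvg_lim => //; apply: cvg_EFin; first exact: nearW.
    rewrite /=; have [z0|z0] := ltP 0 z.
      have /cvgrPdist_le /(_ _ z0) H : (@harmonic R) n @[n --> \oo] --> (0 : R).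
        exact: cvg_harmonic.
      apply: (@cvg_near_eq R nat \oo _ (fun=> ind 0 1 z * riesz a z)); last exact: cvg_cst.
      apply: filterS H => n; rewrite /harmonic/= sub0r normrN ger0_norm ?invr_ge0 ?ler0n// => H.
      by rewrite /F/= !indE H (ltW z0).
    apply: (@cvg_near_eq R nat \oo _ (fun=> ind 0 1 z * riesz a z)); last exact: cvg_cst.
    apply: nearW => n; rewrite /F/= !indE.
    have -> : (n.+1%:R^-1 <= z) = false.
      by apply/negbTE; rewrite -ltNge (le_lt_trans z0)// invr_gt0 ltr0n.
    (* At $z = 0$ the truncations vanish, and so does [riesz a 0]: [powR] sends 0 to 0 for a nonzero
       exponent. *)
    rewrite mul0r; move: z0; rewrite le_eqVlt => /orP[/eqP ->|z0].
      by rewrite /riesz normr0 powR0 ?mulr0// oppr_eq0 gt_eqF.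
    by rewrite leNgt z0 mul0r.
  under eq_integral do rewrite GE.
  rewrite -(cvg_lim _ c)//; apply: lime_le; first by apply/cvg_ex; eexists; exact: c.
  apply: nearW => n; apply: riesz_itv => //.
  by rewrite invf_le1 ?ltr0n// ler1n.
apply: (@le_lt_trans _ _ (\int[mu]_z (G z + G (- z)%R))%E).
  apply: ge0_le_integral => //.
  - by apply/measurable_EFinP; apply: mfun_abs; exact: mfun_riesz_near.
  - apply: emeasurable_funD => //.
    apply/measurable_EFinP; apply: (@mfun_comp _ (fun z => ind 0 1 z * riesz a z)).
      by apply: mfunM; [exact: mfun_ind|exact: mfun_riesz].
    exact: mfunN (mfun_id).
  move=> z _; rewrite ger0_norm ?riesz_near_ge0// -EFinD lee_fin rieszN -mulrDl.
  rewrite ler_wpM2r ?riesz_ge0// !indE; case: ifPn => [/andP[h1 h2]|_].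
    have [z0|z0] := leP 0 z; first by rewrite h2/=; case: ifP => _; lra.
    have -> : (0 <= - z <= 1) = true by apply/andP; split; lra.
    by rewrite /= add0r.
  by case: ifP => _; case: ifP => _; lra.
rewrite ge0_integralD//; last 3 first.
- by move=> z _; rewrite lee_fin.
- by move=> z _; rewrite lee_fin.
- apply/measurable_EFinP; apply: (@mfun_comp _ (fun z => ind 0 1 z * riesz a z)).
    by apply: mfunM; [exact: mfun_ind|exact: mfun_riesz].
  exact: mfunN (mfun_id).
rewrite (@ge0_integral_opp G)//; last by move=> z; rewrite lee_fin.
by apply: lte_add_pinfty; exact: (le_lt_trans GI (ltry _)).
Qed.
End RieszKernel.

(** * Mapping properties of the potential *)

Section RieszPotential.
Context {R : realType} (a : R) (a0 : 0 < a) (a1 : a < 1).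
Local Notation mu := (@lebesgue_measure R).
Local Notation RR := (measurableTypeR R).
Implicit Types f g h : R -> R.

Local Notation k1 := (riesz_near a).
Local Notation k2 := (riesz_far a).
Definition kap : R := intg k1.

Lemma kap_ge0 : 0 <= kap.
Proof. by apply: intg_ge0 => z; exact: riesz_near_ge0. Qed.

Lemma mfun_refl (k : R -> R) x : mfun k -> mfun (fun y => k (x - y)).
Proof.
move=> mk; apply: (@mfun_comp _ k (fun y => x - y)) => //.
by apply: mfunB; [exact: mfun_cst|exact: mfun_id].
Qed.

Lemma L1_near x : L1 (fun y => k1 (x - y)).
Proof.
have -> : (fun y => k1 (x - y)) = (fun y => k1 (y + - x)).
  by apply/funext => y; rewrite -riesz_nearN opprB.
by apply: L1_sh; exact: L1_riesz_near.
Qed.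

Lemma intg_near x : intg (fun y => k1 (x - y)) = kap.
Proof.
have -> : (fun y => k1 (x - y)) = (fun y => k1 (y + - x)).
  by apply/funext => y; rewrite -riesz_nearN opprB.
by rewrite intg_sh//; exact: mfun_riesz_near.
Qed.

(* The kernel is split at [|z| = 1] into an integrable and a bounded part. *)
Definition cnear f x := intg (fun y => k1 (x - y) * f y).
Definition cfar f x := intg (fun y => k2 (x - y) * f y).
Definition rpot f x := cnear f x + cfar f x.

Lemma mfun_cnear f : mfun f -> mfun (cnear f).
Proof. by move=> mf; apply: measurable_rconv => //; exact: mfun_riesz_near. Qed.
Lemma mfun_cfar f : mfun f -> mfun (cfar f).
Proof. by move=> mf; apply: measurable_rconv => //; exact: mfun_riesz_far. Qed.
Lemma mfun_rpot f : mfun f -> mfun (rpot f).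
Proof. by move=> mf; apply: mfunD; [exact: mfun_cnear|exact: mfun_cfar]. Qed.

Lemma far_le1 z : `|k2 z| <= 1.
Proof. by have /andP[k0 k1] := riesz_far01 z a0; rewrite ger0_norm. Qed.

Lemma L1_farM f x : L1 f -> L1 (fun y => k2 (x - y) * f y).
Proof.
move=> f1; apply: (L1_le _ _ (L1_abs f1)).
  by apply: mfunM; [exact: mfun_refl (mfun_riesz_far a)|exact: L1_mfun].
by move=> y; rewrite normrM ler_piMl// far_le1.
Qed.

Lemma cfar_bound f x : L1 f -> `|cfar f x| <= intg (fun y => `|f y|).
Proof.
move=> f1; have lf := L1_farM x f1.
apply: (le_trans (intg_abs lf)); apply: intg_le; [exact: L1_abs..|move=> y].
by rewrite normrM ler_piMl// far_le1.
Qed.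

Lemma cfarB f g x : L1 f -> L1 g -> cfar (fun y => f y - g y) x = cfar f x - cfar g x.
Proof.
move=> f1 g1; rewrite /cfar -intgB; [|exact: L1_farM..].
by congr intg; apply/funext => y; rewrite mulrBr.
Qed.

Lemma L1_nearM_bounded f x C : mfun f -> (forall y, `|f y| <= C) ->
  L1 (fun y => k1 (x - y) * f y).
Proof.
move=> mf fC; apply: (L1_le _ _ (L1Z C (L1_near x))).
  by apply: mfunM => //; exact: mfun_refl (mfun_riesz_near a).
by move=> y; rewrite normrM mulrC (ger0_norm (riesz_near_ge0 a _)) ler_wpM2r// riesz_near_ge0.
Qed.

Lemma cnear_bound f x C : mfun f -> (forall y, `|f y| <= C) -> `|cnear f x| <= kap * C.
Proof.
move=> mf fC; have lf := L1_nearM_bounded x mf fC.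
apply: (le_trans (intg_abs lf)); rewrite -(intg_near x) mulrC -intgZ; last exact: L1_near.
apply: intg_le; [exact: L1_abs|apply: L1Z; exact: L1_near|move=> y].
by rewrite normrM mulrC (ger0_norm (riesz_near_ge0 a _)) ler_wpM2r// riesz_near_ge0.
Qed.

Lemma cnearB_bounded f g x C : mfun f -> mfun g -> (forall y, `|f y| <= C) ->
  (forall y, `|g y| <= C) -> cnear (fun y => f y - g y) x = cnear f x - cnear g x.
Proof.
move=> mf mg fC gC; rewrite /cnear -intgB; [|exact: (@L1_nearM_bounded _ _ C)..].
by congr intg; apply/funext => y; rewrite mulrBr.
Qed.

(** By Tonelli the convolution of the near kernel with $f^2$ is integrable, hence finite almost
    everywhere. *)
Lemma ae_L1_near_sq f : l2 f -> {ae mu, forall x : RR, L1 (fun y => k1 (x - y) * f y ^+ 2)}.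
Proof.
move=> [mf f2].
have mf2 : mfun (fun y => f y ^+ 2) by exact: mfunX.
have mk := mfun_riesz_near a.
have f20 y : 0 <= f y ^+ 2 by exact: sqr_ge0.
have k0 := riesz_near_ge0 a.
have I : mu.-integrable setT (fun x => \int[mu]_y (k1 (x - y) * f y ^+ 2)%:E)%E.
  apply/integrableP; split; first exact: measurable_econv.
  under eq_integral => x _.
    rewrite gee0_abs; last by apply: integral_ge0 => y _; rewrite lee_fin mulr_ge0.
    over.
  rewrite conv_tonelli// (intgE (L1_riesz_near a0 a1)) (intgE f2) -EFinM; exact: ltry.
have := integrable_ae measurableT I; apply: ae_sub => x /= /(_ Logic.I) fx.
apply: L1P; first by apply: mfunM => //; exact: mfun_refl mk.
under eq_integral => y _ do rewrite (ger0_norm (mulr_ge0 (k0 _) (f20 _))).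
by rewrite ltey_eq fx.
Qed.

Lemma L1_nearM f x : mfun f -> L1 (fun y => k1 (x - y) * f y ^+ 2) ->
  L1 (fun y => k1 (x - y) * f y).
Proof.
move=> mf h; apply: (L1_le _ _ (L1D (L1_near x) h)).
  by apply: mfunM => //; exact: mfun_refl (mfun_riesz_near a).
move=> y; have k0 := riesz_near_ge0 a (x - y).
rewrite normrM (ger0_norm k0) -{2}[k1 _]mulr1 -mulrDr ler_wpM2l//.
rewrite -(real_normK (num_real (f y))).
by have := sqr_ge0 (`|f y| - 1); have := normr_ge0 (f y); nra.
Qed.

(** Cauchy-Schwarz for the measure with density $k_1(x - y)$, whose square root $s$ is shared
    between the two factors. *)
Lemma cnear_sq_le f x : mfun f -> L1 (fun y => k1 (x - y) * f y ^+ 2) ->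
  cnear f x ^+ 2 <= kap * intg (fun y => k1 (x - y) * f y ^+ 2).
Proof.
move=> mf h; have k0 y := riesz_near_ge0 a (x - y).
pose s y := Num.sqrt (k1 (x - y)).
have s2 y : s y ^+ 2 = k1 (x - y) by rewrite sqr_sqrtr.
have ms : mfun s.
  apply: (@mfun_comp _ Num.sqrt (fun y => k1 (x - y))); last exact: mfun_refl (mfun_riesz_near a).
  by apply: continuous_measurable_fun; exact: sqrt_continuous.
have ls : l2 s.
  by split => //; under eq_fun do rewrite s2; exact: L1_near.
have lsf : l2 (fun y => s y * f y).
  by split; [exact: mfunM|under eq_fun do rewrite exprMn s2].
have := ip_le_n2 ls lsf.
have -> : ip s (fun y => s y * f y) = cnear f x.
  by congr intg; apply/funext => y; rewrite mulrA -expr2 s2.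
move=> H.
have -> : kap * intg (fun y => k1 (x - y) * f y ^+ 2) = (n2 s * n2 (fun y => s y * f y)) ^+ 2.
  rewrite exprMn !n2E'; congr (_ * _); last by congr intg; apply/funext => y; rewrite exprMn s2.
  by under eq_fun do rewrite s2; rewrite intg_near.
by rewrite -(real_normK (num_real (cnear f x))) ler_pXn2r// nnegrE ?mulr_ge0 ?n2_ge0.
Qed.

(** Young's inequality for an $L^1$ kernel acting on $L^2$: the pointwise bound [cnear_sq_le] is
    integrated by Tonelli. *)
Lemma young_sq f : l2 f ->
  (\int[mu]_x (cnear f x ^+ 2)%:E <= ((kap * n2 f) ^+ 2)%:E)%E.
Proof.
move=> hf; have [mf f2] := hf.
have mf2 : mfun (fun y => f y ^+ 2) by exact: mfunX.
have mk := mfun_riesz_near a.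
have f20 y : 0 <= f y ^+ 2 by exact: sqr_ge0.
have k0 := riesz_near_ge0 a.
have me := measurable_econv mk mf2 k0 f20.
apply: (@le_trans _ _ (\int[mu]_x (kap%:E * \int[mu]_y (k1 (x - y) * f y ^+ 2)%:E))%E).
  apply: ae_ge0_le_integral => //.
  - by move=> x _; rewrite lee_fin sqr_ge0.
  - by apply/measurable_EFinP; apply: mfunX; exact: mfun_cnear.
  - by move=> x _; rewrite mule_ge0 ?lee_fin ?kap_ge0//; apply: integral_ge0 => y _; rewrite lee_fin mulr_ge0.
  - exact: measurable_funeM.
  apply: ae_sub (ae_L1_near_sq hf) => x /= h _.
  by rewrite (intgE h) -EFinM lee_fin cnear_sq_le.
rewrite ge0_integralZl//; last 2 first.
- by move=> x _; apply: integral_ge0 => y _; rewrite lee_fin mulr_ge0.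
- by rewrite lee_fin kap_ge0.
rewrite conv_tonelli// (intgE (L1_riesz_near a0 a1)) (intgE f2) -!EFinM lee_fin.
by rewrite -n2E' exprMn mulrA expr2.
Qed.

Lemma l2_cnear f : l2 f -> l2 (cnear f).
Proof.
move=> hf; have mc := mfun_cnear (l2_mfun hf); split => //.
apply: L1P; first exact: mfunX.
under eq_integral => x _ do rewrite ger0_norm ?sqr_ge0//.
by apply: le_lt_trans (young_sq hf) _; exact: ltry.
Qed.

Lemma young f : l2 f -> n2 (cnear f) <= kap * n2 f.
Proof.
move=> hf; have := young_sq hf; have hc := l2_cnear hf.
rewrite (intgE (l2_sq hc)) lee_fin -n2E' ler_pXn2r// nnegrE ?n2_ge0//.
by rewrite mulr_ge0 ?kap_ge0 ?n2_ge0.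
Qed.

(** For $f$ in $L^2$ the defining integrals are known to converge only almost everywhere; where they
    diverge [intg] need not be additive. *)
Lemma cnearB f g : l2 f -> l2 g ->
  aeq (cnear (fun y => f y - g y)) (fun x => cnear f x - cnear g x).
Proof.
move=> hf hg; apply: ae_sub (ae_and (ae_L1_near_sq hf) (ae_L1_near_sq hg)) => x /= [fx gx].
rewrite /cnear -intgB; [|apply: L1_nearM => //; exact: l2_mfun..].
by congr intg; apply/funext => y; rewrite mulrBr.
Qed.

Lemma rpot_sh f d x : mfun f -> rpot (fun y => f (y + d)) x = rpot f (x + d).
Proof.
move=> mf; rewrite /rpot /cnear /cfar.
have H (k : R -> R) : mfun k -> intg (fun y => k (x - y) * f (y + d)) = intg (fun y => k (x + d - y) * f y).
  move=> mk; rewrite -(intg_sh d (f := fun y => k (x + d - y) * f y)); last first.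
    by apply: mfunM => //; exact: mfun_refl.
  by congr intg; apply/funext => y; congr (k _ * _); ring.
by rewrite !H//; [exact: mfun_riesz_far|exact: mfun_riesz_near].
Qed.

Lemma rpotB_bounded f g x C : L1 f -> L1 g -> (forall y, `|f y| <= C) ->
  (forall y, `|g y| <= C) -> rpot (fun y => f y - g y) x = rpot f x - rpot g x.
Proof.
move=> f1 g1 fC gC; rewrite /rpot cfarB// (cnearB_bounded _ _ _ fC gC); [ring|exact: L1_mfun..].
Qed.

Lemma rpotE f x C : L1 f -> (forall y, `|f y| <= C) ->
  rpot f x = intg (fun y => riesz a (x - y) * f y).
Proof.
move=> f1 fC; rewrite /rpot /cnear /cfar -intgD.
- by congr intg; apply/funext => y; rewrite -mulrDl -rieszE.
- by apply: (L1_nearM_bounded _ _ fC); exact: L1_mfun.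
- exact: L1_farM.
Qed.

Lemma L1_rieszM f x C : L1 f -> (forall y, `|f y| <= C) ->
  L1 (fun y => riesz a (x - y) * f y).
Proof.
move=> f1 fC; have := L1D (L1_nearM_bounded x (L1_mfun f1) fC) (L1_farM x f1).
by congr L1; apply/funext => y; rewrite -mulrDl -rieszE.
Qed.

Lemma rpot_bound f x C : L1 f -> (forall y, `|f y| <= C) ->
  `|rpot f x| <= kap * C + intg (fun y => `|f y|).
Proof.
move=> f1 fC; apply: (le_trans (ler_normD _ _)); apply: lerD; last exact: cfar_bound.
by apply: cnear_bound => //; exact: L1_mfun.
Qed.

Section Nets.
Context {I : Type} (F : set_system I) {FF : Filter F}.

Definition cv1 (f_ : I -> R -> R) (f : R -> R) := [/\ forall i, L1 (f_ i), L1 f &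
  intg (fun x => `|f_ i x - f x|) @[i --> F] --> (0 : R)].

Lemma cv2_mul (f_ g_ : I -> R -> R) f g : cv2 F f_ f -> cv2 F g_ g ->
  cv1 (fun i x => f_ i x * g_ i x) (fun x => f x * g x).
Proof.
move=> [hf_ hf fc] [hg_ hg gc]; split; [by move=> i; exact: l2M|exact: l2M|].
pose v i := n2 (fun x => f_ i x - f x) * (n2 (fun x => g_ i x - g x) + n2 g) +
  n2 f * n2 (fun x => g_ i x - g x).
have v0 : v i @[i --> F] --> 0.
  have -> : 0 = 0 * (0 + n2 g) + n2 f * 0 :> R by ring.
  apply: cvgD; first by apply: cvgM => //; apply: cvgD => //; exact: cvg_cst.
  by apply: cvgM => //; exact: cvg_cst.
have habs (u : R -> R) : l2 u -> l2 (fun x => `|u x|).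
  by move=> hu; apply: (l2_le _ _ hu); [exact: mfun_abs (l2_mfun hu)|move=> x; rewrite normr_id].
have nabs (u : R -> R) : n2 (fun x => `|u x|) = n2 u.
  by rewrite /n2 /ip; congr Num.sqrt; congr intg; apply/funext => x; rewrite -normrM ger0_norm// -expr2 sqr_ge0.
apply: (squeeze0 _ v0) => i; rewrite intg_ge0//=.
have hfi := hf_ i; have hgi := hg_ i.
have hfB := l2B hfi hf; have hgB := l2B hgi hg.
apply: (@le_trans _ _ (ip (fun x => `|f_ i x - f x|) (fun x => `|g_ i x|) +
   ip (fun x => `|f x|) (fun x => `|g_ i x - g x|))).
  rewrite /ip -intgD; [|by apply: l2M; exact: habs..].
  apply: intg_le; [apply: L1_abs; apply: L1B; exact: l2M|by apply: L1D; apply: l2M; exact: habs|move=> x].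
  have -> : f_ i x * g_ i x - f x * g x = (f_ i x - f x) * g_ i x + f x * (g_ i x - g x) by ring.
  by apply: (le_trans (ler_normD _ _)); rewrite !normrM.
have P (u w : R -> R) : l2 u -> l2 w -> ip (fun x => `|u x|) (fun x => `|w x|) <= n2 u * n2 w.
  move=> hu hw; apply: (le_trans (ler_norm _)).
  by rewrite -(nabs u) -(nabs w); apply: ip_le_n2; exact: habs.
apply: lerD; last exact: P.
apply: (le_trans (P _ _ hfB hgi)); rewrite ler_wpM2l ?n2_ge0//.
have -> : g_ i = (fun x => (g_ i x - g x) + g x) by apply/funext => x; ring.
have -> : (fun x => g_ i x - g x + g x - g x) = (fun x => g_ i x - g x) by apply/funext => x; ring.
exact: n2D.
Qed.

Lemma cv1D (f_ g_ : I -> R -> R) f g : cv1 f_ f -> cv1 g_ g ->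
  cv1 (fun i x => f_ i x + g_ i x) (fun x => f x + g x).
Proof.
move=> [hf_ hf fc] [hg_ hg gc]; split; [by move=> i; exact: L1D|exact: L1D|].
apply: (squeeze0' (cvgD fc gc) (addr0 _)) => i; rewrite intg_ge0//=.
have lf := L1_abs (L1B (hf_ i) hf); have lg := L1_abs (L1B (hg_ i) hg).
rewrite [leRHS](_ : _ = intg (fun x => `|f_ i x - f x| + `|g_ i x - g x|)); last by rewrite intgD.
apply: intg_le; [by apply: L1_abs; apply: L1B; exact: L1D|exact: L1D|move=> x].
have -> : f_ i x + g_ i x - (f x + g x) = (f_ i x - f x) + (g_ i x - g x) by ring.
exact: ler_normD.
Qed.

Lemma cvU_cfar (f_ : I -> R -> R) f : cv1 f_ f -> cvU F (fun i => cfar (f_ i)) (cfar f).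
Proof.
move=> [hf_ hf fc]; split.
- by move=> i; apply: mfun_cfar; exact: L1_mfun.
- by apply: mfun_cfar; exact: L1_mfun.
- by exists (intg (fun y => `|f y|)) => x; exact: cfar_bound.
- exists (fun i => intg (fun x => `|f_ i x - f x|)) => // i x.
  by rewrite -cfarB//; apply: cfar_bound; exact: L1B.
Qed.

Lemma cv2_cnear (f_ : I -> R -> R) f : cv2 F f_ f -> cv2 F (fun i => cnear (f_ i)) (cnear f).
Proof.
move=> [hf_ hf fc]; split; [by move=> i; exact: l2_cnear|exact: l2_cnear|].
apply: (squeeze0' (cvgM (cvg_cst kap) fc) (mulr0 _)) => i; rewrite n2_ge0/=.
have hB := l2B (hf_ i) hf.
rewrite -(aeq_n2 _ _ (cnearB (hf_ i) hf)); last 2 first.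
- by apply: mfun_cnear; exact: l2_mfun.
- by apply: mfunB; apply: mfun_cnear; exact: l2_mfun.
exact: young.
Qed.

Lemma cv2_rpotM (f_ h_ : I -> R -> R) f h : cv1 f_ f -> cv2 F f_ f ->
  cvU F h_ h -> cv2 F h_ h ->
  cv2 F (fun i x => rpot (f_ i) x * h_ i x) (fun x => rpot f x * h x).
Proof.
move=> f1 f2 hU h2.
have A : cv2 F (fun i x => h_ i x * cnear (f_ i) x) (fun x => h x * cnear f x).
  by apply: cvU_cv2 => //; exact: cv2_cnear.
have B : cv2 F (fun i x => cfar (f_ i) x * h_ i x) (fun x => cfar f x * h x).
  by apply: cvU_cv2 => //; exact: cvU_cfar.
have := @cv2D _ _ _ FF _ _ _ _ A B.
have -> : (fun i x => h_ i x * cnear (f_ i) x + cfar (f_ i) x * h_ i x) =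
   (fun i x => rpot (f_ i) x * h_ i x).
  by apply/funext => i; apply/funext => x; rewrite /rpot; ring.
have -> // : (fun x => h x * cnear f x + cfar f x * h x) = (fun x => rpot f x * h x).
by apply/funext => x; rewrite /rpot; ring.
Qed.

(** Uniform convergence of the densities makes the near part converge uniformly as well, its kernel
    being integrable. *)
Lemma cvU_rpot (f_ : I -> R -> R) f : cv1 f_ f -> cvU F f_ f ->
  cvU F (fun i => rpot (f_ i)) (rpot f).
Proof.
move=> f1 fU; have c2 := cvU_cfar f1.
have [hf_ hf _] := f1; have [mf_ mf [C fC] [e e0 he]] := fU.
rewrite /rpot; apply: cvUD => //; split.
- by move=> i; exact: mfun_cnear.
- exact: mfun_cnear.
- by exists (kap * C) => x; exact: cnear_bound.
- exists (fun i => kap * e i).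
    by rewrite -(mulr0 kap); apply: cvgM => //; exact: cvg_cst.
  move=> i x.
  have fiC y : `|f_ i y| <= e i + C.
    have -> : f_ i y = (f_ i y - f y) + f y by ring.
    by rewrite (le_trans (ler_normD _ _))// lerD.
  have fC' y : `|f y| <= e i + C.
    by rewrite (le_trans (fC y))// lerDr (le_trans _ (he i 0)).
  rewrite -(cnearB_bounded _ (mf_ i) mf fiC fC').
  by apply: cnear_bound => //; exact: mfunB.
Qed.

End Nets.
End RieszPotential.

Opaque rpot.

(** * Symmetry and sign of the kernel *)

Section RieszSymmetry.
Context {R : realType} (a : R) (a0 : 0 < a) (a1 : a < 1).
Local Notation mu := (@lebesgue_measure R).
Local Notation RR := (measurableTypeR R).
Implicit Types f g h : R -> R.

(** Fubini and evenness of the kernel; the shift changes sign as it passes to the other factor.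
    Nonzero $d$ serves the symmetric difference in [riesz_sign], and $d = 0$ the potential
    energy. *)
Lemma riesz_sym d f g C : L1 f -> L1 g -> (forall x, `|f x| <= C) ->
  (forall x, `|g x| <= C) ->
  intg (fun x => g x * rpot a f (x + d)) = intg (fun y => f y * rpot a g (y - d)).
Proof.
move=> f1 g1 fC gC; have mf := L1_mfun f1; have mg := L1_mfun g1.
have C0 : 0 <= C := le_trans (normr_ge0 _) (fC 0).
pose k z := riesz a (z + d).
have mk : mfun k by apply: mfun_sh; exact: mfun_riesz.
pose H (z : RR * RR) : \bar R := (g z.1 * (k (z.1 - z.2) * f z.2))%:E.
have mH : measurable_fun setT H.
  apply/measurable_EFinP; apply: measurable_funM.
    by apply: (@measurableT_comp _ _ _ _ _ _ (g : RR -> R)) => //; exact: measurable_fst.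
  by apply/measurable_EFinP; exact: measurable_conv.
have kE x y : k (x - y) = riesz a (x + d - y) by rewrite /k; congr riesz; ring.
have kE' x y : k (x - y) = riesz a (y - d - x) by rewrite /k -rieszN; congr riesz; ring.
have iy x : L1 (fun y => k (x - y) * f y).
  by under eq_fun do rewrite kE; exact: (L1_rieszM a0 a1 (x + d) f1 fC).
have ix y : L1 (fun x => k (x - y) * g x).
  by under eq_fun do rewrite kE'; exact: (L1_rieszM a0 a1 (y - d) g1 gC).
have fa1 := L1_abs f1.
have faC x : `| `|f x| | <= C by rewrite normr_id.
have iH : (mu \x mu)%E.-integrable setT H.
  apply/(@integrable12ltyP _ _ RR RR R mu mu H mH).
  (* A uniform bound for the potential of $|f|$; the iterated absolute integral is then at most
     $B\int|g|$. *)
  pose B := kap a * C + intg (fun y => `| `|f y| |).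
  apply: (@le_lt_trans _ _ (\int[mu]_x (`|g x| * B)%:E)%E).
    apply: ge0_le_integral => //.
    - by move=> x _; apply: integral_ge0.
    - have mH' : measurable_fun setT (abse \o H) by exact: measurableT_comp.
      by apply: (@measurable_fun_fubini_tonelli_F _ _ RR RR R mu _ mH') => z; exact: abse_ge0.
    - by apply/measurable_EFinP; apply: mfunM; [exact: mfun_abs|exact: mfun_cst].
    move=> x _; rewrite /H/=.
    have E y : `|g x * (k (x - y) * f y)| = `|g x| * (riesz a (x + d - y) * `|f y|).
      by rewrite !normrM kE (ger0_norm (riesz_ge0 a _)).
    under eq_integral do rewrite E.
    have l := L1Z `|g x| (L1_rieszM a0 a1 (x + d) fa1 faC).
    rewrite (intgE l) lee_fin intgZ; last exact: (L1_rieszM a0 a1 (x + d) fa1 faC).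
    rewrite ler_wpM2l// -(rpotE a0 a1 (x + d) fa1 faC).
    by apply: (le_trans (ler_norm _)); exact: rpot_bound.
  have l : L1 (fun x => `|g x| * B).
    by have := L1Z B (L1_abs g1); congr L1; apply/funext => x; rewrite mulrC.
  by rewrite (intgE l) ltry.
have FB := @Fubini _ _ RR RR R mu mu H iH.
have L x : (\int[mu]_y H (x, y) = (g x * rpot a f (x + d))%:E)%E.
  rewrite /H/= (rpotE a0 a1 (x + d) f1 fC) (intgE (L1Z (g x) (iy x))) intgZ; last exact: iy.
  suff -> : (fun y => k (x - y) * f y) = (fun y => riesz a (x + d - y) * f y) by [].
  by apply/funext => y; rewrite kE.
have Rr y : (\int[mu]_x H (x, y) = (f y * rpot a g (y - d))%:E)%E.
  have -> : (\int[mu]_x H (x, y) = \int[mu]_x (f y * (k (x - y) * g x))%:E)%E.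
    by apply: eq_integral => x _; rewrite /H/=; congr EFin; ring.
  rewrite (intgE (L1Z (f y) (ix y))) intgZ; last exact: ix.
  rewrite (rpotE a0 a1 (y - d) g1 gC).
  suff -> : (fun x => k (x - y) * g x) = (fun x => riesz a (y - d - x) * g x) by [].
  by apply/funext => x; rewrite kE'.
rewrite /intg /Rintegral; congr fine.
transitivity (\int[mu]_x \int[mu]_y H (x, y))%E.
  by apply: eq_integral => x _; rewrite L.
by rewrite FB; apply: eq_integral => y _; rewrite Rr.
Qed.

Opaque intg.

Lemma intg_le0_ae f : L1 f -> {ae mu, forall x : RR, f x <= 0} -> intg f <= 0.
Proof.
move=> f1 fle; have mf := L1_mfun f1.
have mm : mfun (fun x => Num.min (f x) 0) by apply: measurable_minr.
have E : aeq f (fun x => Num.min (f x) 0) by apply: ae_sub fle => x /= h; rewrite min_l.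
rewrite (aeq_intg mf mm E) -[leRHS]intg0; apply: intg_le.
- exact: aeq_L1 mm E f1.
- exact: L1_0.
- by move=> x; rewrite ge_min lexx orbT.
Qed.

(** The origin has to be excluded for $u$, because [riesz a 0] is 0 by convention. *)
Lemma riesz_decr (u v : R) : u != 0 -> `|u| <= `|v| -> riesz a v <= riesz a u.
Proof.
move=> u0 uv; have u0' : 0 < `|u| by rewrite normr_gt0.
rewrite /riesz !powRN lef_pV2 ?posrE ?powR_gt0//; last exact: lt_le_trans uv.
by apply: ge0_ler_powR; rewrite ?nnegrE// ltW.
Qed.

(** If $y < x$, then $|x - d - y| \le x - y + d$, so the shift by $+d$ gives the smaller kernel
    value; if $x \le y$ the roles are exchanged. Monotonicity of [phi] makes the two signs
    opposite. *)
Lemma riesz_pair (phi : R -> R) (d x y : R) : 0 < d -> {homo phi : x y / x <= y} ->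
  x + d - y != 0 -> x - d - y != 0 ->
  (riesz a (x + d - y) - riesz a (x - d - y)) * (phi x - phi y) <= 0.
Proof.
move=> d0 incr n1 n2.
have [yx|xy] := ltP y x.
  have h1 := incr _ _ (ltW yx).
  have h2 : riesz a (x + d - y) <= riesz a (x - d - y).
    apply: riesz_decr => //; rewrite [leRHS]ger0_norm; last lra.
    by rewrite ler_norml; apply/andP; split; lra.
  by rewrite mulr_le0_ge0 ?subr_le0 ?subr_ge0.
have h1 := incr _ _ xy.
have h2 : riesz a (x - d - y) <= riesz a (x + d - y).
  apply: riesz_decr => //; rewrite [leRHS]ler0_norm; last lra.
  by rewrite ler_norml; apply/andP; split; lra.
by rewrite mulr_ge0_le0 ?subr_le0 ?subr_ge0.
Qed.

(* Symmetrising in [x] and [y] by [riesz_sym] replaces [phi x] by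
   [phi x - phi y], whose sign is opposite to that of the kernel difference. *)
Lemma riesz_sign (d C : R) m phi : 0 < d -> L1 m -> (forall x, 0 <= m x <= C) ->
  mfun phi -> (forall x, `|phi x| <= 1) -> {homo phi : x y / x <= y} ->
  intg (fun x => phi x * m x * (rpot a m (x + d) - rpot a m (x - d))) <= 0.
Proof.
move=> d0 m1 mC mphi phi1 incr.
have dbl (z : R) : z + z <= 0 -> z <= 0 by lra.
have mm := L1_mfun m1.
have mC' x : `|m x| <= C by have /andP[h1 h2] := mC x; rewrite ger0_norm.
have C0 : 0 <= C := le_trans (normr_ge0 _) (mC' 0).
pose g x := phi x * m x.
have g1 : L1 g.
  apply: (L1_le _ _ (L1_abs m1)); first exact: mfunM.
  by move=> x; rewrite normrM ler_piMl.
have gC x : `|g x| <= C by rewrite normrM (le_trans _ (mC' x))// ler_piMl.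
have LM u v e : L1 u -> L1 v -> (forall x, `|u x| <= C) -> (forall x, `|v x| <= C) -> L1 (fun x => u x * rpot a v (x + e)).
  move=> u1 v1 uC vC; pose B := kap a * C + intg (fun y => `|v y|).
  apply: (L1_le _ _ (L1Z B (L1_abs u1))).
    by apply: mfunM; [exact: L1_mfun|apply: mfun_sh; apply: mfun_rpot; exact: L1_mfun].
  by move=> x; rewrite normrM mulrC ler_wpM2r//; exact: rpot_bound.
have E1 := riesz_sym d m1 g1 mC' gC.
have E2 := riesz_sym (- d) m1 g1 mC' gC.
move EJ : (intg _) => J.
have JE : J = intg (fun x => g x * rpot a m (x + d)) - intg (fun x => g x * rpot a m (x - d)).
  rewrite -intgB; [|exact: LM..]; rewrite -EJ.
  by congr intg; apply/funext => x; rewrite /g mulrBr.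
have opN : (fun x => m x * rpot a g (x - - d)) = (fun x => m x * rpot a g (x + d)).
  by apply/funext => x; rewrite opprK.
rewrite opN in E2.
have JE2 : J = intg (fun x => m x * rpot a g (x - d)) - intg (fun x => m x * rpot a g (x + d)).
  exact: (etrans JE (congr2 (fun u v => u - v) E1 E2)).
(* Adding the original and the transposed form of the same integral antisymmetrises the weight;
   [dbl] removes the factor 2 afterwards. *)
have J2 : J + J = intg (fun x => g x * (rpot a m (x + d) - rpot a m (x - d)) -
     m x * (rpot a g (x + d) - rpot a g (x - d))).
  rewrite {1}JE JE2 -!intgB; [|exact: LM..]; rewrite -intgD; [|by apply: L1B; exact: LM..].
  congr intg; apply/funext => x.
  move: (rpot a m (x + d)) (rpot a m (x - d)) (rpot a g (x + d)) (rpot a g (x - d)) => A B C1 D1.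
  ring.
apply: dbl.
have lJ : L1 (fun x => g x * (rpot a m (x + d) - rpot a m (x - d)) -
     m x * (rpot a g (x + d) - rpot a g (x - d))).
  have := L1D (L1B (LM _ _ d g1 m1 gC mC') (LM _ _ (- d) g1 m1 gC mC'))
    (L1B (LM _ _ (- d) m1 g1 mC' gC) (LM _ _ d m1 g1 mC' gC)).
  set A := (X in L1 X -> _); set B := (X in _ -> L1 X).
  suff -> : A = B by exact: id.
  apply/funext => x; rewrite {}/A {}/B.
  move: (rpot a m (x + d)) (rpot a m (x - d)) (rpot a g (x + d)) (rpot a g (x - d)) => A' B' C1 D1.
  ring.
clear JE JE2 opN E1 E2 EJ; rewrite {}J2; apply: intg_le0_ae; first exact: lJ.
clear lJ; apply: aeW => x.
have kx u (y : R) : L1 u -> (forall x, `|u x| <= C) -> L1 (fun z => riesz a (y - z) * u z).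
  by move=> u1 uC; exact: (L1_rieszM a0 a1 y u1 uC).
pose P y := (riesz a (x + d - y) - riesz a (x - d - y)) * (phi x - phi y) * m y.
have lP : L1 P.
  have := L1B (L1Z (phi x) (L1B (kx _ (x + d) m1 mC') (kx _ (x - d) m1 mC')))
    (L1B (kx _ (x + d) g1 gC) (kx _ (x - d) g1 gC)).
  by congr L1; apply/funext => y; rewrite /P /g; ring.
have -> : g x * (rpot a m (x + d) - rpot a m (x - d)) -
     m x * (rpot a g (x + d) - rpot a g (x - d)) = m x * intg P.
  rewrite !(rpotE a0 a1 _ m1 mC') !(rpotE a0 a1 _ g1 gC) /g -mulrA mulrCA -mulrBr.
  congr (_ * _); rewrite -!intgB; [|exact: kx..].
  rewrite -intgZ; last by apply: L1B; exact: kx.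
  rewrite -intgB; [|by [apply: L1Z; apply: L1B; exact: kx|apply: L1B; exact: kx]..].
  by congr intg; apply/funext => y; rewrite /P /g; ring.
have /andP[m0 _] := mC x.
apply: mulr_ge0_le0; first exact: m0.
apply: intg_le0_ae; first exact: lP.
(* These two values of $y$ evaluate the kernel at 0, where [riesz_decr] fails. *)
apply: ae_sub (ae_and (ae_neq (x + d)) (ae_neq (x - d))) => y /= [y1 y2].
have /andP[my _] := mC y.
have n1 : x + d - y != 0 by rewrite subr_eq0 eq_sym.
have n2 : x - d - y != 0 by rewrite subr_eq0 eq_sym.
rewrite /P; apply: mulr_le0_ge0 => //; exact: riesz_pair.
Qed.
End RieszSymmetry.

(** * Sup norm bounds and convergence in H^1 *)

Section FtcTools.
Context {R : realType}.
Implicit Types f g h : R -> R.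

(** The inequality $|f(x)| \le |f(y)| + \sqrt r\,\|g\|$ is averaged over $y$ in $[x, x+r]$. The
    length $r$ stays free: it is taken small in the final upgrade from weighted $L^2$ decay to
    uniform decay. *)
Lemma ftc_sup_local f g x (r : R) : ftc f g -> 0 < r ->
  `|f x| * r <= Num.sqrt r * n2 (fun z => ind x (x + r) z * f z) + Num.sqrt r * n2 g * r.
Proof.
move=> fg r0; have [hf hg _] := fg.
have xr : x <= x + r by lra.
have -> : `|f x| * r = intg (fun y => ind x (x + r) y * `|f x|).
  have -> : (fun y => ind x (x + r) y * `|f x|) = (fun y => `|f x| * ind x (x + r) y).
    by apply/funext => y; rewrite mulrC.
  by rewrite intgZ; [rewrite intg_ind// addrAC subrr add0r|exact: L1_ind].
have lfi : L1 (fun y => `|ind x (x + r) y * f y|) by apply: L1_abs; exact: L1loc_l2.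
have lc c : L1 (fun y => ind x (x + r) y * c).
  by have := L1Z c (L1_ind x (x + r)); congr L1; apply/funext => y; rewrite mulrC.
apply: (@le_trans _ _ (intg (fun y => `|ind x (x + r) y * f y| + ind x (x + r) y * (Num.sqrt r * n2 g)))).
  apply: intg_le; [exact: lc|by apply: L1D|move=> y].
  rewrite indE; case: ifPn => [/andP[xy yr]|_]; last by rewrite !mul0r normr0 addr0.
  rewrite !mul1r.
  have := ftc_holder2 fg xy.
  have : Num.sqrt (y - x) <= Num.sqrt r by apply: ler_wsqrtr; lra.
  have := n2_ge0 g => h1 h2 h3.
  have : `|f x| <= `|f y| + `|f y - f x|.
    by have := ler_normB (f y) (f y - f x); rewrite opprB addrC subrK.
  nra.
rewrite intgD//; apply: lerD.
  have -> : intg (fun y => `|ind x (x + r) y * f y|) =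
      ip (ind x (x + r)) (fun y => `|ind x (x + r) y * f y|).
    congr intg; apply/funext => y; rewrite normrM (ger0_norm (andP (ind01 _ _ _)).1).
    by rewrite mulrA ind_sq.
  have li := l2_indM x (x + r) hf.
  have la : l2 (fun y => `|ind x (x + r) y * f y|).
    by apply: (l2_le _ _ li); [exact: mfun_abs (l2_mfun li)|move=> y; rewrite normr_id].
  apply: (le_trans (ler_norm _)); apply: (le_trans (ip_le_n2 (l2_ind _ _) la)).
  rewrite n2_ind// addrAC subrr add0r ler_wpM2l ?sqrtr_ge0//.
  by apply: n2_le; [exact: l2_mfun|exact: li|move=> y; rewrite normr_id].
have -> : (fun y => ind x (x + r) y * (Num.sqrt r * n2 g)) =
    (fun y => (Num.sqrt r * n2 g) * ind x (x + r) y).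
  by apply/funext => y; rewrite mulrC.
by rewrite intgZ; [rewrite intg_ind// addrAC subrr add0r|exact: L1_ind].
Qed.

Lemma ftc_sup f g x : ftc f g -> `|f x| <= n2 f + n2 g.
Proof.
move=> fg; have [hf _ _] := fg.
have := @ftc_sup_local f g x 1 fg ltr01; rewrite mulr1 sqrtr1 !mul1r mulr1 => h.
apply: (le_trans h); rewrite lerD2r -[leRHS]mul1r; apply: n2Mb => //; first exact: mfun_ind.
by move=> y; have /andP[i0 i1] := ind01 x (x + 1) y; rewrite ger0_norm.
Qed.

Lemma ftcB f1 g1 f2 g2 : ftc f1 g1 -> ftc f2 g2 ->
  ftc (fun x => f1 x - f2 x) (fun x => g1 x - g2 x).
Proof.
move=> h1 h2; have [a1 b1 _] := h1; have [a2 b2 _] := h2.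
split; [exact: l2B..|move=> x y xy].
rewrite Rintegral_ind.
have -> : (fun z => ind x y z * (g1 z - g2 z)) = (fun z => ind x y z * g1 z - ind x y z * g2 z).
  by apply/funext => z; rewrite mulrBr.
by rewrite intgB; [rewrite -(ftcE h1 xy) -(ftcE h2 xy); ring|exact: L1loc_l2..].
Qed.

Lemma ftc_sh c f g : ftc f g -> ftc (fun x => f (x + c)) (fun x => g (x + c)).
Proof.
move=> h1; have [a1 b1 _] := h1.
split; [exact: l2_sh..|move=> x y xy].
rewrite Rintegral_ind (ftcE h1 (x := x + c) (y := y + c)); last by rewrite lerD2r.
rewrite -(intg_sh c (f := fun z => ind (x + c) (y + c) z * g z)); last first.
  by apply: mfunM; [exact: mfun_ind|exact: l2_mfun].
congr intg; apply/funext => z; congr (_ * _).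
by rewrite -ind_shift addrK.
Qed.

Definition cvH {I : Type} (F : set_system I) (f_ g_ : I -> R -> R) f g :=
  [/\ forall i, ftc (f_ i) (g_ i), ftc f g, cv2 F f_ f & cv2 F g_ g].

Section Nets.
Context {I : Type} (F : set_system I) {FF : Filter F}.

Lemma cvH_cst f g : ftc f g -> cvH F (fun=> f) (fun=> g) f g.
Proof. by move=> h; have [? ? _] := h; split => //; exact: cv2_cst. Qed.

Lemma cvH_cvU (f_ g_ : I -> R -> R) f g : cvH F f_ g_ f g -> cvU F f_ f.
Proof.
move=> [hi h [_ _ fc] [_ _ gc]]; have [hf _ _] := h; split.
- by move=> i; have [? _ _] := hi i; exact: l2_mfun.
- exact: l2_mfun.
- by exists (n2 f + n2 g) => x; exact: ftc_sup.
- exists (fun i => n2 (fun x => f_ i x - f x) + n2 (fun x => g_ i x - g x)).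
    by rewrite -[X in _ --> X](addr0 0); exact: cvgD.
  by move=> i x; exact: ftc_sup (ftcB (hi i) h).
Qed.

(** Uniformity in the moving shift comes from $|f(x+d) - f(x)| \le \sqrt{|d|}\,\|g\|$ for the limit
    function. *)
Lemma cvH_cvU_sh (d : I -> R) (f_ g_ : I -> R -> R) f g : d i @[i --> F] --> (0 : R) ->
  cvH F f_ g_ f g -> cvU F (fun i x => f_ i (x + d i)) f.
Proof.
move=> dc h; have [hi hf [_ _ fc] [hg_ hg gc]] := h.
have [mi mf fb [e e0 he]] := cvH_cvU h; split => //.
  by move=> i; exact: mfun_sh.
exists (fun i => Num.sqrt `|d i| * n2 g + e i + e i + e i).
  have -> : 0 = Num.sqrt `|(0 : R)| * n2 g + 0 + 0 + 0 by rewrite normr0 sqrtr0; ring.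
  apply: cvgD => //; apply: cvgD => //; apply: cvgD => //; apply: cvgM; last exact: cvg_cst.
  apply: (@continuous_cvg _ _ _ _ _ (fun i => `|d i|) Num.sqrt); first exact: sqrt_continuous.
  exact: cvg_norm.
move=> i x.
have H : `|f (x + d i) - f x| <= Num.sqrt `|d i| * n2 g.
  have [d0|d0] := leP 0 (d i).
    have xd : x <= x + d i by lra.
    by have := ftc_holder2 hf xd; rewrite addrAC subrr add0r (ger0_norm d0).
  have xd : x + d i <= x by lra.
  have := ftc_holder2 hf xd; rewrite distrC.
  by rewrite (_ : x - (x + d i) = - d i); [rewrite (ltr0_norm d0)|ring].
have -> : f_ i (x + d i) - f x = (f_ i (x + d i) - f (x + d i)) + (f (x + d i) - f x) by ring.
apply: (le_trans (ler_normD _ _)).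
have := he i (x + d i); have := he i x; have := normr_ge0 (f_ i x - f x); lra.
Qed.

Lemma cvH_cv2_sh (d : I -> R) (f_ g_ : I -> R -> R) f g : d i @[i --> F] --> (0 : R) ->
  cvH F f_ g_ f g -> cv2 F (fun i x => f_ i (x + d i)) f.
Proof.
move=> dc h; have [hi hf [hf_ hf2 fc] [hg_ hg gc]] := h.
split => //; first by move=> i; exact: l2_sh.
have v0 : `|d i| * n2 g + n2 (fun x => f_ i x - f x) @[i --> F] --> 0.
  have -> : 0 = `|(0 : R)| * n2 g + 0 by rewrite normr0; ring.
  by apply: cvgD => //; apply: cvgM; [exact: cvg_norm|exact: cvg_cst].
apply: (squeeze0 _ v0) => i; rewrite n2_ge0/=.
rewrite (_ : (fun x => _) = (fun x => (f (x + d i) - f x) + (f_ i (x + d i) - f (x + d i)))); last first.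
  by apply/funext => x; ring.
have hB := l2B (hf_ i) hf2.
apply: (le_trans (n2D _ _)).
- by apply: l2B => //; exact: l2_sh.
- exact: (l2_sh (d i) hB).
rewrite lerD//; first exact: n2_sh_sub (ftc_sd hf).
by rewrite (n2_sh (d i) hB).
Qed.

Lemma cvH_cv2_dq (d : I -> R) (f_ g_ : I -> R -> R) f g : d i @[i --> F] --> (0 : R)^' ->
  cvH F f_ g_ f g -> cv2 F (fun i => dq (d i) (f_ i)) g.
Proof.
move=> dc [hi h fc gc]; apply: (@cv2_dq _ _ F FF d f_ g_ f g) => //.
- by move=> i; exact: ftc_sd.
- exact: ftc_sd.
- by move=> i; apply: ftc_sd; exact: ftcB.
Qed.

Lemma cvg_dnbhs0 (d : I -> R) : d i @[i --> F] --> (0 : R)^' -> d i @[i --> F] --> (0 : R).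
Proof. by move=> h; apply: cvg_trans h _; exact: nbhs_dnbhs. Qed.

(** The quotient of $f^2$ is $(f(x+d) + f(x))\,D_d f$. The first factor converges both in $L^2$ and
    uniformly, which yields $L^1$ and $L^2$ convergence of the product. *)
Lemma cvH_dq_sq (d : I -> R) (f_ g_ : I -> R -> R) f g : d i @[i --> F] --> (0 : R)^' ->
  cvH F f_ g_ f g ->
  cv1 F (fun i => dq (d i) (fun x => f_ i x ^+ 2)) (fun x => 2 * (f x * g x)) /\
  cv2 F (fun i => dq (d i) (fun x => f_ i x ^+ 2)) (fun x => 2 * (f x * g x)).
Proof.
move=> dc h; have dc0 := cvg_dnbhs0 dc.
have [_ _ fc _] := h.
have A := cvH_cv2_dq dc h.
have B := @cv2D _ _ F FF _ _ _ _ (cvH_cv2_sh dc0 h) fc.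
have U := @cvUD _ _ F FF _ _ _ _ (cvH_cvU_sh dc0 h) (cvH_cvU h).
have E : (fun i => dq (d i) (fun x => f_ i x ^+ 2)) =
   (fun i x => (f_ i (x + d i) + f_ i x) * dq (d i) (f_ i) x).
  by apply/funext => i; apply/funext => x; rewrite /dq mulrA; congr (_ / _); ring.
have E2 : (fun x => 2 * (f x * g x)) = (fun x => (f x + f x) * g x).
  by apply/funext => x; ring.
rewrite E E2; split; first exact: (@cv2_mul _ _ F FF _ _ _ _ B A).
exact: (@cvU_cv2 _ _ F FF _ _ _ _ U A).
Qed.
End Nets.
End FtcTools.

Transparent rpot intg.

(** * Multipliers of H^1 and weak evolution equations *)

Section Multipliers.
Context {R : realType}.
Implicit Types f g : R -> R.

Lemma dqM d f g x : dq d (fun x => f x * g x) x = f (x + d) * dq d g x + dq d f x * g x.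
Proof. by rewrite /dq [in RHS]mulrA [X in _ = _ + X]mulrAC -mulrDl; congr (_ / _); ring. Qed.

Lemma ip_dq d f g : l2 f -> l2 g -> ip (dq d f) g = - ip f (dq (- d) g).
Proof.
move=> hf hg.
have E c h : dq c h = (fun x => c^-1 * (h (x + c) - h x)).
  by apply/funext => x; rewrite /dq mulrC.
rewrite !E ipZl//; last by apply: l2B => //; exact: l2_sh.
rewrite ipZr//; last by apply: l2B => //; exact: l2_sh.
rewrite ipBl//; last exact: l2_sh.
rewrite ipBr//; last exact: l2_sh.
have -> : ip (fun x => f (x + d)) g = ip f (fun x => g (x + - d)).
  rewrite /ip -(intg_sh d (f := fun x => f x * g (x + - d))); last first.
    by apply: mfunM; [exact: l2_mfun|apply: mfun_sh; exact: l2_mfun].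
  by congr intg; apply/funext => x; rewrite addrK.
by rewrite invrN; ring.
Qed.

Lemma cvg_dnbhs_id : (h : R) @[h --> (0 : R)^'] --> (0 : R).
Proof. exact: nbhs_dnbhs. Qed.

(* [psi'] need not be bounded: for the potential it is only such that [psi' f] is
   in L^2 when [f] is in H^1. *)
Definition mult (psi psi' : R -> R) := [/\ mfun psi, mfun psi',
  exists C : R, forall x, `|psi x| <= C,
  forall f g, ftc f g -> sd (fun x => psi x * f x) (fun x => psi' x * f x + psi x * g x) &
  exists C : R, forall f g, ftc f g ->
    l2 (fun x => psi' x * f x) /\ n2 (fun x => psi' x * f x) <= C * (n2 f + n2 g)].

(** Bounded Lipschitz functions with bounded derivative off the origin: this admits weights built
    from $|x|$, whose derivative jumps at 0. *)
Definition lipm (psi psi' : R -> R) := [/\ mfun psi, mfun psi',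
  exists C : R, forall x, [/\ `|psi x| <= C, `|psi' x| <= C &
     forall d, `|psi (x + d) - psi x| <= C * `|d|] &
  forall x, x != 0 -> dq d psi x @[d --> (0 : R)^'] --> psi' x].

Lemma n2_cvg0 {I : Type} (F : set_system I) {FF : Filter F} (f_ : I -> R -> R) :
  intg (fun x => f_ i x ^+ 2) @[i --> F] --> (0 : R) -> n2 (f_ i) @[i --> F] --> (0 : R).
Proof.
move=> h; rewrite (_ : (0 : R) = Num.sqrt (0 : R)); last by rewrite sqrtr0.
by apply: (@continuous_cvg _ _ _ _ _ (fun i => ip (f_ i) (f_ i)) Num.sqrt); [exact: sqrt_continuous|exact: h].
Qed.

Lemma dq_bound (C d : R) psi x : 0 <= C -> `|psi (x + d) - psi x| <= C * `|d| -> `|dq d psi x| <= C.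
Proof.
move=> C0 h; rewrite /dq; have [->|d0] := eqVneq d 0; first by rewrite invr0 mulr0 normr0.
by rewrite normrM normfV ler_pdivrMr ?normr_gt0.
Qed.

(** In the discrete product rule the Lipschitz constant dominates $D_d\psi$, so $(D_d\psi) f$ tends
    to $\psi' f$ in $L^2$ by dominated convergence. *)
Lemma lipm_mult psi psi' : lipm psi psi' -> mult psi psi'.
Proof.
move=> [mp mp' [C HC] lim].
have pC x : `|psi x| <= C by have [] := HC x.
have pC' x : `|psi' x| <= C by have [] := HC x.
have C0 : 0 <= C := le_trans (normr_ge0 _) (pC 0).
have pL d x : `|dq d psi x| <= C by apply: dq_bound => //; have [] := HC x.
split => //; first by exists C.
  move=> f g fg; have [hf hg _] := fg.
  have md d : mfun (dq d psi) by apply: mfunM; [apply: mfunB => //; exact: mfun_sh|exact: mfun_cst].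
  apply/sdP; split; [exact: l2Mb pC hf|by apply: l2D; [exact: l2Mb pC' hf|exact: l2Mb pC hg]|].
  rewrite (_ : (fun d => _) = (fun d x => dq d psi x * f x + psi (x + d) * dq d f x)); last first.
    by apply/funext => d; apply/funext => x; rewrite dqM addrC.
  apply: cv2D; last first.
    apply: cvU_cv2; last by have /sdP[] := ftc_sd fg.
    split => //; [by move=> d; exact: mfun_sh|by exists C|].
    exists (fun d => C * `|d|); last by move=> d x; have [] := HC x.
    rewrite [X in _ --> X](_ : (0 : R) = C * `|(0 : R)|); last by rewrite normr0 mulr0.
    by apply: cvgM; [exact: cvg_cst|apply: cvg_norm; exact: cvg_dnbhs_id].
  split; [by move=> d; exact: l2Mb (pL d) hf|exact: l2Mb pC' hf|].
  apply/cvgr_dnbhsP => u [u0 ucvg]; apply: n2_cvg0.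
  rewrite -[X in _ --> X](@intg0 R).
  apply: (@dct R _ _ (fun x => (2 * C) ^+ 2 * f x ^+ 2)).
  - by move=> n; apply: mfunX; apply: mfunB; apply: mfunM => //; exact: l2_mfun.
  - exact: mfun_cst.
  - by apply: L1Z; exact: l2_sq.
  - move=> n x; rewrite -mulrBl normrX -(real_normK (num_real (f x))) -exprMn normrM.
    rewrite ler_pXn2r ?nnegrE ?mulr_ge0// ler_wpM2r//.
    apply: (le_trans (ler_normB _ _)); have := pL (u n) x; have := pC' x; lra.
  apply: ae_sub (ae_neq 0) => x /= x0.
  have /cvgr_dnbhsP/(_ u (conj u0 ucvg)) h := lim x x0.
  have : ((dq (u n) psi x * f x - psi' x * f x) ^+ 2 @[n --> \oo] --> (psi' x * f x - psi' x * f x) ^+ 2).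
    rewrite !expr2; apply: cvgM; apply: cvgB; try exact: cvg_cst; apply: cvgM; try exact: cvg_cst; exact: h.
  by rewrite subrr expr0n.
exists C => f g fg; have [hf hg _] := fg; split; first exact: l2Mb pC' hf.
apply: (le_trans (n2Mb mp' pC' hf)); rewrite ler_wpM2l// lerDl; exact: n2_ge0.
Qed.

Lemma mult_cst (c : R) : mult (fun=> c) (fun=> 0).
Proof.
apply: lipm_mult; split; [exact: mfun_cst..| |].
  exists `|c| => x; split => //; first by rewrite normr0.
  by move=> d; rewrite subrr normr0 mulr_ge0.
move=> x _; rewrite (_ : (fun d => _) = (fun=> 0)); first exact: cvg_cst.
by apply/funext => d; rewrite /dq subrr mul0r.
Qed.

Lemma multD psi psi' chi chi' : mult psi psi' -> mult chi chi' ->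
  mult (fun x => psi x + chi x) (fun x => psi' x + chi' x).
Proof.
move=> [a1 a2 [C HC] a3 [D HD]] [b1 b2 [C' HC'] b3 [D' HD']].
split; [exact: mfunD..| | |].
- by exists (C + C') => x; rewrite (le_trans (ler_normD _ _))// lerD.
- move=> f g fg; have := sdD (a3 _ _ fg) (b3 _ _ fg).
  by congr sd; apply/funext => x; ring.
exists (D + D') => f g fg; have [h1 k1] := HD _ _ fg; have [h2 k2] := HD' _ _ fg.
rewrite (_ : (fun x => _) = (fun x => psi' x * f x + chi' x * f x)); last by apply/funext => x; rewrite mulrDl.
by split; [exact: l2D|rewrite (le_trans (n2D h1 h2))// mulrDl lerD].
Qed.

Section MultNets.
Context {I : Type} (F : set_system I) {FF : Filter F}.

Lemma mult_cv2 psi psi' (f_ g_ : I -> R -> R) f g : mult psi psi' -> cvH F f_ g_ f g ->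
  [/\ cv2 F (fun i x => psi x * f_ i x) (fun x => psi x * f x),
      cv2 F (fun i x => psi' x * f_ i x) (fun x => psi' x * f x) &
      cv2 F (fun i x => psi' x * f_ i x + psi x * g_ i x) (fun x => psi' x * f x + psi x * g x)].
Proof.
move=> [mp mp' [C HC] _ [D HD]] [hi h fc gc].
have U : cvU F (fun=> psi) psi by exact: cvU_cst HC.
have A : cv2 F (fun i x => psi' x * f_ i x) (fun x => psi' x * f x).
  split; [by move=> i; exact: (HD _ _ (hi i)).1|exact: (HD _ _ h).1|].
  have [_ _ fc'] := fc; have [_ _ gc'] := gc.
  have v0 : D * (n2 (fun x => f_ i x - f x) + n2 (fun x => g_ i x - g x)) @[i --> F] --> 0.
    rewrite -(mulr0 D) -[X in D * X](addr0 0); apply: cvgM; first exact: cvg_cst.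
    exact: cvgD.
  apply: (squeeze0 _ v0) => i; rewrite n2_ge0/=.
  rewrite (_ : (fun x => _) = (fun x => psi' x * (f_ i x - f x))); last by apply/funext => x; rewrite mulrBr.
  exact: (HD _ _ (ftcB (hi i) h)).2.
split; [exact: (@cvU_cv2 _ _ F FF _ _ _ _ U fc)|exact: A|].
exact: (@cv2D _ _ F FF _ _ _ _ A (@cvU_cv2 _ _ F FF _ _ _ _ U gc)).
Qed.
End MultNets.
End Multipliers.

Lemma cvg_sub0 {R : realType} {I : Type} (F : set_system I) {FF : Filter F} (u v : I -> R) (l : R) :
  u i - v i @[i --> F] --> (0 : R) -> v i @[i --> F] --> l -> u i @[i --> F] --> l.
Proof.
move=> h1 h2; have -> : u = (fun i => (u i - v i) + v i) by apply/funext => i; rewrite subrK.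
by rewrite -[X in _ --> X]add0r; exact: cvgD.
Qed.

Lemma n2_sub_le {R : realType} (f g : R -> R) : l2 f -> l2 g -> n2 f <= n2 g + n2 (fun x => f x - g x).
Proof.
move=> hf hg; have := n2D hg (l2B hf hg).
by have -> : (fun x => g x + (f x - g x)) = f by apply/funext => x; ring.
Qed.

Section Composition.
Context {R : realType} {I J : Type} (F : set_system I) (G : set_system J).

Lemma cv2_comp (d : I -> J) (f_ : J -> R -> R) f : d i @[i --> F] --> G ->
  cv2 G f_ f -> cv2 F (fun i => f_ (d i)) f.
Proof. by move=> dG [h1 h2 h3]; split => //; exact: (@cvg_comp _ _ _ d (fun j => n2 (fun x => f_ j x - f x)) _ _ _ dG h3). Qed.

Lemma cvH_comp (d : I -> J) (f_ g_ : J -> R -> R) f g : d i @[i --> F] --> G ->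
  cvH G f_ g_ f g -> cvH F (fun i => f_ (d i)) (fun i => g_ (d i)) f g.
Proof. by move=> dG [h1 h2 h3 h4]; split => //; [exact: cv2_comp dG h3|exact: cv2_comp dG h4]. Qed.
End Composition.

(** * Weak evolution equations and the product rule *)

Section Evolution.
Context {R : realType}.
Implicit Types (r rx A B s sx : R -> R -> R) (f g : R -> R).

(* [r] solves r_t = - A_x + B, weakly in H^1. *)
Definition evol r rx A B := [/\ forall t : R, cvH (nbhs t) r rx (r t) (rx t),
  forall t : R, cv2 (nbhs t) A (A t), forall t : R, cv2 (nbhs t) B (B t) &
  forall t e : R, 0 < e -> exists2 d : R, 0 < d & forall h : R, `|h| < d ->
    forall f g, sd f g -> `|ip (fun x => r (t + h) x - r t x) f -
      h * (ip (A t) g + ip (B t) f)| <= e * `|h| * (n2 f + n2 g)].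

Lemma evol_l2 r rx A B t : evol r rx A B -> [/\ ftc (r t) (rx t), l2 (r t), l2 (rx t), l2 (A t) & l2 (B t)].
Proof.
move=> [h1 h2 h3 _]; have [_ h _ _] := h1 t; have [? ? _] := h.
by have [_ ? _] := h2 t; have [_ ? _] := h3 t.
Qed.

Lemma ftcZ (c : R) f g : ftc f g -> ftc (fun x => c * f x) (fun x => c * g x).
Proof.
move=> h1; have [a1 b1 _] := h1.
split; [exact: l2Z..|move=> x y xy].
rewrite Rintegral_ind.
have -> : (fun z => ind x y z * (c * g z)) = (fun z => c * (ind x y z * g z)).
  by apply/funext => z; ring.
by rewrite intgZ; [rewrite -(ftcE h1 xy); ring|exact: L1loc_l2].
Qed.

Lemma dqE (d : R) f : dq d f = (fun x => d^-1 * (f (x + d) - f x)).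
Proof. by apply/funext => x; rewrite /dq mulrC. Qed.

Lemma ftc_dq d f g : ftc f g -> ftc (dq d f) (dq d g).
Proof. by move=> fg; rewrite !dqE; apply: ftcZ; apply: ftcB => //; exact: ftc_sh. Qed.

Lemma sd_dq d f g : sd f g -> sd (dq d f) (dq d g).
Proof. by move=> fg; rewrite !dqE; apply: sdZ; apply: sdB => //; exact: sd_sh. Qed.

Lemma cv2_dq_fixed {I : Type} (F : set_system I) {FF : Filter F} (f_ : I -> R -> R) f d :
  cv2 F f_ f -> cv2 F (fun i => dq d (f_ i)) (dq d f).
Proof.
move=> [hf_ hf fc].
have sh : cv2 F (fun i x => f_ i (x + d)) (fun x => f (x + d)).
  split; [by move=> i; exact: l2_sh|exact: l2_sh|].
  have -> : (fun i => n2 (fun x => f_ i (x + d) - f (x + d))) = (fun i => n2 (fun x => f_ i x - f x)) => //.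
  by apply/funext => i; exact: (n2_sh d (l2B (hf_ i) hf)).
have := @cv2Z _ _ F FF d^-1 _ _ (@cv2B _ _ F FF _ _ _ _ sh (And3 hf_ hf fc)).
rewrite -dqE; congr (cv2 _ _ _); apply/funext => i; exact/esym/dqE.
Qed.

Lemma n2_dq_rough d f : l2 f -> n2 (dq d f) <= 2 * `|d^-1| * n2 f.
Proof.
move=> hf; rewrite dqE n2Z; last by apply: l2B => //; exact: l2_sh.
rewrite [2 * _]mulrC -mulrA ler_wpM2l//.
apply: (le_trans (n2B (l2_sh d hf) hf)); rewrite n2_sh//; lra.
Qed.

(** At fixed $d$ the operator $D_d$ is bounded on $L^2$ with adjoint $-D_{-d}$, so it can be moved
    onto the test function, which stays in $H^1$. *)
Lemma evol_dq d r rx A B : evol r rx A B ->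
  evol (fun t => dq d (r t)) (fun t => dq d (rx t)) (fun t => dq d (A t)) (fun t => dq d (B t)).
Proof.
move=> ev; have [h1 h2 h3 h4] := ev; split.
- move=> t; have [hi h fc gc] := h1 t.
  by split; [move=> i; exact: ftc_dq|exact: ftc_dq|exact: cv2_dq_fixed..].
- by move=> t; exact: cv2_dq_fixed.
- by move=> t; exact: cv2_dq_fixed.
(* The norm of $D_{-d}$ on $L^2$ is at most $2/|d|$; the 1 keeps $K$ positive at $d = 0$, where
   [d^-1] is 0. *)
move=> t e e0; pose K := 2 * `|d^-1| + 1.
have K0 : 0 < K by rewrite /K; have := normr_ge0 d^-1; lra.
have [dl dl0 H] := h4 t (e / K) (divr_gt0 e0 K0); exists dl => // h hdl f g fg.
have [_ hr _ hA hB] := evol_l2 t ev; have [_ hr' _ _ _] := evol_l2 (t + h) ev.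
have [hf hg _] := fg; have fg' := sd_dq (- d) fg.
have := H h hdl _ _ fg'.
have -> : ip (fun x => dq d (r (t + h)) x - dq d (r t) x) f = - ip (fun x => r (t + h) x - r t x) (dq (- d) f).
  rewrite -ip_dq//; last exact: l2B.
  by congr ip; apply/funext => x; rewrite /dq -mulrBl; congr (_ / _); ring.
rewrite !ip_dq// => H'.
rewrite -normrN (_ : - (- _ - _) = ip (fun x => r (t + h) x - r t x) (dq (- d) f) -
    h * (ip (A t) (dq (- d) g) + ip (B t) (dq (- d) f))); last by ring.
apply: (le_trans H').
have n1 := n2_dq_rough (- d) hf; have n3 := n2_dq_rough (- d) hg.
rewrite invrN normrN in n1 n3.
have F0 := n2_ge0 f; have G0 := n2_ge0 g.
rewrite (_ : e * `|h| = e / K * `|h| * K); last by field; rewrite gt_eqF.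
rewrite -[leRHS]mulrA ler_wpM2l//; first by rewrite mulr_ge0// divr_ge0 ?ltW.
rewrite /K; nra.
Qed.

Lemma hasdP (F : R -> R) (t l : R) : (F (t + h) - F t) / h @[h --> (0 : R)^'] --> l -> hasd F t l.
Proof.
move=> H.
have E : (fun h : R => h^-1 *: ((F \o shift t) (h *: (1 : R)) - F t)) = (fun h => (F (t + h) - F t) / h).
  by apply/funext => h /=; rewrite /GRing.scale/= mulr1 mulrC (addrC h).
have cv : cvg (h^-1 *: ((F \o shift t) (h *: (1 : R)) - F t) @[h --> (0 : R)^']).
  by rewrite E; apply/cvg_ex; exists l.
split => //; rewrite /derive; apply/cvg_lim => //.
by rewrite E.
Qed.

(** The increment of $\langle r, \psi s\rangle$ is $\langle r(t+h) - r(t), \psi s(t+h)\rangle +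
    \langle s(t+h) - s(t), \psi r(t)\rangle$. Both increments are tested against functions that stay
    bounded in $H^1$, so the two equations apply with an $o(h)$ error. *)
Lemma hasd_ip r rx A B s sx A' B' psi psi' (t : R) :
  evol r rx A B -> evol s sx A' B' -> mult psi psi' ->
  hasd (fun t => ip (r t) (fun x => psi x * s t x)) t
    ((ip (A t) (fun x => psi' x * s t x + psi x * sx t x) + ip (B t) (fun x => psi x * s t x)) +
     (ip (A' t) (fun x => psi' x * r t x + psi x * rx t x) + ip (B' t) (fun x => psi x * r t x))).
Proof.
move=> er es mp; apply: hasdP.
have [r1 _ _ r4] := er; have [s1 _ _ s4] := es.
have [ftr hr hrx hA hB] := evol_l2 t er; have [fts hs hsx hA' hB'] := evol_l2 t es.
have [mpsi mpsi' [C HC] sdp _] := mp.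
pose X t := (fun x => psi x * s t x); pose Xx t := (fun x => psi' x * s t x + psi x * sx t x).
pose Y := (fun x => psi x * r t x); pose Yx := (fun x => psi' x * r t x + psi x * rx t x).
have sX u : sd (X u) (Xx u) by have [? _ _ _ _] := evol_l2 u es; exact: sdp.
have sY : sd Y Yx by exact: sdp.
have cth : t + h @[h --> (0 : R)^'] --> t.
  rewrite -[X in _ --> X](addr0 t); apply: cvgD; first exact: cvg_cst.
  exact: cvg_dnbhs_id.
have cX : cv2 (0 : R)^' (fun h => X (t + h)) (X t) /\ cv2 (0 : R)^' (fun h => Xx (t + h)) (Xx t).
  have [c1 _ c2] := @mult_cv2 _ _ _ _ _ _ _ _ _ _ mp (s1 t).
  by split; [exact: (cv2_comp cth c1)|exact: (cv2_comp cth c2)].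
have [cX1 cX2] := cX.
have lim : (ip (A t) (Xx (t + h)) + ip (B t) (X (t + h))) + (ip (A' t) Yx + ip (B' t) Y)
   @[h --> (0 : R)^'] --> (ip (A t) (Xx t) + ip (B t) (X t)) + (ip (A' t) Yx + ip (B' t) Y).
  apply: cvgD; last exact: cvg_cst.
  by apply: cvgD; (apply: cv2_ip; [exact: cv2_cst|by []]).
suff H : ((ip (r (t + h)) (X (t + h)) - ip (r t) (X t)) / h -
   ((ip (A t) (Xx (t + h)) + ip (B t) (X (t + h))) + (ip (A' t) Yx + ip (B' t) Y)))
     @[h --> (0 : R)^'] --> 0.
  exact: cvg_sub0 H lim.
(* A bound for the norms of both test functions and their derivatives once those of [X] at time
   [t + h] are within 1 of their values at [t]; the two slacks give the 2. *)
pose K := n2 (X t) + n2 (Xx t) + 2 + (n2 Y + n2 Yx).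
have [hX hXx] : l2 (X t) /\ l2 (Xx t) by have [? ? _] := sX t.
have K0 : 0 < K by rewrite /K; have := n2_ge0 (X t); have := n2_ge0 (Xx t); have := n2_ge0 Y; have := n2_ge0 Yx; lra.
apply/cvgrPdist_le => e e0.
have eK : 0 < e / K by rewrite divr_gt0.
have [d1 d10 H1] := r4 t _ eK; have [d2 d20 H2] := s4 t _ eK.
have [_ _ c1] := cX1; have [_ _ c2] := cX2.
have /cvgrPdist_lt/(_ 1 ltr01) c1' := c1; have /cvgrPdist_lt/(_ 1 ltr01) c2' := c2.
near=> h.
have h0 : h != 0 by near: h; exact: nbhs_dnbhs_neq.
have hd1 : `|h| < d1.
  by near: h; apply: nbhs_dnbhs; apply: (@cvgr0_norm_lt _ _ _ (nbhs (0 : R)) _ (fun h => h)).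
have hd2 : `|h| < d2.
  by near: h; apply: nbhs_dnbhs; apply: (@cvgr0_norm_lt _ _ _ (nbhs (0 : R)) _ (fun h => h)).
have hn : 0 < `|h| by rewrite normr_gt0.
have k1 : `|0 - n2 (fun x => X (t + h) x - X t x)| < 1 by near: h.
have k2 : `|0 - n2 (fun x => Xx (t + h) x - Xx t x)| < 1 by near: h.
rewrite sub0r normrN ger0_norm ?n2_ge0// in k1.
rewrite sub0r normrN ger0_norm ?n2_ge0// in k2.
have [hXh hXxh _] := sX (t + h).
have [ftrh hrh _ _ _] := evol_l2 (t + h) er; have [ftsh hsh _ _ _] := evol_l2 (t + h) es.
have n1 : n2 (X (t + h)) <= n2 (X t) + 1.
  by apply: (le_trans (n2_sub_le hXh hX)); rewrite lerD2l ltW.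
have n3 : n2 (Xx (t + h)) <= n2 (Xx t) + 1.
  by apply: (le_trans (n2_sub_le hXxh hXx)); rewrite lerD2l ltW.
have G1 := H1 h hd1 _ _ (sX (t + h)); have G2 := H2 h hd2 _ _ sY.
have E : ip (r (t + h)) (X (t + h)) - ip (r t) (X t) =
   ip (fun x => r (t + h) x - r t x) (X (t + h)) + ip (fun x => s (t + h) x - s t x) Y.
  rewrite !ipBl//; last by have [] := sY.
  have -> : ip (s (t + h)) Y = ip (r t) (X (t + h)) by congr intg; apply/funext => x; rewrite /X /Y; ring.
  have -> : ip (s t) Y = ip (r t) (X t) by congr intg; apply/funext => x; rewrite /X /Y; ring.
  by ring.
rewrite sub0r normrN E.
move: G1 G2.
set a1 := ip _ (X (t + h)); set a2 := ip (fun x => s (t + h) x - s t x) _.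
set b1 := ip (A t) _ + _; set b2 := ip (A' t) _ + _ => G1 G2.
have -> : (a1 + a2) / h - (b1 + b2) = ((a1 - h * b1) + (a2 - h * b2)) / h by field.
rewrite normrM normfV ler_pdivrMr//.
apply: (le_trans (ler_normD _ _)); apply: (le_trans (lerD G1 G2)).
have -> : e * `|h| = e / K * `|h| * K by field; rewrite gt_eqF.
rewrite -mulrDr ler_wpM2l//; first by rewrite mulr_ge0// ltW.
rewrite /K; lra.
Unshelve. all: by end_near. Qed.
End Evolution.

(** * Differentiation through a regularisation *)

Section Regularisation.
Context {R : realType}.

Lemma mvt (F f : R -> R) (s t : R) : (forall x, hasd F x (f x)) ->
  exists2 c, `|c - s| <= `|t - s| & F t - F s = f c * (t - s).
Proof.
move=> H; have ct a b : {within `[a, b], continuous F}.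
  by apply: continuous_subspaceT => x; exact: hasd_continuous (H x).
have [st|ts|<-] := ltgtP s t; last by exists s; rewrite !subrr ?mulr0.
  have [c /[!in_itv]/= /andP[sc ct'] E] := MVT st (fun x _ => H x) (ct s t).
  by exists c => //; rewrite !ger0_norm; lra.
have [c /[!in_itv]/= /andP[sc ct'] E] := MVT ts (fun x _ => H x) (ct t s).
exists c; first by rewrite !ler0_norm; lra.
by rewrite -opprB E; ring.
Qed.

(* Mean value theorem on [G d], then [d] tends to 0. *)
Lemma hasd_limit (G g : R -> R -> R) (F : R -> R) (X t0 : R) :
  (forall d t, d != 0 -> hasd (G d) t (g d t)) ->
  (forall t, G d t @[d --> (0 : R)^'] --> F t) ->
  g z.1 z.2 @[z --> filter_prod (0 : R)^' (nbhs t0)] --> X -> hasd F t0 X.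
Proof.
move=> HG GF gX; apply: hasdP; apply/cvgrPdist_le => e e0.
have /cvgrPdist_le/(_ e e0) [[A B] /= [nA nB] AB] := gX.
have /nbhs_ballP[dl /= dl0 Bd] := nB.
near=> h.
have h0 : h != 0 by near: h; exact: nbhs_dnbhs_neq.
have hd : `|h| < dl.
  by near: h; apply: nbhs_dnbhs; apply: (@cvgr0_norm_lt _ _ _ (nbhs (0 : R)) _ (fun h => h)).
have hn : 0 < `|h| by rewrite normr_gt0.
have Z : `|X - (G d (t0 + h) - G d t0) / h| @[d --> (0 : R)^'] --> `|X - (F (t0 + h) - F t0) / h|.
  apply: cvg_norm; apply: cvgB; first exact: cvg_cst.
  by apply: cvgM; [apply: cvgB; exact: GF|exact: cvg_cst].
(* The estimate is proved for the regularised quotient at small $d$; being a closed condition, it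
   survives the limit at fixed $h$. *)
apply: (@closed_cvg _ _ (0 : R)^' _ _ (fun y : R => y <= e) _ _ _ Z); first exact: closed_le.
near=> d.
have d0 : d != 0 by near: d; exact: nbhs_dnbhs_neq.
have Ad : A d by near: d.
have [c cs ->] := mvt t0 (t0 + h) (fun x => HG d x d0).
rewrite addrAC subrr add0r mulfK//.
apply: (AB (d, c)); split => //=; apply: Bd.
rewrite /ball/= distrC (le_lt_trans cs)// addrAC subrr add0r//.
Unshelve. all: by end_near. Qed.
End Regularisation.

(** * The potential as a multiplier of H^1 *)

Section PotentialMultiplier.
Context {R : realType} (a : R) (a0 : 0 < a) (a1 : a < 1).
Implicit Types f g h p px q qx : R -> R.

Definition msq p q : R -> R := fun x => p x ^+ 2 + q x ^+ 2.
Definition dmsq p px q qx : R -> R := fun x => 2 * (p x * px x) + 2 * (q x * qx x).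

Lemma dqM' d f g x : dq d (fun x => f x * g x) x = f x * dq d g x + dq d f x * g (x + d).
Proof.
have -> : (fun x => f x * g x) = (fun x => g x * f x) by apply/funext => y; rewrite mulrC.
by rewrite dqM addrC mulrC [X in _ + X]mulrC.
Qed.

Lemma rpotZ (c C : R) f x : L1 f -> (forall y, `|f y| <= C) ->
  rpot a (fun y => c * f y) x = c * rpot a f x.
Proof.
move=> f1 fC; rewrite (rpotE a0 a1 x f1 fC).
have cC y : `|c * f y| <= `|c| * C by rewrite normrM ler_wpM2l.
rewrite (rpotE a0 a1 x (L1Z c f1) cC) -intgZ; last exact: (L1_rieszM a0 a1 x f1 fC).
suff -> : (fun y => riesz a (x - y) * (c * f y)) = (fun y => c * (riesz a (x - y) * f y)) by [].
by apply/funext => y; rewrite mulrCA.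
Qed.

(** Convolution is linear and commutes with translations, so the quotient falls on the density and
    the singular kernel is left untouched. *)
Lemma dq_rpot (d C : R) f x : L1 f -> (forall y, `|f y| <= C) ->
  dq d (rpot a f) x = rpot a (dq d f) x.
Proof.
move=> f1 fC; have fC' y : `|f (y + d)| <= C by [].
have C0 := le_trans (normr_ge0 _) (fC 0).
have hB : L1 (fun y => f (y + d) - f y) by apply: L1B => //; exact: L1_sh.
rewrite [in RHS]dqE (@rpotZ d^-1 (C + C)) //; last by move=> y; rewrite (le_trans (ler_normB _ _))// lerD.
by rewrite (rpotB_bounded a0 a1 x (L1_sh d f1) f1 fC' fC) rpot_sh; [rewrite /dq mulrC|exact: L1_mfun].
Qed.

(** The near part of the potential of $v$ is only in $L^2$; the sup bound on $f$ from $H^1$ makes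
    the product square integrable. *)
Lemma rpotM_bound v f g : L1 v -> l2 v -> ftc f g ->
  l2 (fun x => rpot a v x * f x) /\
  n2 (fun x => rpot a v x * f x) <= (kap a * n2 v + intg (fun y => `|v y|)) * (n2 f + n2 g).
Proof.
move=> v1 v2 fg; have [hf hg _] := fg.
have mv := L1_mfun v1.
have E : (fun x => rpot a v x * f x) = (fun x => f x * cnear a v x + cfar a v x * f x).
  by apply/funext => x; rewrite /rpot mulrDl mulrC.
have fS x := ftc_sup x fg.
have A1 := l2Mb (l2_mfun hf) fS (l2_cnear a0 a1 v2).
have cB x : `|cfar a v x| <= intg (fun y => `|v y|) by exact: cfar_bound.
have A2 := l2Mb (mfun_cfar a mv) cB hf.
rewrite E; split; first exact: l2D.
apply: (le_trans (n2D A1 A2)); rewrite mulrDl; apply: lerD.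
  apply: (le_trans (n2Mb (l2_mfun hf) fS (l2_cnear a0 a1 v2))).
  rewrite mulrC ler_wpM2r ?addr_ge0 ?n2_ge0//; exact: young.
apply: (le_trans (n2Mb (mfun_cfar a mv) cB hf)).
by rewrite ler_wpM2l ?lerDl ?n2_ge0// intg_ge0.
Qed.

Section PotentialNets.
Context {I : Type} (F : set_system I) {FF : Filter F}.

Lemma msq_nets (p_ px_ q_ qx_ : I -> R -> R) p px q qx :
  cvH F p_ px_ p px -> cvH F q_ qx_ q qx ->
  [/\ cv1 F (fun i => msq (p_ i) (q_ i)) (msq p q),
      cvU F (fun i => msq (p_ i) (q_ i)) (msq p q),
      cv1 F (fun i => dmsq (p_ i) (px_ i) (q_ i) (qx_ i)) (dmsq p px q qx) &
      cv2 F (fun i => dmsq (p_ i) (px_ i) (q_ i) (qx_ i)) (dmsq p px q qx)].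
Proof.
move=> hp hq; have [_ _ p2 px2] := hp; have [_ _ q2 qx2] := hq.
have pU : cvU F p_ p by exact: cvH_cvU hp.
have qU : cvU F q_ q by exact: cvH_cvU hq.
have E (f1 f2 : R -> R) : msq f1 f2 = (fun x => f1 x * f1 x + f2 x * f2 x).
  by apply/funext => x; rewrite /msq !expr2.
have Ei : (fun i => msq (p_ i) (q_ i)) = (fun i x => p_ i x * p_ i x + q_ i x * q_ i x).
  by apply/funext => i; exact: E.
have D (f1 g1 f2 g2 : R -> R) : dmsq f1 g1 f2 g2 = (fun x => (f1 x * g1 x + f1 x * g1 x) + (f2 x * g2 x + f2 x * g2 x)).
  by apply/funext => x; rewrite /dmsq; ring.
have Di : (fun i => dmsq (p_ i) (px_ i) (q_ i) (qx_ i)) =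
   (fun i x => (p_ i x * px_ i x + p_ i x * px_ i x) + (q_ i x * qx_ i x + q_ i x * qx_ i x)).
  by apply/funext => i; exact: D.
rewrite Ei Di E D; split.
- by apply: cv1D; exact: cv2_mul.
- by apply: cvUD; exact: cvUM.
- by apply: cv1D; apply: cv1D; exact: cv2_mul.
- by apply: cv2D; apply: cv2D; exact: cvU_cv2.
Qed.

Lemma msq_dq_nets (d : I -> R) (p_ px_ q_ qx_ : I -> R -> R) p px q qx :
  d i @[i --> F] --> (0 : R)^' -> cvH F p_ px_ p px -> cvH F q_ qx_ q qx ->
  cv1 F (fun i => dq (d i) (msq (p_ i) (q_ i))) (dmsq p px q qx) /\
  cv2 F (fun i => dq (d i) (msq (p_ i) (q_ i))) (dmsq p px q qx).
Proof.
move=> dc hp hq; have [p1 p2] := @cvH_dq_sq _ _ F FF _ _ _ _ _ dc hp.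
have [q1 q2] := @cvH_dq_sq _ _ F FF _ _ _ _ _ dc hq.
have -> : (fun i => dq (d i) (msq (p_ i) (q_ i))) =
  (fun i x => dq (d i) (fun x => p_ i x ^+ 2) x + dq (d i) (fun x => q_ i x ^+ 2) x).
  apply/funext => i; apply/funext => x; rewrite /dq /msq -mulrDl; congr (_ / _); ring.
by split; [exact: cv1D|exact: cv2D].
Qed.
End PotentialNets.

Lemma msq_L1 p px q qx : ftc p px -> ftc q qx -> L1 (msq p q) /\
  exists C : R, forall x, 0 <= msq p q x <= C.
Proof.
move=> hp hq; have [p2 _ _] := hp; have [q2 _ _] := hq; split.
  by apply: L1D; exact: l2_sq.
exists ((n2 p + n2 px) ^+ 2 + (n2 q + n2 qx) ^+ 2) => x.
rewrite /msq addr_ge0 ?sqr_ge0//=.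
rewrite -(real_normK (num_real (p x))) -(real_normK (num_real (q x))).
by apply: lerD; rewrite ler_pXn2r ?nnegrE ?addr_ge0 ?n2_ge0//; exact: ftc_sup.
Qed.

Lemma dq_rpot_msq (d : R) p px q qx : ftc p px -> ftc q qx ->
  dq d (rpot a (msq p q)) = rpot a (dq d (msq p q)).
Proof.
move=> hp hq; have [m1 [C mC]] := msq_L1 hp hq; apply/funext => x.
apply: (@dq_rpot d C) => // y.
by have /andP[h1 h2] := mC y; rewrite ger0_norm.
Qed.

Section PotentialProducts.
Context {I : Type} (F : set_system I) {FF : Filter F}.

(** Steps and functions vary together, as the double limits in the energy and virial identities
    require; the shifted factor is the one in the discrete product rule [dqM']. *)
Lemma cv2_dq_rpotM (d : I -> R) (p_ px_ q_ qx_ f_ g_ : I -> R -> R) p px q qx f g :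
  d i @[i --> F] --> (0 : R)^' -> cvH F p_ px_ p px -> cvH F q_ qx_ q qx -> cvH F f_ g_ f g ->
  cv2 F (fun i x => dq (d i) (rpot a (msq (p_ i) (q_ i))) x * f_ i (x + d i))
    (fun x => rpot a (dmsq p px q qx) x * f x).
Proof.
move=> dc hp hq hf; have [m1 m2] := msq_dq_nets dc hp hq.
have dc0 := cvg_dnbhs0 dc.
have := @cv2_rpotM _ _ a0 a1 _ F FF _ _ _ _ m1 m2 (@cvH_cvU_sh _ _ F FF _ _ _ _ _ dc0 hf)
  (@cvH_cv2_sh _ _ F FF _ _ _ _ _ dc0 hf).
have [hpi _ _ _] := hp; have [hqi _ _ _] := hq.
set A := (X in cv2 F X _ -> _); set B := (X in _ -> cv2 F X _).
suff -> : A = B by [].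
by apply/funext => i; rewrite /A /B (dq_rpot_msq _ (hpi i) (hqi i)).
Qed.
End PotentialProducts.

(** The product rule is [cv2_dq_rpotM] for constant nets, and the bound on the derivative part is
    [rpotM_bound] with $v = m_x$. *)
Lemma mult_rpot p px q qx : ftc p px -> ftc q qx ->
  mult (rpot a (msq p q)) (rpot a (dmsq p px q qx)).
Proof.
move=> hp hq; have [m1 [C mC]] := msq_L1 hp hq.
have [p2 px2 _] := hp; have [q2 qx2 _] := hq.
have mC' y : `|msq p q y| <= C by have /andP[h1 h2] := mC y; rewrite ger0_norm.
have [_ _ c1 c2] := msq_nets (@cvH_cst _ _ (0 : R)^' _ _ _ hp) (@cvH_cst _ _ (0 : R)^' _ _ _ hq).
have [_ d1 _] := c1; have [_ d2 _] := c2.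
have mV := mfun_rpot a (L1_mfun m1).
have bV x := rpot_bound a0 a1 x m1 mC'.
split; [exact: mV|exact: mfun_rpot (L1_mfun d1)|by exists (kap a * C + intg (fun y => `|msq p q y|))| |]; last first.
  exists (kap a * n2 (dmsq p px q qx) + intg (fun y => `|dmsq p px q qx y|)) => f g fg.
  exact: rpotM_bound.
move=> f g fg; have [hf hg _] := fg; apply/sdP.
have hVf := l2Mb mV bV hf; have hVg := l2Mb mV bV hg; have [hDf _] := rpotM_bound d1 d2 fg.
split; [exact: hVf|exact: l2D|].
have -> : (fun d => dq d (fun x => rpot a (msq p q) x * f x)) =
  (fun d x => dq d (rpot a (msq p q)) x * f (x + d) + rpot a (msq p q) x * dq d f x).
  by apply/funext => d; apply/funext => x; rewrite dqM' addrC.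
apply: cv2D; last first.
  by apply: cvU_cv2; [exact: cvU_cst mV bV|have /sdP[] := ftc_sd fg].
by apply: (@cv2_dq_rpotM _ (0 : R)^' _ (fun d => d) (fun=> p) (fun=> px) (fun=> q) (fun=> qx) (fun=> f) (fun=> g)) => //;
  exact: cvH_cst.
Qed.
End PotentialMultiplier.

Lemma dnbhs0N {R : realType} : - h @[h --> (0 : R)^'] --> (0 : R)^'.
Proof.
move=> A /nbhs_ballP[e /= e0 H]; apply/nbhs_ballP; exists e => //= x xe x0.
apply: H => //=; last by rewrite oppr_eq0.
by move: xe; rewrite /ball/= !sub0r opprK normrN.
Qed.

Section Products.
Context {R : realType}.
Implicit Types f g v w : R -> R.

Lemma ip_swap v f w g : ip (fun x => v x * f x) (fun x => w x * g x) =
  ip (fun x => v x * g x) (fun x => w x * f x).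
Proof. by congr intg; apply/funext => x; ring. Qed.

Lemma ipMC f w g : ip f (fun x => w x * g x) = ip g (fun x => w x * f x).
Proof. by congr intg; apply/funext => x; ring. Qed.

Lemma mfun_dq (d : R) f : mfun f -> mfun (dq d f).
Proof.
by move=> mf; apply: mfunM; [apply: mfunB; [exact: mfun_sh|exact: mf]|exact: mfun_cst].
Qed.

Lemma dqN_fun (d : R) f : dq d (fun x => - f x) = (fun x => - dq d f x).
Proof. by apply/funext => x; rewrite /dq -mulNr; congr (_ / _); ring. Qed.
End Products.

(** * Energy and virial identities *)

Section System.
Context {R : realType} (a : R) (a0 : 0 < a) (a1 : a < 1).
Local Notation V p q t := (rpot a (msq (p t) (q t))).
Local Notation V' p px q qx t := (rpot a (dmsq (p t) (px t) (q t) (qx t))).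

(* i u_t + u_xx = V u for u = p + i q. *)
Definition hsys (p px q qx : R -> R -> R) :=
  evol p px qx (fun t x => V p q t x * q t x) /\
  evol q qx (fun t x => - px t x) (fun t x => - (V p q t x * p t x)).

Context (p px q qx : R -> R -> R) (hs : hsys p px q qx).
Local Notation Vt t := (V p q t).
Local Notation Vxt t := (V' p px q qx t).

Lemma hsys_ftc t : ftc (p t) (px t) /\ ftc (q t) (qx t).
Proof. by have [e1 e2] := hs; have [] := evol_l2 t e1; have [] := evol_l2 t e2. Qed.

Lemma hsys_l2 t : [/\ l2 (p t), l2 (px t), l2 (q t) & l2 (qx t)].
Proof. by have [[? ? _] [? ? _]] := hsys_ftc t. Qed.

Lemma hsys_cvH t : cvH (nbhs t) p px (p t) (px t) /\ cvH (nbhs t) q qx (q t) (qx t).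
Proof. by have [[h1 _ _ _] [h2 _ _ _]] := hs. Qed.

Lemma hsys_V t : mult (Vt t) (Vxt t).
Proof. by have [h1 h2] := hsys_ftc t; exact: mult_rpot. Qed.

Lemma multM_l2 (psi psi' f g : R -> R) : mult psi psi' -> ftc f g ->
  l2 (fun x => psi' x * f x) /\ forall h, l2 h -> l2 (fun x => psi x * h x).
Proof.
move=> [mp mp' [C HC] _ [D HD]] fg; split; first exact: (HD _ _ fg).1.
by move=> h hh; exact: l2Mb HC hh.
Qed.

(** The local law of mass: the terms with $V$ cancel because $V$ is real, and so do those with $\psi
    p_x q_x$; only the current against $\psi'$ is left. *)
Lemma hasd_density (psi psi' : R -> R) t : mult psi psi' ->
  hasd (fun t => ip (p t) (fun x => psi x * p t x) + ip (q t) (fun x => psi x * q t x)) t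
    (2 * (ip (qx t) (fun x => psi' x * p t x) - ip (px t) (fun x => psi' x * q t x))).
Proof.
move=> mp; have [ep eq] := hs; have [fp fq] := hsys_ftc t.
have [p2 px2 q2 qx2] := hsys_l2 t.
apply: hasd_eq; first exact: hasdD (hasd_ip t ep ep mp) (hasd_ip t eq eq mp).
have [lp l] := multM_l2 mp fp; have [lq _] := multM_l2 mp fq.
have [_ lV] := multM_l2 (hsys_V t) fp.
have n1 := lV _ p2; have n3 := lV _ q2.
have k1 := l _ p2; have k2 := l _ q2; have k3 := l _ px2; have k4 := l _ qx2.
rewrite !ipDr// ?ipNl//; try exact: l2N; try exact: l2D.
rewrite (ipMC (px t) psi) (ip_swap (Vt t) (p t)).
ring.
Qed.

Lemma dqV_product d (f : R -> R) t : dq d (fun x => Vt t x * f x) =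
  (fun x => Vt t x * dq d f x + dq d (Vt t) x * f (x + d)).
Proof. by apply/funext => x; rewrite dqM'. Qed.

Lemma l2_dqVM d f t : l2 f -> l2 (fun x => dq d (Vt t) x * f x).
Proof.
have [mV _ [C HC] _ _] := hsys_V t => hf.
have md := mfun_dq d mV.
apply: (l2Mb (C := (C + C) * `|d^-1|) md _ hf) => x.
by rewrite /dq normrM ler_wpM2r// (le_trans (ler_normB _ _))// lerD.
Qed.

(** The step tends to 0 jointly with the time tending to $t$, as [hasd_limit] demands. *)
Let zF (t : R) : set_system (R * R) := filter_prod (0 : R)^' (nbhs t).
Let zd t : z.1 @[z --> zF t] --> (0 : R)^'. Proof. exact: cvg_fst. Qed.
Let zt t : z.2 @[z --> zF t] --> nbhs t. Proof. exact: cvg_snd. Qed.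

Let zH t : cvH (zF t) (fun z => p z.2) (fun z => px z.2) (p t) (px t) /\
  cvH (zF t) (fun z => q z.2) (fun z => qx z.2) (q t) (qx t).
Proof. by have [h1 h2] := hsys_cvH t; split; exact: (cvH_comp (@zt t)). Qed.

(* [px t] is not in H^1, so the identity is obtained as a limit from [dq d (p t)]. *)
Lemma hasd_kinetic t :
  hasd (fun t => ip (px t) (px t) + ip (qx t) (qx t)) t
    (2 * (ip (fun x => Vxt t x * q t x) (px t) - ip (fun x => Vxt t x * p t x) (qx t))).
Proof.
pose G d t := ip (dq d (p t)) (fun x => 1 * dq d (p t) x) + ip (dq d (q t)) (fun x => 1 * dq d (q t) x).
pose g d t := 2 * (ip (fun x => dq d (Vt t) x * q t (x + d)) (dq d (p t)) -
   ip (fun x => dq d (Vt t) x * p t (x + d)) (dq d (q t))).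
apply: (@hasd_limit _ G g).
- move=> d {}t d0; have [ep eq] := hs; have [fp fq] := hsys_ftc t.
  have [p2 px2 q2 qx2] := hsys_l2 t.
  have mp := mult_cst (1 : R).
  have ed := evol_dq d ep; have eqd := evol_dq d eq.
  apply: hasd_eq; first exact: hasdD (hasd_ip t ed ed mp) (hasd_ip t eqd eqd mp).
  have S (f h : R -> R) : (fun x => 0 * f x + 1 * h x) = h by apply/funext => x; rewrite mul0r add0r mul1r.
  have S1 (h : R -> R) : (fun x => 1 * h x) = h by apply/funext => x; rewrite mul1r.
  rewrite !S !S1 !dqN_fun !dqV_product /g.
  have P2 := l2_dq d p2; have Q2 := l2_dq d q2; have Px2 := l2_dq d px2; have Qx2 := l2_dq d qx2.
  have [_ lV] := multM_l2 (hsys_V t) fp.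
  have VP := lV _ P2; have VQ := lV _ Q2.
  have WP := l2_dqVM d t (l2_sh d p2); have WQ := l2_dqVM d t (l2_sh d q2).
  rewrite !ipNl//; last exact: l2D.
  rewrite !ipDl// (ipC (dq d (px t))).
  (* The part of $D_d(Vu)$ in which $V$ is not differenced cancels between the two components. *)
  have -> : ip (fun x => Vt t x * dq d (p t) x) (dq d (q t)) = ip (fun x => Vt t x * dq d (q t) x) (dq d (p t)).
    by congr intg; apply/funext => x; rewrite mulrAC.
  ring.
- move=> {}t; have [fp fq] := hsys_ftc t.
  have S1 (h : R -> R) : (fun x => 1 * h x) = h by apply/funext => x; rewrite mul1r.
  rewrite /G; under eq_fun do rewrite !S1.
  have /sdP[_ _ cp] := ftc_sd fp; have /sdP[_ _ cq] := ftc_sd fq.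
  by apply: cvgD; exact: cv2_ip.
have [hp hq] := zH t.
have FF : Filter (zF t) by exact: filter_prod_filter.
have cP := @cvH_cv2_dq _ _ _ FF _ _ _ _ _ (@zd t) hp.
have cQ := @cvH_cv2_dq _ _ _ FF _ _ _ _ _ (@zd t) hq.
have cWp := @cv2_dq_rpotM _ _ a0 a1 _ _ FF _ _ _ _ _ _ _ _ _ _ _ _ _ (@zd t) hp hq hp.
have cWq := @cv2_dq_rpotM _ _ a0 a1 _ _ FF _ _ _ _ _ _ _ _ _ _ _ _ _ (@zd t) hp hq hq.
have e1 := @cv2_ip _ _ _ FF _ _ _ _ cWq cP; have e2 := @cv2_ip _ _ _ FF _ _ _ _ cWp cQ.
by apply: cvgM; [exact: cvg_cst|exact: cvgB e1 e2].
Qed.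

(** The case $d = 0$ of [riesz_sym], at two different times. *)
Lemma V_symm (s t : R) :
  ip (Vt s) (msq (p t) (q t)) = ip (Vt t) (msq (p s) (q s)).
Proof.
have [fp fq] := hsys_ftc t; have [fp' fq'] := hsys_ftc s.
have [m1 [C mC]] := msq_L1 fp fq; have [m1' [C' mC']] := msq_L1 fp' fq'.
have b1 x : `|msq (p t) (q t) x| <= Num.max C C'.
  by have /andP[h1 h2] := mC x; rewrite ger0_norm// le_max h2.
have b2 x : `|msq (p s) (q s) x| <= Num.max C C'.
  by have /andP[h1 h2] := mC' x; rewrite ger0_norm// le_max h2 orbT.
have := riesz_sym a0 a1 0 m1' m1 b2 b1.
have E f h : (fun x => h x * rpot a f (x + 0)) = (fun x => rpot a f x * h x).
  by apply/funext => x; rewrite addr0 mulrC.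
have E' f h : (fun x => h x * rpot a f (x - 0)) = (fun x => rpot a f x * h x).
  by apply/funext => x; rewrite subr0 mulrC.
by rewrite E E'.
Qed.

Lemma density_ip (psi psi' : R -> R) t : mult psi psi' ->
  ip (p t) (fun x => psi x * p t x) + ip (q t) (fun x => psi x * q t x) = ip psi (msq (p t) (q t)).
Proof.
move=> mp; have [fp fq] := hsys_ftc t; have [p2 px2 q2 qx2] := hsys_l2 t.
have [_ l] := multM_l2 mp fp.
rewrite /ip -intgD; [|exact: l2M p2 (l _ p2)|exact: l2M q2 (l _ q2)].
by congr intg; apply/funext => x; rewrite /msq; ring.
Qed.

(* By symmetry of the kernel, the increment of [int V m] on [[t, t + h]] is that of
   [s |-> int (V (t + h) + V t) m s], where the multiplier is frozen. *)
Lemma hasd_potential t : hasd (fun t => ip (Vt t) (msq (p t) (q t))) t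
  (2 * (ip (qx t) (fun x => Vxt t x * p t x + Vxt t x * p t x) -
        ip (px t) (fun x => Vxt t x * q t x + Vxt t x * q t x))).
Proof.
pose g (h c : R) := 2 * (ip (qx c) (fun x => (Vxt (t + h) x + Vxt t x) * p c x) -
   ip (px c) (fun x => (Vxt (t + h) x + Vxt t x) * q c x)).
have FF : Filter (zF t) by exact: filter_prod_filter.
have gX : g z.1 z.2 @[z --> zF t] --> 2 * (ip (qx t) (fun x => Vxt t x * p t x + Vxt t x * p t x) -
        ip (px t) (fun x => Vxt t x * q t x + Vxt t x * q t x)).
  have cth : t + z.1 @[z --> zF t] --> t.
    rewrite -[X in _ --> X](addr0 t); apply: cvgD; first exact: cvg_cst.
    exact: cvg_dnbhs0 (@zd t).
  have [hp hq] := hsys_cvH t; have [zp zq] := zH t.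
  have hp1 := cvH_comp cth hp; have hq1 := cvH_comp cth hq.
  have [fp fq] := hsys_ftc t.
  have [_ _ c1 c2] := @msq_nets _ _ _ FF _ _ _ _ _ _ _ _ hp1 hq1.
  have [_ _ d1 d2] := @msq_nets _ _ _ FF _ _ _ _ _ _ _ _ (@cvH_cst _ _ (zF t) _ _ _ fp) (@cvH_cst _ _ (zF t) _ _ _ fq).
  have T f_ g_ f h : cvH (zF t) f_ g_ f h -> cv2 (zF t)
     (fun z x => (Vxt (t + z.1) x + Vxt t x) * f_ z x) (fun x => Vxt t x * f x + Vxt t x * f x).
    move=> hf; have [_ _ f2 _] := hf.
    have -> : (fun z x => (Vxt (t + z.1) x + Vxt t x) * f_ z x) =
       (fun z x => Vxt (t + z.1) x * f_ z x + Vxt t x * f_ z x).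
      by apply/funext => z; apply/funext => x; rewrite mulrDl.
    by apply: cv2D; (apply: (cv2_rpotM a0 a1) => //; exact: cvH_cvU hf).
  have [_ _ p2 px2] := zp; have [_ _ q2 qx2] := zq.
  have e1 := @cv2_ip _ _ _ FF _ _ _ _ qx2 (T _ _ _ _ zp).
  have e2 := @cv2_ip _ _ _ FF _ _ _ _ px2 (T _ _ _ _ zq).
  by apply: cvgM; [exact: cvg_cst|exact: cvgB e1 e2].
apply: hasdP; apply/cvgrPdist_le => e e0.
have /cvgrPdist_le/(_ e e0) [[A B] /= [nA nB] AB] := gX.
have /nbhs_ballP[dl /= dl0 Bd] := nB.
near=> h.
have h0 : h != 0 by near: h; exact: nbhs_dnbhs_neq.
have hd : `|h| < dl.
  by near: h; apply: nbhs_dnbhs; apply: (@cvgr0_norm_lt _ _ _ (nbhs (0 : R)) _ (fun h => h)).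
have Ah : A h by near: h.
have mW := multD (hsys_V (t + h)) (hsys_V t).
have [c cs E] := mvt t (t + h) (fun s => hasd_density s mW).
have -> : ip (Vt (t + h)) (msq (p (t + h)) (q (t + h))) - ip (Vt t) (msq (p t) (q t)) =
    g h c * (t + h - t).
  rewrite /g -E !(density_ip _ mW).
  have [fp fq] := hsys_ftc t; have [fp' fq'] := hsys_ftc (t + h).
  have L s u : L1 (fun x => Vt s x * msq (p u) (q u) x).
    have [fp1 fq1] := hsys_ftc u; have [m1 _] := msq_L1 fp1 fq1.
    have [mV _ [C HC] _ _] := hsys_V s.
    apply: (L1_le _ _ (L1Z C (L1_abs m1))); first by apply: mfunM => //; exact: L1_mfun.
    by move=> x; rewrite normrM ler_wpM2r.
  have D u : ip (fun x => Vt (t + h) x + Vt t x) (msq (p u) (q u)) =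
     ip (Vt (t + h)) (msq (p u) (q u)) + ip (Vt t) (msq (p u) (q u)).
    rewrite /ip -intgD; [|exact: L..].
    by congr intg; apply/funext => x; rewrite mulrDl.
  (* The mixed terms, potential at one time against density at the other, agree by symmetry and
     cancel. *)
  by rewrite !D (V_symm (t + h) t) opprD addrA addrK.
rewrite addrAC subrr add0r mulfK//.
apply: (AB (h, c)); split => //=; apply: Bd.
rewrite /ball/= distrC (le_lt_trans cs)// addrAC subrr add0r//.
Unshelve. all: by end_near. Qed.

Definition energy t := ip (px t) (px t) + ip (qx t) (qx t) + 2^-1 * ip (Vt t) (msq (p t) (q t)).

(** The potential term has weight one half since its derivative counts the interaction twice: once
    through each copy of the density. *)
Lemma energy_cst s t : energy s = energy t.
Proof.
have H x : hasd energy x 0.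
  have [fp fq] := hsys_ftc x; have [p2 px2 q2 qx2] := hsys_l2 x.
  have [lp l] := multM_l2 (hsys_V x) fp; have [lq _] := multM_l2 (hsys_V x) fq.
  apply: hasd_eq.
    apply: hasdD (hasd_kinetic x) _; apply: hasdM (hasd_cst _ x) (hasd_potential x).
  cbv beta; rewrite (ipDr lp lp qx2) (ipDr lq lq px2) (ipC (qx x)) (ipC (px x)).
  by field.
by have [c _ E] := mvt s t H; apply/eqP; rewrite eq_sym -subr_eq0 E mul0r.
Qed.

Section Virial.
Context (phi phi' phi'' : R -> R) (mp : mult phi phi') (mp' : mult phi' phi'').

(** Minus the imaginary part of $\int\phi\,\bar u\,u_x$, the sign for which it is nonincreasing with
    the weight chosen later. *)
Definition virial t := ip (q t) (fun x => phi x * px t x) - ip (p t) (fun x => phi x * qx t x).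

(** With $u_x$ replaced by $D_d u$, the terms with $\phi p_x D_d p_x$ cancel, as do those with $V
    D_d u$. In the surviving $\langle D_d p_x, \phi' p\rangle$ the quotient is moved onto $\phi' p$,
    which is where $\phi''$ arises. *)
Lemma hasd_virial t : hasd virial t
  ((ip (px t) (fun x => - (phi'' x * p t x + phi' x * px t x)) - ip (px t) (fun x => phi' x * px t x)) +
   (ip (qx t) (fun x => - (phi'' x * q t x + phi' x * qx t x)) - ip (qx t) (fun x => phi' x * qx t x)) +
   (ip (fun x => Vxt t x * p t x) (fun x => phi x * p t x) +
    ip (fun x => Vxt t x * q t x) (fun x => phi x * q t x))).
Proof.
pose G d t := ip (q t) (fun x => phi x * dq d (p t) x) - ip (p t) (fun x => phi x * dq d (q t) x).
pose g d t := 
  (ip (px t) (fun x => - dq (- d) (fun x => phi' x * p t x) x) - ip (px t) (fun x => phi' x * dq d (p t) x)) +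
  (ip (qx t) (fun x => - dq (- d) (fun x => phi' x * q t x) x) - ip (qx t) (fun x => phi' x * dq d (q t) x)) +
  (ip (fun x => dq d (Vt t) x * p t (x + d)) (fun x => phi x * p t x) +
   ip (fun x => dq d (Vt t) x * q t (x + d)) (fun x => phi x * q t x)).
apply: (@hasd_limit _ G g).
- move=> d {}t d0; have [ep eq] := hs; have [fp fq] := hsys_ftc t.
  have [p2 px2 q2 qx2] := hsys_l2 t.
  have ed := evol_dq d ep; have eqd := evol_dq d eq.
  apply: hasd_eq; first exact: hasdD (hasd_ip t eq ed mp) (hasdN (hasd_ip t ep eqd mp)).
  cbv beta; rewrite !dqN_fun !dqV_product /g.
  have P2 := l2_dq d p2; have Q2 := l2_dq d q2; have Px2 := l2_dq d px2; have Qx2 := l2_dq d qx2.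
  have [_ lV] := multM_l2 (hsys_V t) fp.
  have VP := lV _ P2; have VQ := lV _ Q2; have Vp := lV _ p2; have Vq := lV _ q2.
  have WP := l2_dqVM d t (l2_sh d p2); have WQ := l2_dqVM d t (l2_sh d q2).
  have [pp' lp] := multM_l2 mp fp; have [pq' _] := multM_l2 mp fq.
  have [_ lp'] := multM_l2 mp' fp.
  have a3 := lp _ p2; have a4 := lp _ q2; have a5 := lp _ px2; have a6 := lp _ qx2.
  have b3 := lp _ P2; have b4 := lp _ Q2; have b5 := lp _ Px2; have b6 := lp _ Qx2.
  have c3 := lp' _ P2; have c4 := lp' _ Q2.
  have N (f h : R -> R) : l2 f -> l2 h -> ip f (fun x => - h x) = - ip f h.
    by move=> *; rewrite ipC ipNl// ipC.
  rewrite (N _ _ px2 (l2_dq (- d) pp')) (N _ _ qx2 (l2_dq (- d) pq')) -!ip_dq//.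
  rewrite !ipDr// ?ipNl//; try exact: l2N; try exact: l2D.
  rewrite !ipDl//.
  rewrite (ip_swap (Vt t) (dq d (q t))) (ip_swap (Vt t) (dq d (p t))).
  rewrite (ipMC (dq d (px t)) phi) (ipMC (dq d (qx t)) phi).
  ring.
- move=> {}t; have [fp fq] := hsys_ftc t; have [p2 px2 q2 qx2] := hsys_l2 t.
  have [mph _ [C HC] _ _] := mp.
  have /sdP[_ _ cp] := ftc_sd fp; have /sdP[_ _ cq] := ftc_sd fq.
  by apply: cvgB; (apply: cv2_ip; [exact: cv2_cst|apply: cvU_cv2 => //; exact: cvU_cst mph HC]).
have FF : Filter (zF t) by exact: filter_prod_filter.
have [hp hq] := zH t.
have zdN : - z.1 @[z --> zF t] --> (0 : R)^'.
  by apply: cvg_comp (@zd t) _; apply: dnbhs0N.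
have T f_ g_ f h : cvH (zF t) f_ g_ f h ->
   [/\ cv2 (zF t) (fun z x => - dq (- z.1) (fun x => phi' x * f_ z x) x) (fun x => - (phi'' x * f x + phi' x * h x)),
    cv2 (zF t) (fun z x => phi' x * dq z.1 (f_ z) x) (fun x => phi' x * h x) &
    cv2 (zF t) (fun z x => phi x * f_ z x) (fun x => phi x * f x)].
  move=> hf; have [hi h0 fc gc] := hf; have [m1 _ [C HC] sdp _] := mp'.
  have [_ _ c2] := @mult_cv2 _ _ _ FF _ _ _ _ _ _ mp' hf.
  have [c3 _ _] := @mult_cv2 _ _ _ FF _ _ _ _ _ _ mp hf.
  split; [|by apply: (@cvU_cv2 _ _ _ FF); [exact: cvU_cst m1 HC|exact: (@cvH_cv2_dq _ _ _ FF) hf]|exact: c3].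
    apply: (@cv2N _ _ _ FF).
    apply: (@cv2_dq _ _ _ FF _ _ (fun z x => phi'' x * f_ z x + phi' x * g_ z x)); [exact: zdN| | | |exact: c2].
    - by move=> z; exact: sdp.
    - exact: sdp.
    move=> z; have := sdp _ _ (ftcB (hi z) h0).
    by congr sd; apply/funext => x; ring.
have [p1 p2 p3] := T _ _ _ _ hp; have [q1 q2 q3] := T _ _ _ _ hq.
have cWp := @cv2_dq_rpotM _ _ a0 a1 _ _ FF _ _ _ _ _ _ _ _ _ _ _ _ _ (@zd t) hp hq hp.
have cWq := @cv2_dq_rpotM _ _ a0 a1 _ _ FF _ _ _ _ _ _ _ _ _ _ _ _ _ (@zd t) hp hq hq.
have [_ _ _ px2] := hp; have [_ _ _ qx2] := hq.
have e1 := @cv2_ip _ _ _ FF _ _ _ _ px2 p1; have e2 := @cv2_ip _ _ _ FF _ _ _ _ px2 p2.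
have e3 := @cv2_ip _ _ _ FF _ _ _ _ qx2 q1; have e4 := @cv2_ip _ _ _ FF _ _ _ _ qx2 q2.
have e5 := @cv2_ip _ _ _ FF _ _ _ _ cWp p3; have e6 := @cv2_ip _ _ _ FF _ _ _ _ cWq q3.
exact: (cvgD (cvgD (cvgB e1 e2) (cvgB e3 e4)) (cvgD e5 e6)).
Qed.

(** Both $D_d V$ and $D_{-d} V$ tend to $V_x$, and their sum is $(V(x+d) - V(x-d))/d$, whose
    weighted integral has the sign of [riesz_sign]. So twice the expression is a limit of
    nonpositive numbers. *)
Lemma virial_potential_le0 t : (forall x, `|phi x| <= 1) -> {homo phi : x y / x <= y} ->
  ip (fun x => Vxt t x * p t x) (fun x => phi x * p t x) +
  ip (fun x => Vxt t x * q t x) (fun x => phi x * q t x) <= 0.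
Proof.
move=> phi1 incr.
have [fp fq] := hsys_ftc t; have [p2 px2 q2 qx2] := hsys_l2 t.
have [_ l] := multM_l2 mp fp.
have [mph _ _ _ _] := mp.
pose S d := ip (fun x => dq d (Vt t) x * p t x) (fun x => phi x * p t x) +
            ip (fun x => dq d (Vt t) x * q t x) (fun x => phi x * q t x).
set Y := (X in X <= 0).
have SY : S d @[d --> (0 : R)^'] --> Y.
  have Hp : cvH (0 : R)^' (fun=> p t) (fun=> px t) (p t) (px t) by exact: cvH_cst.
  have Hq : cvH (0 : R)^' (fun=> q t) (fun=> qx t) (q t) (qx t) by exact: cvH_cst.
  have cid : (d : R) @[d --> (0 : R)^'] --> (0 : R)^' by exact: cvg_id.
  have [c1 c2] := @msq_dq_nets _ _ _ _ _ _ _ _ _ _ _ _ _ cid Hp Hq.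
  have T f g0 : ftc f g0 -> cv2 (0 : R)^' (fun d x => dq d (Vt t) x * f x) (fun x => Vxt t x * f x).
    move=> ff; have [hf _ _] := ff.
    have -> : (fun d x => dq d (Vt t) x * f x) = (fun d x => rpot a (dq d (msq (p t) (q t))) x * f x).
      by apply/funext => d; rewrite (dq_rpot_msq a0 a1 d fp fq).
    have Hf : cvH (0 : R)^' (fun=> f) (fun=> g0) f g0 by exact: cvH_cst.
    by apply: (cv2_rpotM a0 a1) => //; [exact: cvH_cvU Hf|exact: cv2_cst].
  by apply: cvgD; (apply: cv2_ip; [apply: T; eassumption|apply: cv2_cst; exact: l]).
have SN : S (- d) @[d --> (0 : R)^'] --> Y.
  by apply: (@cvg_comp _ _ _ -%R S _ _ _ _ SY); apply: dnbhs0N.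
have [m1 [C mC]] := msq_L1 fp fq.
have S0 d : 0 < d -> S d + S (- d) <= 0.
  move=> d0; have := riesz_sign a0 a1 d0 m1 mC mph phi1 incr.
  have L e f : l2 f -> L1 (fun x => dq e (Vt t) x * f x * (phi x * f x)).
    by move=> hf; apply: l2M; [exact: l2_dqVM|exact: l].
  have Lp := L d _ p2; have Lq := L d _ q2; have Lp' := L (- d) _ p2; have Lq' := L (- d) _ q2.
  set J := intg _ => J0.
  suff -> : S d + S (- d) = d^-1 * J by rewrite pmulr_rle0// invr_gt0.
  rewrite /S /ip -!intgD//; [|exact: L1D..].
  apply: (mulfI (lt0r_neq0 d0)); rewrite mulVKf ?lt0r_neq0// -intgZ; last by apply: L1D; exact: L1D.
  rewrite /J; congr intg; apply/funext => x; rewrite /dq /msq.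
  by move: (Vt t (x + d)) (Vt t (x - d)) (Vt t x) => A B D; field; rewrite gt_eqF.
have Z : S d + S (- d) @[d --> (0 : R)^'] --> Y + Y by exact: cvgD SY SN.
have : Y + Y <= 0.
  apply: (@closed_cvg _ _ (0 : R)^' _ _ (fun y : R => y <= 0) _ _ _ Z); first exact: closed_le.
  near=> d.
  have d0 : d != 0 by near: d; exact: nbhs_dnbhs_neq.
  have [dp|dn|dz] := ltgtP 0 d; first exact: S0.
    have := S0 (- d); rewrite opprK oppr_gt0 => /(_ dn); by rewrite addrC.
  by rewrite -dz eqxx in d0.
by move: Y {SY SN Z} => Y; lra.
Unshelve. all: by end_near. Qed.
End Virial.
End System.

(** * Coercivity and decay *)

Section Weights.
Context {R : realType}.
Implicit Types (f g : R -> R) (x y d : R).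

Definition sg x : R := Num.sg x.
Definition w x : R := (1 + `|x|)^-1.

Lemma mfun_sg : mfun sg.
Proof.
have -> : sg = (fun x => \1_(`]0, +oo[%classic) x - \1_(`]-oo, 0[%classic) x).
  apply/funext => x; rewrite /sg !indicE !mem_setE !in_itv/= andbT.
  by case: sgrP => h; rewrite ?ltxx ?subr0 ?sub0r ?(lt_gtF h)//= ?subr0 ?sub0r.
by apply: mfunB; apply: measurable_indic.
Qed.

Lemma w_gt0 x : 0 < w x. Proof. by rewrite invr_gt0 ltr_wpDr. Qed.
Lemma w_le1 x : w x <= 1. Proof. by rewrite invf_le1 ?ltr_wpDr// lerDl. Qed.
Lemma wE x : w x * (1 + `|x|) = 1. Proof. by rewrite mulVf// gt_eqF// ltr_wpDr. Qed.
Lemma absw x : `|x| * w x = 1 - w x.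
Proof. by have := wE x; rewrite mulrDr mulr1 => h; rewrite mulrC; lra. Qed.

(** Increments of $w$ are reduced to those of $|x|$; its Lipschitz bound and its derivative both
    come from here. *)
Lemma wB x y : w y - w x = - (`|y| - `|x|) * (w y * w x).
Proof.
have := wE x; have := wE y; move: (w x) (w y) => a b h1 h2.
transitivity (b * (a * (1 + `|x|)) - a * (b * (1 + `|y|))); last by ring.
by rewrite h1 h2 !mulr1.
Qed.

Lemma w_lip x y : `|w y - w x| <= `|y - x|.
Proof.
rewrite wB normrM normrN (ger0_norm (ltW (mulr_gt0 (w_gt0 y) (w_gt0 x)))).
apply: (@le_trans _ _ (`| `|y| - `|x| | * 1)); last by rewrite mulr1 ler_dist_dist.
rewrite ler_wpM2l//; have := w_le1 x; have := w_le1 y; have := w_gt0 x; have := w_gt0 y; nra.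
Qed.

Lemma w_cvg x : w (x + d) @[d --> (0 : R)^'] --> w x.
Proof.
apply/cvgrPdist_le => e e0; near=> d; rewrite distrC (le_trans (w_lip _ _))// addrAC subrr add0r.
apply: ltW; near: d; apply: nbhs_dnbhs; apply: (@cvgr0_norm_lt _ _ _ (nbhs (0 : R)) _ (fun h => h)) => //.
Unshelve. all: by end_near. Qed.

Lemma abs_near x : x != 0 -> \forall d \near (0 : R)^', `|x + d| - `|x| = sg x * d.
Proof.
move=> x0; near=> d.
have dx : `|d| < `|x|.
  near: d; apply: nbhs_dnbhs; apply: (@cvgr0_norm_lt _ _ _ (nbhs (0 : R)) _ (fun h => h)) => //.
  by rewrite normr_gt0.
move: dx; rewrite /sg ltr_norml.
have [xp|xn|xe] := ltgtP x 0; last by have := x0; rewrite xe eqxx.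
  rewrite ltr0_norm// ltr0_sg// => /andP[h1 h2]; rewrite ltr0_norm; [ring|lra].
rewrite gtr0_norm// gtr0_sg// => /andP[h1 h2]; rewrite gtr0_norm; [ring|lra].
Unshelve. all: by end_near. Qed.

Lemma lipm_w : lipm w (fun x => - sg x * w x ^+ 2).
Proof.
have cw : continuous w.
  move=> x; apply: cvgV; first by rewrite gt_eqF// ltr_wpDr.
  by apply: cvgD; [exact: cvg_cst|apply: cvg_norm; exact: cvg_id].
have mw : mfun w by exact: continuous_measurable_fun.
have w01 x : `|w x| <= 1 by rewrite ger0_norm ?w_le1// ltW ?w_gt0.
split => //.
- by apply: mfunM; [apply: mfunN; exact: mfun_sg|exact: mfunX].
- exists 1 => x; split => //.
    rewrite normrM normrN mulr_ile1// ?normrX ?exprn_ile1//.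
    by rewrite /sg normr_sg; case: eqP.
  by move=> d; rewrite mul1r (le_trans (w_lip _ _))// addrAC subrr add0r.
move=> x x0.
have L : - sg x * (w (x + d) * w x) @[d --> (0 : R)^'] --> - sg x * (w x * w x).
  by apply: cvgM; [exact: cvg_cst|apply: cvgM; [exact: w_cvg|exact: cvg_cst]].
rewrite expr2; apply: (cvg_near_eq _ L); near=> d.
have d0 : d != 0 by near: d; exact: nbhs_dnbhs_neq.
have E : `|x + d| - `|x| = sg x * d by near: d; exact: abs_near.
by rewrite /dq wB E; field.
Unshelve. all: by end_near. Qed.

Lemma lipm_eq psi psi' chi chi' : lipm psi psi' -> psi =1 chi -> psi' =1 chi' -> @lipm R chi chi'.
Proof. by move=> h /funext <- /funext <-. Qed.

Lemma lipmM psi psi' chi chi' : @lipm R psi psi' -> lipm chi chi' ->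
  lipm (fun x => psi x * chi x) (fun x => psi' x * chi x + psi x * chi' x).
Proof.
move=> [m1 m1' [C HC] l1] [m2 m2' [D HD] l2].
have C0 : 0 <= C by have [h _ _] := HC 0; exact: le_trans (normr_ge0 _) h.
have D0 : 0 <= D by have [h _ _] := HD 0; exact: le_trans (normr_ge0 _) h.
have CD : 0 <= C * D by exact: mulr_ge0.
split.
- exact: mfunM.
- by apply: mfunD; exact: mfunM.
- exists (C * D + C * D) => x; have [h1 h2 h3] := HC x; have [k1 k2 k3] := HD x; split.
  + by rewrite normrM (le_trans (ler_pM _ _ h1 k1))// lerDl.
  + by rewrite (le_trans (ler_normD _ _))// !normrM lerD// ler_pM.
  move=> d; have [h1' _ _] := HC (x + d).
  have -> : psi (x + d) * chi (x + d) - psi x * chi x =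
    psi (x + d) * (chi (x + d) - chi x) + (psi (x + d) - psi x) * chi x by ring.
  rewrite (le_trans (ler_normD _ _))// !normrM mulrDl lerD//.
    by rewrite -mulrA ler_pM.
  by rewrite mulrAC ler_pM.
move=> x x0.
have -> : (fun d => dq d (fun x => psi x * chi x) x) = (fun d => dq d psi x * chi x + psi (x + d) * dq d chi x).
  by apply/funext => d; rewrite dqM addrC.
apply: cvgD; first by apply: cvgM; [exact: l1|exact: cvg_cst].
apply: cvgM; last exact: l2.
apply/cvgrPdist_le => e e0; near=> d; rewrite distrC.
have [_ _ h3] := HC x; apply: (le_trans (h3 d)).
have dn : `|d| < e / (C + 1).
  near: d; apply: nbhs_dnbhs; apply: (@cvgr0_norm_lt _ _ _ (nbhs (0 : R)) _ (fun h => h)) => //.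
  by rewrite divr_gt0// ltr_wpDl.
have : `|d| * (C + 1) < e by rewrite -ltr_pdivlMr// ltr_wpDl.
have := normr_ge0 d; nra.
Unshelve. all: by end_near. Qed.

Lemma lipm_wX n : lipm (fun x => w x ^+ n.+1) (fun x => - (n.+1%:R * (sg x * w x ^+ n.+2))).
Proof.
elim: n => [|n IH].
  by apply: lipm_eq lipm_w _ _ => x; rewrite ?expr1// mul1r mulNr.
apply: (lipm_eq (lipmM lipm_w IH)) => x; first by rewrite -exprS.
by rewrite [in RHS]mulrSr !exprS; ring.
Qed.

Lemma mult_wX n : mult (fun x => w x ^+ n.+1) (fun x => - (n.+1%:R * (sg x * w x ^+ n.+2))).
Proof. by apply: lipm_mult; exact: lipm_wX. Qed.

Lemma xw_le1 x : `|x * w x| <= 1.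
Proof.
rewrite normrM (ger0_norm (ltW (w_gt0 x))) absw; have := w_gt0 x; lra.
Qed.

Lemma xw_homo : {homo (fun x => x * w x) : x y / x <= y}.
Proof.
move=> x y xy; rewrite -subr_ge0.
have -> : y * w y - x * w x = (y * (1 + `|x|) - x * (1 + `|y|)) * (w x * w y).
  have := wE x; have := wE y; move: (w x) (w y) => a b h1 h2.
  transitivity (y * b * (a * (1 + `|x|)) - x * a * (b * (1 + `|y|))); last by ring.
  by rewrite h1 h2; ring.
rewrite mulr_ge0 ?mulr_ge0 ?(ltW (w_gt0 _))//.
by case: (ger0P x) => hx; case: (ger0P y) => hy; nra.
Qed.

Lemma mult_xw : mult (fun x => x * w x) (fun x => w x ^+ 2).
Proof.
have [mw mw' [C HC] lw] := lipm_w.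
apply: lipm_mult; split.
- by apply: mfunM => //; exact: mfun_id.
- exact: mfunX.
- exists 2 => x; split; first by rewrite (le_trans (xw_le1 x))// ler1n.
    rewrite ger0_norm ?sqr_ge0//; have := w_gt0 x; have := w_le1 x; nra.
  move=> d; have -> : (x + d) * w (x + d) - x * w x = (x * w x) * (- (`|x + d| - `|x|) * w (x + d)) + d * w (x + d).
    rewrite mulrDl addrAC -mulrBr wB; ring.
  have k1 := xw_le1 x; have k2 := w_gt0 (x + d); have k3 := w_le1 (x + d).
  rewrite (le_trans (ler_normD _ _))// mulr_natl mulr2n lerD//.
    rewrite normrM -[leRHS]mul1r ler_pM// normrM normrN -[leRHS]mulr1 ler_pM//.
      by rewrite (le_trans (ler_dist_dist _ _))// addrAC subrr add0r.
    by rewrite ger0_norm// ltW.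
  by rewrite normrM -[leRHS]mulr1 ler_wpM2l// ger0_norm// ltW.
move=> x x0.
have -> : (fun d => dq d (fun x => x * w x) x) = (fun d => x * dq d w x + dq d id x * w (x + d)).
  by apply/funext => d; rewrite dqM'.
(* By $|x| w = 1 - w$ the derivative $w - |x| w^2$ of $x w$ simplifies to $w^2$. *)
have -> : w x ^+ 2 = x * (- sg x * w x ^+ 2) + 1 * w x.
  have -> : x * (- sg x * w x ^+ 2) = - ((`|x| * w x) * w x) by rewrite (normrEsg x) /sg; ring.
  rewrite absw; ring.
apply: cvgD; first by apply: cvgM; [exact: cvg_cst|exact: lw].
apply: cvgM; last exact: w_cvg.
apply: (cvg_near_eq _ (cvg_cst (1 : R))); near=> d.
have d0 : d != 0 by near: d; exact: nbhs_dnbhs_neq.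
by rewrite /dq addrAC subrr add0r divff.
Unshelve. all: by end_near. Qed.

Lemma sg_abs x : `|sg x| <= 1.
Proof. by rewrite /sg normr_sg; case: eqP. Qed.

(** On each half line the factor is a constant sign, and at the origin the vanishing of $f$ leaves
    no jump, so the two primitives fit together. *)
Lemma ftc_sg f g : ftc f g -> f 0 = 0 -> ftc (fun x => sg x * f x) (fun x => sg x * g x).
Proof.
move=> fg f0; have [hf hg _] := fg.
have hsg h : l2 h -> l2 (fun x => sg x * h x) by move=> hh; exact: l2Mb mfun_sg sg_abs hh.
have hs := hsg _ hg.
split; [exact: hsg|exact: hsg|].
have ms x y : mfun (fun z => ind x y z * (sg z * g z)).
  by apply: mfunM; [exact: mfun_ind|exact: l2_mfun].
have ms' x y : mfun (fun z => ind x y z * g z).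
  by apply: mfunM; [exact: mfun_ind|exact: l2_mfun].
have P x y : 0 <= x -> x <= y -> sg y * f y - sg x * f x = intg (fun z => ind x y z * (sg z * g z)).
  have S z : 0 <= z -> sg z * f z = f z.
    rewrite le_eqVlt => /orP[/eqP <-|z0]; first by rewrite f0 mulr0.
    by rewrite /sg gtr0_sg// mul1r.
  move=> x0 xy; rewrite !S//; last exact: le_trans xy.
  rewrite (ftcE fg xy); apply: aeq_intg => //.
  apply: ae_sub (ae_neq 0) => z /= z0; rewrite indE; case: ifPn => [/andP[xz zy]|_]; last by rewrite !mul0r.
  by rewrite /sg gtr0_sg ?mul1r// lt_neqAle eq_sym z0 (le_trans x0 xz).
have N x y : y <= 0 -> x <= y -> sg y * f y - sg x * f x = intg (fun z => ind x y z * (sg z * g z)).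
  have S z : z <= 0 -> sg z * f z = - f z.
    rewrite le_eqVlt => /orP[/eqP ->|z0]; first by rewrite f0 mulr0 oppr0.
    by rewrite /sg ltr0_sg// mulN1r.
  move=> y0 xy; rewrite !S//; last exact: le_trans xy y0.
  have -> : - f y - - f x = - (f y - f x) by ring.
  rewrite (ftcE fg xy) -intgN; last exact: L1loc_l2.
  apply: aeq_intg => //; first exact: mfunN.
  apply: ae_sub (ae_neq 0) => z /= z0; rewrite indE; case: ifPn => [/andP[xz zy]|_]; last by rewrite !mul0r oppr0.
  by rewrite /sg ltr0_sg ?mul1r ?mulN1r// lt_neqAle z0 (le_trans zy y0).
move=> x y xy; rewrite Rintegral_ind.
have [x0|x0] := leP 0 x; first exact: P.
have [y0|y0] := leP y 0; first exact: N.
rewrite (ind_chain hs (ltW x0) (ltW y0)) -(P 0 y)// ?ltW// -(N x 0)// ?ltW//.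
by rewrite f0 mulr0 subr0 sub0r addrC.
Qed.

(* The test function [w^3 f sgn f], which is in H^1 because f(0) = 0, yields
   [3 |w^2 f|^2 = 2 int sgn(x) w^3 f g]; this gains the term [w^4 f^2]. *)
Lemma weighted_coercive f g : ftc f g -> f 0 = 0 ->
  ip g (fun x => - (- (2 * (sg x * w x ^+ 3)) * f x + w x ^+ 2 * g x)) - ip g (fun x => w x ^+ 2 * g x) <=
  - (3^-1 * n2 (fun x => w x * g x) ^+ 2 + 2^-1 * n2 (fun x => w x ^+ 2 * f x) ^+ 2).
Proof.
move=> fg f0; have [hf hg _] := fg.
have [mw _ _ _] := lipm_w.
have w01 n x : `|w x ^+ n| <= 1.
  by rewrite normrX exprn_ile1// ger0_norm ?w_le1// ltW ?w_gt0.
have lw n h : l2 h -> l2 (fun x => w x ^+ n * h x) by move=> hh; exact: l2Mb (mfunX n mw) (w01 n) hh.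
have ls h : l2 h -> l2 (fun x => sg x * h x) by move=> hh; exact: l2Mb mfun_sg sg_abs hh.
have [_ _ _ sd3 _] := mult_wX 2.
have := sd_ibp (sd3 _ _ fg) (ftc_sd (ftc_sg fg f0)).
have lsf := ls _ hf; have lsg := ls _ hg.
pose X := ip (fun x => w x * g x) (fun x => sg x * (w x ^+ 2 * f x)).
pose A := n2 (fun x => w x * g x); pose B := n2 (fun x => w x ^+ 2 * f x).
have lwg : l2 (fun x => w x * g x) by have := lw 1 _ hg.
have lwf := lw 2 _ hf; have lwsf := ls _ lwf.
have Xle : X <= A * B.
  apply: (le_trans (ler_norm _)); apply: (le_trans (ip_le_n2 lwg lwsf)).
  rewrite ler_wpM2l ?n2_ge0// -[leRHS]mul1r; exact: n2Mb mfun_sg sg_abs lwf.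
have LX : L1 (fun x => w x * g x * (sg x * (w x ^+ 2 * f x))) := l2M lwg lwsf.
have LB : L1 (fun x => (w x ^+ 2 * f x) * (w x ^+ 2 * f x)) := l2M lwf lwf.
have LA : L1 (fun x => (w x * g x) * (w x * g x)) := l2M lwg lwg.
(* At the origin [sg] is 0, but so is $f$. *)
have sgf x : sg x * sg x * f x = f x.
  have [->|x0] := eqVneq x 0; first by rewrite f0 mulr0.
  by rewrite /sg -expr2 sqr_sg x0 mul1r.
have -> : ip (fun x => - (3 * (sg x * w x ^+ 4)) * f x + w x ^+ 3 * g x) (fun x => sg x * f x) +
  ip (fun x => w x ^+ 3 * f x) (fun x => sg x * g x) = 2 * X - 3 * B ^+ 2.
  rewrite n2E /X /ip -!intgZ// -intgB; [|exact: L1Z..].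
  rewrite -intgD.
  - congr intg; apply/funext => x; move: (sgf x); move: (sg x) (f x) (w x) (g x) => s F W G E.
    transitivity (2 * (W * G * (s * (W ^+ 2 * F))) - 3 * (W ^+ 4 * F * (s * s * F))); first by ring.
    by rewrite E; ring.
  - apply: l2M => //; apply: l2D; last exact: lw.
    have := l2Z (-3) (ls _ (lw 4 _ hf)); congr l2; apply/funext => x; ring.
  - by apply: l2M => //; exact: lw.
have -> : ip g (fun x => - (- (2 * (sg x * w x ^+ 3)) * f x + w x ^+ 2 * g x)) - ip g (fun x => w x ^+ 2 * g x) =
   2 * X - 2 * A ^+ 2.
  have -> : 2 * X - 2 * A ^+ 2 = intg (fun x => 2 * (w x * g x * (sg x * (w x ^+ 2 * f x))) -
      2 * ((w x * g x) * (w x * g x))).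
    by rewrite n2E /X /ip -!intgZ// -intgB; [|exact: L1Z..].
  have LA' : L1 (fun x => g x * (w x ^+ 2 * g x)) by move: LA; congr L1; apply/funext => x; ring.
  rewrite /ip -intgB//; first by congr intg; apply/funext => x; ring.
  have := L1B (L1Z 2 LX) LA; congr L1; apply/funext => x; ring.
move=> E; have : 3 * B ^+ 2 = 2 * X by lra.
rewrite -/A -/B; have := n2_ge0 (fun x => w x * g x); have := n2_ge0 (fun x => w x ^+ 2 * f x).
rewrite -/A -/B; move: A B X Xle {E LX LB LA} => A B X XAB B0 A0 E.
(* The claim amounts to $\frac72 B^2 \le \frac53 A^2$. The square gives $60AB \le 25A^2 + 36B^2$,
   which turns $3B^2 \le 2AB$ into $54B^2 \le 25A^2$, and this suffices. *)
have := sqr_ge0 (5 * A - 6 * B); rewrite !expr2 in E *; nra.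
Qed.
End Weights.

(** * Decay from a bounded monotone functional *)

Section Decay.
Context {R : realType}.

Lemma mvt_le (F f : R -> R) (s t : R) : (forall x, hasd F x (f x)) -> s < t ->
  exists2 c, s <= c <= t & F t - F s = f c * (t - s).
Proof.
move=> H st; have ct : {within `[s, t], continuous F}.
  by apply: continuous_subspaceT => x; exact: hasd_continuous (H x).
have [c /[!in_itv]/= /andP[sc ct'] E] := MVT st (fun x _ => H x) ct.
by exists c => //; rewrite !ltW.
Qed.

Lemma hasd_le0_nincr (F f : R -> R) s t : (forall x, hasd F x (f x)) -> (forall x, f x <= 0) ->
  s <= t -> F t <= F s.
Proof.
move=> H f0; rewrite le_eqVlt => /orP[/eqP -> //|st].
have [c _ E] := mvt_le H st; by rewrite -subr_le0 E mulr_le0_ge0// subr_ge0 ltW.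
Qed.

(* [M + c B] and [- M + c B] are nonincreasing, so that the oscillation of [M] is
   controlled by that of [B], and [M] is small at some time by the mean value
   theorem for [B]. *)
Lemma decay (M B M' B' : R -> R) (c K : R) : 0 < c ->
  (forall t, hasd M t (M' t)) -> (forall t, hasd B t (B' t)) ->
  (forall t, 0 <= M t <= - (c * B' t)) -> (forall t, `|M' t| <= - (c * B' t)) ->
  (forall t, `|B t| <= K) -> M t @[t --> +oo] --> (0 : R).
Proof.
move=> c0 dM dB M0 MB BK.
have B'0 t : B' t <= 0 by have /andP[h1 h2] := M0 t; nra.
have mB s t : s <= t -> B t <= B s by exact: hasd_le0_nincr dB B'0.
have mP s t : s <= t -> M t + c * B t <= M s + c * B s.
  apply: (@hasd_le0_nincr (fun t => M t + c * B t) (fun t => M' t + (c * B' t + B t * 0))).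
    by move=> x; apply: hasdD => //; apply: hasdM => //; exact: hasd_cst.
  by move=> x; have := MB x; rewrite ler_norml mulr0 addr0 => /andP[h1 h2]; lra.
have mN s t : s <= t -> - M t + c * B t <= - M s + c * B s.
  apply: (@hasd_le0_nincr (fun t => - M t + c * B t) (fun t => - M' t + (c * B' t + B t * 0))).
    by move=> x; apply: hasdD; [exact: hasdN|apply: hasdM => //; exact: hasd_cst].
  by move=> x; have := MB x; rewrite ler_norml mulr0 addr0 => /andP[h1 h2]; lra.
have K0 : 0 <= K := le_trans (normr_ge0 _) (BK 0).
apply/cvgrPdist_le => e e0.
pose A := [set B t | t in [set: R]].
have hA : has_inf A.
  split; first by exists (B 0); exists 0.
  by exists (- K) => _ [t _ <-]; have := BK t; rewrite ler_norml => /andP[].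
have e2 : 0 < e / 2 / c by rewrite !divr_gt0.
have [_ [T _ <-] HT] := inf_adherent e2 hA.
have HB t : B T - e / 2 / c <= B t.
  have : inf A <= B t by apply: ge_inf; [exact: hA.2|exists t].
  by move: HT; lra.
(* Over a time interval of this length $B$ changes by at most $2K$, so the mean of $-cB'$ there is
   at most $2Kc/N \le e/2$. *)
pose N := 4 * K * c / e + 1.
have N0 : 0 < N.
  have : 0 <= 4 * K * c / e by rewrite divr_ge0 ?mulr_ge0// ltW.
  by rewrite /N; lra.
have TN : T < T + N by lra.
have [s /andP[Ts sT] Es] := mvt_le dB TN.
have Ms : M s <= e / 2.
  have /andP[_ h] := M0 s; apply: (le_trans h).
  have b1 : - (K + K) <= B' s * N.
    have -> : B' s * N = B (T + N) - B T by rewrite Es; ring.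
    have := BK T; have := BK (T + N); rewrite !ler_norml => /andP[h1 h2] /andP[h3 h4]; lra.
  have : e * N = 4 * K * c + e by rewrite /N; field; rewrite gt_eqF.
  have b2 : - (c * B' s) * N <= c * (K + K) by nra.
  move=> b3; rewrite -(ler_pM2r N0); nra.
near=> t.
have Tt : s <= t by near: t; exact: nbhs_pinfty_ge (num_real s).
have /andP[m0 _] := M0 t.
rewrite sub0r normrN ger0_norm//.
(* $M(t) \le M(s) + c(B(s) - B(t))$, and $B(s) - B(t) \le B(T) - B(t) \le e/(2c)$ because $B(T)$ is
   that close to the infimum. *)
have := mP _ _ Tt; have := HB t; have := mB _ _ Ts.
have : c * (e / 2 / c) = e / 2 by field; rewrite gt_eqF.
move: Ms; move: (e / 2 / c) => z; nra.
Unshelve. all: by end_near. Qed.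
End Decay.

(** * Local decay for the real system *)

Section RealDecay.
Context {R : realType} (a : R) (a0 : 0 < a) (a1 : a < 1).
Context (p px q qx : R -> R -> R) (hs : hsys a p px q qx).
Context (p0 : forall t, p t 0 = 0) (q0 : forall t, q t 0 = 0).
Implicit Types (f g : R -> R) (t x : R).

Lemma rpot_ge0 f x : (forall y, 0 <= f y) -> 0 <= rpot a f x.
Proof.
move=> f0; apply: addr_ge0; apply: intg_ge0 => y; apply: mulr_ge0 => //; first exact: riesz_near_ge0.
by have /andP[] := riesz_far01 (x - y) a0.
Qed.

Lemma le_sqr1 x : x <= x ^+ 2 + 1.
Proof. have := sqr_ge0 (x - 1); nra. Qed.

Lemma mass_cst s t : n2 (p s) ^+ 2 + n2 (q s) ^+ 2 = n2 (p t) ^+ 2 + n2 (q t) ^+ 2.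
Proof.
have S (h : R -> R) : (fun x => 1 * h x) = h by apply/funext => x; rewrite mul1r.
pose F t := ip (p t) (fun x => 1 * p t x) + ip (q t) (fun x => 1 * q t x).
have H x : hasd F x 0.
  apply: hasd_eq (hasd_density a0 a1 hs x (mult_cst (1 : R))) _.
  have Z f h : ip f (fun x => 0 * h x) = 0.
    by rewrite /ip -[RHS](@intg0 R); congr intg; apply/funext => y; ring.
  by rewrite !Z; ring.
have [c _ E] := mvt s t H.
have : F t = F s by apply/eqP; rewrite -subr_eq0 E mul0r.
by rewrite /F !S !n2E.
Qed.

(** The defocusing sign makes the potential energy nonnegative, so the conserved energy bounds the
    kinetic part; mass bounds the rest. *)
Lemma norm_bound : exists2 K : R, 0 <= K &
  forall t, [/\ n2 (p t) <= K, n2 (px t) <= K, n2 (q t) <= K & n2 (qx t) <= K].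
Proof.
pose A := n2 (p 0) ^+ 2 + n2 (q 0) ^+ 2; pose B := energy a p px q qx 0.
have E t : n2 (px t) ^+ 2 + n2 (qx t) ^+ 2 <= B.
  rewrite /B (energy_cst a0 a1 hs 0 t) /energy !n2E lerDl mulr_ge0//.
  have m0 y : 0 <= msq (p t) (q t) y by rewrite addr_ge0 ?sqr_ge0.
  by apply: intg_ge0 => x; rewrite mulr_ge0// rpot_ge0.
have B0 : 0 <= B by apply: le_trans (E 0); rewrite addr_ge0 ?sqr_ge0.
have A0 : 0 <= A by rewrite addr_ge0 ?sqr_ge0.
(* Each norm is at most its square plus 1, which avoids square roots. *)
exists (A + B + 1) => [|t]; first by rewrite addr_ge0// addr_ge0.
have H1 : n2 (p t) ^+ 2 + n2 (q t) ^+ 2 = A by exact: mass_cst.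
have H2 := E t.
move: (n2 (p t)) (n2 (px t)) (n2 (q t)) (n2 (qx t)) H1 H2 => a' b' c' d' H1 H2.
have := sqr_ge0 a'; have := sqr_ge0 b'; have := sqr_ge0 c'; have := sqr_ge0 d'.
have := le_sqr1 a'; have := le_sqr1 b'; have := le_sqr1 c'; have := le_sqr1 d'.
by split; lra.
Qed.

Let W1 g := n2 (fun x => w x * g x).
Let W2 f := n2 (fun x => w x ^+ 2 * f x).

Lemma w_pow_le1 n x : `|(w x : R) ^+ n| <= 1.
Proof. by rewrite normrX exprn_ile1// ger0_norm ?w_le1// ltW ?w_gt0. Qed.

Lemma mfun_w : mfun (@w R). Proof. by have [] := @lipm_w R. Qed.

Lemma l2_wX n f : l2 f -> l2 (fun x => w x ^+ n * f x).
Proof. by move=> hf; exact: l2Mb (mfunX n mfun_w) (w_pow_le1 n) hf. Qed.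

(** The weight $w^5$ is distributed as $w \cdot w^2 \cdot w^2$, so that the mass flux is controlled
    by the two norms occurring in [weighted_coercive]. *)
Lemma flux_bound f g : l2 f -> l2 g ->
  `|ip g (fun x => - (4 * (sg x * w x ^+ 5)) * f x)| <= 4 * (W1 g * W2 f).
Proof.
move=> hf hg; have hg1 : l2 (fun x => w x * g x) by exact: (l2_wX 1 hg).
have hf2 := l2_wX 2 hf.
pose h (x : R) := - (4 * (sg x * w x ^+ 2)).
have mh : mfun h.
  by apply: mfunN; apply: mfunM; [exact: mfun_cst|apply: mfunM; [exact: mfun_sg|exact: mfunX mfun_w]].
have hb x : `|h x| <= 4.
  rewrite normrN normrM (ger0_norm (ler0n _ 4)) -[leRHS]mulr1 ler_wpM2l//.
  by rewrite normrM mulr_ile1// ?sg_abs// w_pow_le1.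
have -> : ip g (fun x => - (4 * (sg x * w x ^+ 5)) * f x) =
   ip (fun x => w x * g x) (fun x => h x * (w x ^+ 2 * f x)).
  by congr intg; apply/funext => x; rewrite /h; ring.
apply: (le_trans (ip_le_n2 hg1 (l2Mb mh hb hf2))).
by rewrite mulrCA ler_wpM2l ?n2_ge0//; exact: n2Mb mh hb hf2.
Qed.

(** The 12 makes the coercive terms into $4A^2 + 6D^2$ and $4B^2 + 6C^2$, which absorb $8AD \le 4A^2
    + 4D^2$ and $8BC \le 4B^2 + 4C^2$. *)
Lemma decay_arith (A B C D c1 c2 v1 : R) :
  c2 <= - (3^-1 * B ^+ 2 + 2^-1 * D ^+ 2) -> c1 <= - (3^-1 * A ^+ 2 + 2^-1 * C ^+ 2) -> v1 <= 0 ->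
  2 * (4 * (B * C) + 4 * (A * D)) <= - (12 * (c1 + c2 + v1)).
Proof. by have := sqr_ge0 (A - D); have := sqr_ge0 (B - C); nra. Qed.

(** The mass carries the weight $w^4$ because that is what coercivity controls; the virial weight $x
    w$ is bounded and increasing, with derivative $w^2$. *)
Lemma weighted_mass_decay : W2 (p t) ^+ 2 + W2 (q t) ^+ 2 @[t --> +oo] --> (0 : R).
Proof.
have mphi := @mult_xw R; have mphi' := @mult_wX R 1; have m4 := @mult_wX R 3.
have dB t := hasd_virial a0 a1 hs mphi mphi' t.
have dM t := hasd_density a0 a1 hs t m4.
have ME : (fun t => W2 (p t) ^+ 2 + W2 (q t) ^+ 2) =
  (fun t => ip (p t) (fun x => w x ^+ 4 * p t x) + ip (q t) (fun x => w x ^+ 4 * q t x)).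
  apply/funext => t; rewrite /W2 !n2E; congr (_ + _); congr intg; apply/funext => x; ring.
have [K K0 HK] := norm_bound.
have bnd t : 0 <= W2 (p t) ^+ 2 + W2 (q t) ^+ 2 by rewrite addr_ge0 ?sqr_ge0.
have MEt t := congr1 (fun f => f t) ME; rewrite /= in MEt.
have V0 t := virial_potential_le0 a0 a1 hs mphi t (@xw_le1 R) (@xw_homo R).
have Cp t := weighted_coercive (hsys_ftc hs t).1 (p0 t).
have Cq t := weighted_coercive (hsys_ftc hs t).2 (q0 t).
(* The factor 12 is that of [decay_arith]; $2K^2$ bounds the virial by Cauchy-Schwarz, as $|x w| \le
   1$. *)
rewrite ME; apply: (@decay R _ _ _ _ 12 (K * K + K * K) _ dM dB) => //.
- move=> t; rewrite -MEt bnd/=.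
  have := V0 t; have := Cp t; have := Cq t.
  rewrite -/(W1 _) -/(W2 _) -/(W1 _) -/(W2 _).
  set v1 := ip _ (fun x => x * w x * p t x) + _; set c1 := ip (px t) _ - _; set c2 := ip (qx t) _ - _.
  have := sqr_ge0 (W1 (px t)); have := sqr_ge0 (W1 (qx t)).
  have := sqr_ge0 (W2 (p t)); have := sqr_ge0 (W2 (q t)).
  move: c1 c2 v1 (W1 (px t) ^+ 2) (W1 (qx t) ^+ 2) (W2 (p t) ^+ 2) (W2 (q t) ^+ 2) => c1 c2 v1 A B C D.
  lra.
- move=> t.
  have := V0 t; have := Cp t; have := Cq t.
  rewrite -/(W1 _) -/(W2 _) -/(W1 _) -/(W2 _).
  set v1 := ip _ (fun x => x * w x * p t x) + _; set c1 := ip (px t) _ - _; set c2 := ip (qx t) _ - _.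
  have [p2 px2 q2 qx2] := hsys_l2 hs t.
  have := flux_bound p2 qx2; have := flux_bound q2 px2.
  set f1 := ip (px t) _; set f2 := ip (qx t) _.
  move: c1 c2 v1 f1 f2 (W1 (px t)) (W1 (qx t)) (W2 (p t)) (W2 (q t)) => c1 c2 v1 f1 f2 A B C D.
  move=> h1 h2 h3 h4 h5.
  have g1 : `|2 * (f2 - f1)| <= 2 * (4 * (B * C) + 4 * (A * D)).
    by rewrite normrM (ger0_norm (ler0n _ 2)) ler_wpM2l// (le_trans (ler_normB _ _))// lerD.
  exact: le_trans g1 (decay_arith h3 h4 h5).
move=> t; have [p2 px2 q2 qx2] := hsys_l2 hs t; have [k1 k2 k3 k4] := HK t.
have T f g : l2 f -> l2 g -> n2 f <= K -> n2 g <= K -> `|ip f (fun x => x * w x * g x)| <= K * K.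
  move=> hf hg fK gK.
  have mxw : mfun (fun x : R => x * w x) by have [] := mphi.
  apply: (le_trans (ip_le_n2 hf (l2Mb mxw (@xw_le1 R) hg))).
  rewrite ler_pM ?n2_ge0//; apply: le_trans gK; rewrite -[leRHS]mul1r.
  exact: n2Mb mxw (@xw_le1 R) hg.
by apply: (le_trans (ler_normB _ _)); apply: lerD; exact: T.
Qed.

Lemma w_sqr_lower (L z : R) : `|z| <= L -> 1 <= (L + 1) ^+ 2 * w z ^+ 2.
Proof.
move=> zL; rewrite -exprMn exprn_ege1//.
have := wE z; have := w_gt0 z; have := normr_ge0 z; nra.
Qed.

(** [ftc_sup_local] with $r = s^2$ bounds $|f(x)|$ by the local $L^2$ norm divided by $s$, plus $K
    s$; each summand is at most $e/2$. As $s \le 1$, the interval lies in $|z| \le L + 1$, where $w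
    \ge 1/(L+2)$, which explains the factor $(L+2)^2$. *)
Lemma ftc_sup_weighted f g (L K e s x : R) : ftc f g -> n2 g <= K -> 0 < s -> s <= 1 -> 0 <= L ->
  (L + 2) ^+ 2 * W2 f <= s * (e / 2) -> K * s <= e / 2 -> `|x| <= L -> `|f x| <= e.
Proof.
move=> fg gK s0 s1 L0 h1 h2 xL; have [hf hg _] := fg.
have s20 : 0 < s ^+ 2 by rewrite exprn_gt0.
have := ftc_sup_local x fg s20; rewrite sqrtr_sqr (gtr0_norm s0) => h.
have hf2 := l2_wX 2 hf.
have i1 : n2 (fun z => ind x (x + s ^+ 2) z * f z) <= (L + 2) ^+ 2 * W2 f.
  have c0 : 0 <= (L + 2) ^+ 2 by exact: sqr_ge0.
  rewrite -[X in X * W2 f](ger0_norm c0) -n2Z//.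
  apply: n2_le; [by apply: mfunM; [exact: mfun_ind|exact: l2_mfun]|exact: l2Z|move=> z].
  rewrite indE; case: ifPn => [/andP[xz zx]|_]; last by rewrite mul0r normr0.
  have zL : `|z| <= L + 1.
    move: xL; rewrite !ler_norml => /andP[x1 x2]; have : s ^+ 2 <= 1 by rewrite exprn_ile1// ltW.
    by move=> s3; apply/andP; split; lra.
  have := w_sqr_lower zL; rewrite (_ : L + 1 + 1 = L + 2); last by ring.
  move=> h3; rewrite mul1r mulrA normrM [X in _ <= X * _]ger0_norm; last by rewrite mulr_ge0 ?sqr_ge0.
  by rewrite ler_peMl.
have g0 := n2_ge0 g; have f0 := normr_ge0 (f x).
have h4 : `|f x| * s <= e * s.
  have h5 : `|f x| * s ^+ 2 <= s * (s * (e / 2)) + s * K * s ^+ 2.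
    apply: (le_trans h); apply: lerD; last by rewrite ler_wpM2r ?sqr_ge0// ler_wpM2l// ltW.
    by rewrite ler_wpM2l ?(ltW s0)//; exact: le_trans i1 h1.
  have h6 : s * K * s ^+ 2 <= s * s * (e / 2).
    rewrite (_ : s * K * s ^+ 2 = s * s * (K * s)); last by ring.
    by rewrite ler_wpM2l// mulr_ge0// ltW.
  rewrite -(ler_pM2l s0); lra.
by rewrite -(ler_pM2r s0).
Qed.

Lemma locally_uniform_decay (L e : R) : 0 <= L -> 0 < e ->
  \forall t \near +oo, forall x, `|x| <= L -> `|p t x| <= e /\ `|q t x| <= e.
Proof.
move=> L0 e0; have [K K0 HK] := norm_bound.
(* Small enough for $K s \le e/2$; the 1 added to $K$ avoids division by 0. *)
pose s := Num.min 1 (e / (2 * (K + 1))).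
have K1 : 0 < 2 * (K + 1) by lra.
have s0 : 0 < s by rewrite lt_min ltr01 divr_gt0.
have s1 : s <= 1 by rewrite ge_min lexx.
have Ks : K * s <= e / 2.
  have : s <= e / (2 * (K + 1)) by rewrite ge_min lexx orbT.
  rewrite ler_pdivlMr// => h; nra.
have c0 : 0 < (L + 2) ^+ 2 by rewrite exprn_gt0//; lra.
(* The size of the weighted norm that [ftc_sup_weighted] asks for; its square is the tolerance for
   the weighted mass. *)
have d0 : 0 < s * (e / 2) / (L + 2) ^+ 2 by rewrite divr_gt0// mulr_gt0// divr_gt0.
have d20 := exprn_gt0 2 d0.
have /cvgrPdist_le/(_ _ d20) H := weighted_mass_decay.
apply: filterS H => t; rewrite sub0r normrN ger0_norm ?addr_ge0 ?sqr_ge0// => H x xL.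
have [k1 k2 k3 k4] := HK t; have [fp fq] := hsys_ftc hs t.
have T f : W2 f ^+ 2 <= (s * (e / 2) / (L + 2) ^+ 2) ^+ 2 -> (L + 2) ^+ 2 * W2 f <= s * (e / 2).
  by rewrite ler_pXn2r ?nnegrE ?n2_ge0 ?(ltW d0)// ler_pdivlMr// mulrC.
split.
- apply: (ftc_sup_weighted fp k2 s0 s1 L0 _ Ks xL); apply: T.
  by apply: le_trans H; rewrite lerDl sqr_ge0.
- apply: (ftc_sup_weighted fq k4 s0 s1 L0 _ Ks xL); apply: T.
  by apply: le_trans H; rewrite lerDr sqr_ge0.
Qed.
End RealDecay.

(** * Reduction to real and imaginary parts *)

Section ComplexReal.
Context {R : realType}.
Local Open Scope complex_scope.
Local Notation mu := (@lebesgue_measure R).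
Local Notation RR := (measurableTypeR R).
Local Notation Re := complex.Re.
Local Notation Im := complex.Im.
Implicit Types (f g : R -> R[i]) (z : R[i]).

Lemma cabs_sqr z : cabs z ^+ 2 = Re z ^+ 2 + Im z ^+ 2.
Proof. by case: z => x y; rewrite /cabs/= sqr_sqrtr// addr_ge0 ?sqr_ge0. Qed.

Lemma cabs_ge0 z : 0 <= cabs z.
Proof. by case: z => x y; rewrite /cabs/= sqrtr_ge0. Qed.

Lemma Re_le_cabs z : `|Re z| <= cabs z.
Proof.
rewrite -(@ler_pXn2r _ 2)// ?nnegrE ?cabs_ge0// cabs_sqr real_normK ?num_real// lerDl.
exact: sqr_ge0.
Qed.

Lemma Im_le_cabs z : `|Im z| <= cabs z.
Proof.
rewrite -(@ler_pXn2r _ 2)// ?nnegrE ?cabs_ge0// cabs_sqr real_normK ?num_real// lerDr.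
exact: sqr_ge0.
Qed.

Lemma cabs_le z : cabs z <= `|Re z| + `|Im z|.
Proof.
rewrite -(@ler_pXn2r _ 2)// ?nnegrE ?cabs_ge0 ?addr_ge0// cabs_sqr sqrrD.
rewrite !real_normK ?num_real// lerD2r lerDl mulrn_wge0// mulr_ge0//.
Qed.

Lemma Re_mul_real z (r : R) : Re (z * r%:C) = Re z * r.
Proof. by case: z => x y /=; ring. Qed.
Lemma Im_mul_real z (r : R) : Im (z * r%:C) = Im z * r.
Proof. by case: z => x y /=; ring. Qed.

Lemma Rintegral_intg (h : R -> R) : \int[mu]_x h x = intg h.
Proof. by []. Qed.

Lemma cintegralE f : cintegral f = intg (fun x => Re (f x)) +i* intg (fun x => Im (f x)).
Proof. by rewrite /cintegral !Rintegral_intg. Qed.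

Lemma wd_aeq (F f g : R -> R) : wd F g -> mfun f -> l2 F -> aeq f F -> wd f g.
Proof.
move=> [lF lg H] mf hF fF.
have Ff : aeq F f by apply: ae_sub fF => x /= ->.
have hf := aeq_l2 mf Ff hF.
split => //; first exact: l2_locally_integrable.
move=> eta te; rewrite -H//; have te' := test_l2 (test_derive1 te).
apply: aeq_intg; [by apply: mfunM => //; exact: l2_mfun|by apply: mfunM; exact: l2_mfun|].
by apply: ae_sub fF => x /= ->.
Qed.

(** Test functions are real, so the identity separates into real and imaginary parts. *)
Lemma weak_derivativeP f g : weak_derivative f g <->
  wd (fun x => Re (f x)) (fun x => Re (g x)) /\ wd (fun x => Im (f x)) (fun x => Im (g x)).
Proof.
have E (h : R -> R[i]) (e : R -> R) : cintegral (fun x => h x * (e x)%:C) =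
    intg (fun x => Re (h x) * e x) +i* intg (fun x => Im (h x) * e x).
  rewrite cintegralE; congr (_ +i* _); congr intg; apply/funext => x; [exact: Re_mul_real|exact: Im_mul_real].
split=> [[[f1 f2] [g1 g2] H]|[[f1 g1 H1] [f2 g2 H2]]].
  by split; split => // eta te; have := H eta te; rewrite !E => -[].
by split => // eta te; rewrite !E H1// H2.
Qed.

Lemma L2_integral f : (\int[mu]_x (`|(EFin \o ((cabs \o f) \_ [set: R])) x| `^ 2%R) =
  \int[mu]_x (Re (f x) ^+ 2 + Im (f x) ^+ 2)%:E)%E.
Proof.
apply: eq_integral => x _ /=; rewrite patchE mem_setT -cabs_sqr.
by rewrite ger0_norm ?cabs_ge0// -powR_mulrn ?cabs_ge0.
Qed.

Lemma L2P f : L2 f <-> l2 (fun x => Re (f x)) /\ l2 (fun x => Im (f x)).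
Proof.
split=> [[[m1 m2] N]|[h1 h2]].
  have S : L1 (fun x => Re (f x) ^+ 2 + Im (f x) ^+ 2).
    apply: L1P; first by apply: mfunD; exact: mfunX.
    under eq_integral => x _ do rewrite ger0_norm ?addr_ge0 ?sqr_ge0//.
    rewrite -L2_integral -poweR_Lnorm//; exact: poweR_lty.
  split; (split; [by []|apply: (L1_le _ _ S); [exact: mfunX|move=> x]]).
    by rewrite ger0_norm ?sqr_ge0// lerDl sqr_ge0.
  by rewrite ger0_norm ?sqr_ge0// lerDr sqr_ge0.
split; first by split; exact: l2_mfun.
rewrite /Lnorm_on unlock /Lnorm L2_integral.
have S := L1D (l2_sq h1) (l2_sq h2).
by rewrite (intgE S); apply: poweR_lty; rewrite ltry.
Qed.

(** [weakD] is an arbitrary choice, identified only almost everywhere through [wd_unique]; this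
    transfers norms and weak derivatives to representatives on which the calculus is available. *)
Lemma H1_rep f (P Px Q Qx : R -> R) : mfun (fun x => Re (f x)) -> mfun (fun x => Im (f x)) ->
  aeq (fun x => Re (f x)) P -> aeq (fun x => Im (f x)) Q -> sd P Px -> sd Q Qx ->
  [/\ H1 f, H1norm f = (Num.sqrt (n2 P ^+ 2 + n2 Q ^+ 2 + (n2 Px ^+ 2 + n2 Qx ^+ 2)))%:E,
    mfun (fun x => Re (weakD f x)) /\ aeq (fun x => Re (weakD f x)) Px &
    mfun (fun x => Im (weakD f x)) /\ aeq (fun x => Im (weakD f x)) Qx].
Proof.
move=> mr mi fP fQ sP sQ; have [hP hPx _] := sP; have [hQ hQx _] := sQ.
have wf : weak_derivative f (fun x => Px x +i* Qx x).
  by apply/weak_derivativeP; split; [exact: wd_aeq (sd_wd sP) mr hP fP|exact: wd_aeq (sd_wd sQ) mi hQ fQ].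
have sym (h k : R -> R) : aeq h k -> aeq k h by move=> hk; apply: ae_sub hk => x /= ->.
have lr := aeq_l2 mr (sym _ _ fP) hP; have li := aeq_l2 mi (sym _ _ fQ) hQ.
have wD : weak_derivative f (weakD f) by apply: xgetPex; exists (fun x => Px x +i* Qx x).
have /weak_derivativeP[wr wi] := wD; have /weak_derivativeP[wr' wi'] := wf.
have er := wd_unique wr wr'; have ei := wd_unique wi wi'; rewrite /= in er ei.
have mdr : mfun (fun x => Re (weakD f x)) by have [_ []] := wr.
have mdi : mfun (fun x => Im (weakD f x)) by have [_ []] := wi.
have ldr := aeq_l2 mdr (sym _ _ er) hPx; have ldi := aeq_l2 mdi (sym _ _ ei) hQx.
split => //.
  split; first exact/L2P.
  by exists (fun x => Px x +i* Qx x) => //; apply/L2P.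
rewrite /H1norm.
have S1 := L1D (l2_sq lr) (l2_sq li); have S2 := L1D (l2_sq ldr) (l2_sq ldi).
have -> : (\int[mu]_x (cabs (f x) ^+ 2 + cabs (weakD f x) ^+ 2)%:E)%E =
   (n2 P ^+ 2 + n2 Q ^+ 2 + (n2 Px ^+ 2 + n2 Qx ^+ 2))%:E.
  under eq_integral => x _ do rewrite !cabs_sqr.
  rewrite (intgE (L1D S1 S2)) intgD// !intgD//; try exact: l2_sq.
  by rewrite -!n2E' (aeq_n2 mr (l2_mfun hP) fP) (aeq_n2 mi (l2_mfun hQ) fQ)
    (aeq_n2 mdr (l2_mfun hPx) er) (aeq_n2 mdi (l2_mfun hQx) ei).
by rewrite poweR_EFin powR12_sqrt// !addr_ge0 ?sqr_ge0.
Qed.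

Lemma H1_ftc f : H1 f -> exists P Px Q Qx, [/\ ftc P Px, ftc Q Qx,
  (mfun (fun x => Re (f x)) /\ aeq (fun x => Re (f x)) P) &
  (mfun (fun x => Im (f x)) /\ aeq (fun x => Im (f x)) Q)].
Proof.
move=> [/L2P[lr li] [g /weak_derivativeP[wr wi] /L2P[gr gi]]].
have [P fP eP] := wd_ftc wr lr gr; have [Q fQ eQ] := wd_ftc wi li gi.
exists P, (fun x => Re (g x)), Q, (fun x => Im (g x)).
by split => //; split => //; exact: l2_mfun.
Qed.

(** The potential depends on the class only, and a bounded integrable density allows the two parts
    of the split kernel to be recombined. *)
Lemma hartreeE (a : R) f (P Px Q Qx : R -> R) x : 0 < a -> a < 1 ->
  mfun (fun x => Re (f x)) -> mfun (fun x => Im (f x)) ->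
  aeq (fun x => Re (f x)) P -> aeq (fun x => Im (f x)) Q -> ftc P Px -> ftc Q Qx ->
  hartree_potential a f x = rpot a (msq P Q) x.
Proof.
move=> a0 a1 mr mi eP eQ fP fQ; have [m1 [C mC]] := msq_L1 fP fQ.
have mC' y : `|msq P Q y| <= C by have /andP[h1 h2] := mC y; rewrite ger0_norm.
rewrite (rpotE a0 a1 x m1 mC') /hartree_potential Rintegral_intg.
have mk : mfun (fun y => riesz a (x - y)) by exact: mfun_refl (mfun_riesz a).
apply: aeq_intg.
- under eq_fun do rewrite cabs_sqr.
  by apply: mfunM; [exact: mk|apply: mfunD; exact: mfunX].
- by apply: mfunM; [exact: mk|exact: L1_mfun].
by apply: ae_sub (ae_and eP eQ) => y /= [h1 h2]; rewrite cabs_sqr h1 h2.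
Qed.

Lemma aeq_refl (f1 : R -> R) : aeq f1 f1. Proof. exact: aeW. Qed.

Lemma ae_ex_itv (P : R -> Prop) (r : R) : 0 < r -> {ae mu, forall x : RR, P x} ->
  exists x, 0 <= x <= r /\ P x.
Proof.
move=> r0 aP; apply: contrapT => nP.
have : intg (ind 0 r) = intg (fun=> 0 : R).
  apply: aeq_intg; [exact: mfun_ind|exact: mfun_cst|].
  apply: ae_sub aP => x /= Px; rewrite indE; case: ifPn => // xr.
  by exfalso; apply: nP; exists x.
by rewrite intg0 intg_ind ?ltW// subr0 => r0'; move: r0; rewrite r0' ltxx.
Qed.

(** $P$ is only known to agree with $f_0$ almost everywhere, so $P(-x) = -P(x)$ is obtained at some
    arbitrarily small $x \ge 0$, and Hölder continuity carries it to 0. *)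
Lemma odd_rep0 (f0 P Px : R -> R) : (forall x : R, f0 (- x) = - f0 x) -> aeq f0 P -> ftc P Px -> P 0 = 0.
Proof.
move=> od fP ft; have [hP _ _] := ft.
have e2 : aeq (fun x => f0 (- x)) (fun x => P (- x)) by exact: (negligible_opp fP).
apply/eqP; rewrite -normr_le0; apply/ler_addgt0Pr => e e0; rewrite add0r.
pose K := n2 Px + 1; have K0 : 0 < K by rewrite ltr_wpDl ?n2_ge0.
pose r := (e / K) ^+ 2; have r0 : 0 < r by rewrite exprn_gt0// divr_gt0.
have [x [/andP[x0 xr] [h1 h2]]] := ae_ex_itv r0 (ae_and fP e2).
have h3 := ftc_holder2 ft x0; rewrite subr0 in h3.
have nx : - x <= 0 by rewrite oppr_le0.
have h4 := ftc_holder2 ft nx; rewrite sub0r opprK in h4.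
have h5 : P (- x) = - P x by rewrite -h1 -h2 od.
have sx : Num.sqrt x <= e / K.
  have -> : e / K = Num.sqrt r by rewrite sqrtr_sqr ger0_norm// divr_ge0// ltW.
  exact: ler_wsqrtr.
have h6 : Num.sqrt x * n2 Px <= e.
  have : Num.sqrt x * n2 Px <= e / K * K by rewrite ler_pM ?sqrtr_ge0 ?n2_ge0// lerDl.
  by rewrite divfK// gt_eqF.
(* Both brackets are increments over an interval of length $x$, each at most $e$. *)
have -> : P 0 = 2^-1 * ((P 0 - P (- x)) - (P x - P 0)) by rewrite h5; field.
rewrite normrM ger0_norm; last by rewrite invr_ge0.
have := ler_normB (P 0 - P (- x)) (P x - P 0); lra.
Qed.
End ComplexReal.

(** * From the complex equation to the real system *)

Section Reduction.
Context {R : realType}.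
Local Open Scope complex_scope.
Local Notation Re := complex.Re.
Local Notation Im := complex.Im.
Context (a : R) (a0 : 0 < a) (a1 : a < 1) (u : R -> R -> R[i]) (hu : global_odd_H1_solution a u).
Context (p px q qx : R -> R -> R).
Context (fp : forall t, ftc (p t) (px t)) (fq : forall t, ftc (q t) (qx t)).
Context (mr : forall t, mfun (fun x => Re (u t x))) (mi : forall t, mfun (fun x => Im (u t x))).
Context (ep : forall t, aeq (fun x => Re (u t x)) (p t)) (eq : forall t, aeq (fun x => Im (u t x)) (q t)).
Implicit Types (t h : R) (c cx : R -> R).

Local Notation V t := (rpot a (msq (p t) (q t))).

Lemma Re_real_mul (r : R) (z : R[i]) : Re (r%:C * z) = r * Re z.
Proof. by rewrite mulrC Re_mul_real mulrC. Qed.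
Lemma Im_real_mul (r : R) (z : R[i]) : Im (r%:C * z) = r * Im z.
Proof. by rewrite mulrC Im_mul_real mulrC. Qed.

Lemma aeqB (f1 f2 g1 g2 : R -> R) : aeq f1 f2 -> aeq g1 g2 -> aeq (fun x => f1 x - g1 x) (fun x => f2 x - g2 x).
Proof. by move=> h1 h2; apply: ae_sub (ae_and h1 h2) => x /= [-> ->]. Qed.

(** The $H^1$ norm of $u(s) - u(t)$ is a function of four $L^2$ norms of differences of
    representatives and dominates each of them. *)
Lemma solution_continuous t : cvH (nbhs t) p px (p t) (px t) /\ cvH (nbhs t) q qx (q t) (qx t).
Proof.
have [[_ cu] _ _] := hu.
have l2t s : [/\ l2 (p s), l2 (px s), l2 (q s) & l2 (qx s)].
  by have [? ? _] := fp s; have [? ? _] := fq s.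
pose N s := Num.sqrt (n2 (fun x => p s x - p t x) ^+ 2 + n2 (fun x => q s x - q t x) ^+ 2 +
   (n2 (fun x => px s x - px t x) ^+ 2 + n2 (fun x => qx s x - qx t x) ^+ 2)).
have HN s : H1norm (fun x => u s x - u t x) = (N s)%:E.
  have E1 : (fun x => Re (u s x - u t x)) = (fun x => Re (u s x) - Re (u t x)).
    by apply/funext => x; case: (u s x) (u t x) => [? ?] [? ?].
  have E2 : (fun x => Im (u s x - u t x)) = (fun x => Im (u s x) - Im (u t x)).
    by apply/funext => x; case: (u s x) (u t x) => [? ?] [? ?].
  have m1 : mfun (fun x => Re (u s x - u t x)) by rewrite E1; exact: mfunB.
  have m2 : mfun (fun x => Im (u s x - u t x)) by rewrite E2; exact: mfunB.
  have e1 : aeq (fun x => Re (u s x - u t x)) (fun x => p s x - p t x) by rewrite E1; exact: aeqB.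
  have e2 : aeq (fun x => Im (u s x - u t x)) (fun x => q s x - q t x) by rewrite E2; exact: aeqB.
  by have [_ H _ _] := H1_rep m1 m2 e1 e2 (ftc_sd (ftcB (fp s) (fp t))) (ftc_sd (ftcB (fq s) (fq t))).
have N0 : N s @[s --> t] --> (0 : R).
  have := cu t; have -> : (fun s => H1norm (fun x => u s x - u t x)) = (fun s => (N s)%:E).
    by apply/funext => s; exact: HN.
  by move=> /fine_cvgP[_].
have sq0 (s : R) := sqr_ge0 s.
have B (F : R -> R) : (forall s, 0 <= F s) -> (forall s, F s ^+ 2 <= N s ^+ 2) -> F s @[s --> t] --> (0 : R).
  move=> F0 FN; apply: (squeeze0 _ N0) => s; rewrite F0/=.
  have Ns : 0 <= N s by exact: sqrtr_ge0.
  by rewrite -(@ler_pXn2r _ 2) ?nnegrE.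
have NE s : N s ^+ 2 = n2 (fun x => p s x - p t x) ^+ 2 + n2 (fun x => q s x - q t x) ^+ 2 +
   (n2 (fun x => px s x - px t x) ^+ 2 + n2 (fun x => qx s x - qx t x) ^+ 2).
  by rewrite sqr_sqrtr// !addr_ge0 ?sqr_ge0.
have [p2 px2 q2 qx2] := l2t t.
split; split => //; (split; [by move=> s; have [? ? ? ?] := l2t s|by []|apply: B => s; first exact: n2_ge0]);
  rewrite NE; move: (sq0 (n2 (fun x => p s x - p t x))) (sq0 (n2 (fun x => q s x - q t x)))
   (sq0 (n2 (fun x => px s x - px t x))) (sq0 (n2 (fun x => qx s x - qx t x)));
  move: (n2 _ ^+ 2) (n2 _ ^+ 2) (n2 _ ^+ 2) (n2 _ ^+ 2) => A1 A2 A3 A4; lra.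
Qed.

Lemma V_l2 t c : l2 c -> l2 (fun x => V t x * c x).
Proof.
by move=> hc; have [mV _ [C HC] _ _] := mult_rpot a0 a1 (fp t) (fq t); exact: l2Mb mV HC hc.
Qed.

Lemma V_continuous t (f g : R -> R -> R) : cvH (nbhs t) f g (f t) (g t) ->
  cv2 (nbhs t) (fun s x => V s x * f s x) (fun x => V t x * f t x).
Proof.
move=> hf; have [hp hq] := solution_continuous t; have [_ _ f2 _] := hf.
have [c1 cU _ _] := msq_nets hp hq.
by apply: cvU_cv2 => //; exact: cvU_rpot.
Qed.

Lemma test_rep c cx : sd c cx -> [/\ H1 (fun x => (c x)%:C),
   H1norm (fun x => (c x)%:C) = (Num.sqrt (n2 c ^+ 2 + n2 cx ^+ 2))%:E,
   mfun (fun x => Re (weakD (fun x => (c x)%:C) x)) /\ aeq (fun x => Re (weakD (fun x => (c x)%:C) x)) cx &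
   mfun (fun x => Im (weakD (fun x => (c x)%:C) x)) /\ aeq (fun x => Im (weakD (fun x => (c x)%:C) x)) (fun=> 0)].
Proof.
move=> sc; have [hc hcx _] := sc.
have s0 : sd (fun=> 0) (fun=> 0 : R) by have := sdB sc sc; under eq_fun do rewrite subrr; under [X in sd _ X]eq_fun do rewrite subrr.
have [] := @H1_rep R (fun x => (c x)%:C) _ _ _ _ (l2_mfun hc) (mfun_cst 0) (aeq_refl c) (aeq_refl _) sc s0.
by rewrite !n2_0 expr0n/= !addr0.
Qed.

(** Solving the equation for $u_t$ means dividing by $i$, which exchanges the real and imaginary
    components. Only real test functions are paired, so the two components do not mix further. *)
Lemma time_derivative_test t ut c cx : (forall phi, H1 phi ->
      'i%C * ut phi + Hm1_dxx (u t) phi =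
      Hm1_of (fun x => (hartree_potential a (u t) x)%:C * u t x) phi) -> sd c cx ->
  ut (fun x => (c x)%:C) = (ip (qx t) cx + ip (fun x => V t x * q t x) c) +i*
     (ip (fun x => - px t x) cx + ip (fun x => - (V t x * p t x)) c).
Proof.
move=> H sc; have [h1 _ [mcr ecr] [mci eci]] := test_rep sc; have [hc hcx _] := sc.
have [_ hpx _] := fp t; have [_ hqx _] := fq t; have [hp _ _] := fp t; have [hq _ _] := fq t.
have [_ _ [mdr edr] [mdi edi]] := H1_rep (mr t) (mi t) (ep t) (eq t) (ftc_sd (fp t)) (ftc_sd (fq t)).
have := H _ h1.
have -> : Hm1_dxx (u t) (fun x => (c x)%:C) = - (ip (px t) cx +i* ip (qx t) cx).
  rewrite /Hm1_dxx cintegralE; congr (- (_ +i* _)); apply: aeq_intg.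
  - have -> : (fun x => Re (weakD (u t) x * weakD (fun x => (c x)%:C) x)) =
      (fun x => Re (weakD (u t) x) * Re (weakD (fun x => (c x)%:C) x) - Im (weakD (u t) x) * Im (weakD (fun x => (c x)%:C) x)).
      by apply/funext => x; case: (weakD _ x) (weakD _ x) => [? ?] [? ?].
    by apply: mfunB; exact: mfunM.
  - by apply: mfunM; exact: l2_mfun.
  - apply: ae_sub (ae_and (ae_and edr edi) (ae_and ecr eci)) => x /= [[e1 e2] [e3 e4]].
    rewrite -e1 -e3; move: e4; case: (weakD (u t) x) => ? ?; case: (weakD _ x) => ? ? /= ->.
    by rewrite mulr0 subr0.
  - have -> : (fun x => Im (weakD (u t) x * weakD (fun x => (c x)%:C) x)) =
      (fun x => Re (weakD (u t) x) * Im (weakD (fun x => (c x)%:C) x) + Im (weakD (u t) x) * Re (weakD (fun x => (c x)%:C) x)).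
      by apply/funext => x; case: (weakD _ x) (weakD _ x) => [? ?] [? ?].
    by apply: mfunD; exact: mfunM.
  - by apply: mfunM; exact: l2_mfun.
  - apply: ae_sub (ae_and (ae_and edr edi) (ae_and ecr eci)) => x /= [[e1 e2] [e3 e4]].
    rewrite -e2 -e3; move: e4; case: (weakD (u t) x) => ? ?; case: (weakD _ x) => ? ? /= ->.
    by rewrite mulr0 add0r.
have hV x := hartreeE x a0 a1 (mr t) (mi t) (ep t) (eq t) (fp t) (fq t).
have mV : mfun (V t) by have [] := mult_rpot a0 a1 (fp t) (fq t).
have -> : Hm1_of (fun x => (hartree_potential a (u t) x)%:C * u t x) (fun x => (c x)%:C) =
   ip (fun x => V t x * p t x) c +i* ip (fun x => V t x * q t x) c.
  rewrite /Hm1_of cintegralE.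
  have -> : (fun x => Re ((hartree_potential a (u t) x)%:C * u t x * (c x)%:C)) = (fun x => V t x * Re (u t x) * c x).
    by apply/funext => x; rewrite Re_mul_real Re_real_mul hV.
  have -> : (fun x => Im ((hartree_potential a (u t) x)%:C * u t x * (c x)%:C)) = (fun x => V t x * Im (u t x) * c x).
    by apply/funext => x; rewrite Im_mul_real Im_real_mul hV.
  congr (_ +i* _); apply: aeq_intg.
  - by apply: mfunM; [exact: mfunM|exact: l2_mfun].
  - by apply: mfunM; [apply: mfunM => //; exact: l2_mfun|exact: l2_mfun].
  - by apply: ae_sub (ep t) => x /= ->.
  - by apply: mfunM; [exact: mfunM|exact: l2_mfun].
  - by apply: mfunM; [apply: mfunM => //; exact: l2_mfun|exact: l2_mfun].
  - by apply: ae_sub (eq t) => x /= ->.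
rewrite !ipNl//; try exact: V_l2.
move: (ip _ _) (ip _ _) (ip _ _) (ip _ _) => A1 A2 A3 A4.
case: (ut _) => A B; rewrite -[X in X * _]complexiE => -[E1 E2].
by congr (_ +i* _); lra.
Qed.

(** The $H^{-1}$ norm is a supremum over a unit ball while [evol] asks for a bound linear in the
    norm; homogeneity links them. *)
Lemma scale_bound (F A B : R -> R) (e : R) : l2 F -> l2 A -> l2 B -> 0 <= e ->
  (forall c cx, sd c cx -> n2 c + n2 cx <= 1 -> `|ip F c - (ip A cx + ip B c)| <= e) ->
  forall c cx, sd c cx -> `|ip F c - (ip A cx + ip B c)| <= e * (n2 c + n2 cx).
Proof.
move=> hF hA hB e0 H c cx sc; have [hc hcx _] := sc.
have c0 := n2_ge0 c; have cx0 := n2_ge0 cx.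
(* A test function of zero norm cannot be normalised; there both sides vanish. *)
have [N0|N0] := leP (n2 c + n2 cx) 0.
  have z1 : n2 c = 0 by lra. have z2 : n2 cx = 0 by lra.
  have Z (f g : R -> R) : l2 f -> l2 g -> n2 g = 0 -> ip f g = 0.
    by move=> hf hg g0; apply/eqP; rewrite -normr_le0 (le_trans (ip_le_n2 hf hg))// g0 mulr0.
  by rewrite !Z// addr0 subr0 normr0 z1 z2 addr0 mulr0.
set k := n2 c + n2 cx in N0 *.
have k0 : 0 <= k^-1 by rewrite invr_ge0 ltW.
have := H _ _ (sdZ k^-1 sc); rewrite !n2Z// !ipZr// (ger0_norm k0) -mulrDr -/k mulVf ?gt_eqF// lexx => /(_ isT).
rewrite -mulrDr -mulrBr normrM (ger0_norm k0) mulrC ler_pdivrMr//.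
Qed.

Lemma solution_evol : hsys a p px q qx.
Proof.
have [_ eqn _] := hu.
have key t e : 0 < e -> exists2 d : R, 0 < d & forall h : R, `|h| < d ->
    forall f g, sd f g -> `|ip (fun x => p (t + h) x - p t x) f -
      h * (ip (qx t) g + ip (fun x => V t x * q t x) f)| <= e * `|h| * (n2 f + n2 g) /\
      `|ip (fun x => q (t + h) x - q t x) f -
      h * (ip (fun x => - px t x) g + ip (fun x => - (V t x * p t x)) f)| <= e * `|h| * (n2 f + n2 g).
  move=> e0; have [ut [_ Hut] E] := eqn t.
  have : \forall h \near (0 : R)^', (Hm1norm (fun phi =>
    Hm1_of (fun x => (h^-1)%:C * (u (t + h) x - u t x)) phi - ut phi)%R < e%:E)%E.
    have nb : nbhs (0%E : \bar R) [set y | (y < e%:E)%E].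
      by apply: open_nbhs_nbhs; split; [exact: open_ereal_lt_ereal|rewrite /= lte_fin].
    exact: (Hut _ nb).
  move=> /nbhs_ballP[d /= d0 Hd]; exists d => // h hd.
  have [hp _ _] := fp t; have [hp' _ _] := fp (t + h); have [hq _ _] := fq t; have [hq' _ _] := fq (t + h).
  have [_ hpx _] := fp t; have [_ hqx _] := fq t.
  (* The limit is over punctured neighbourhoods and says nothing at $h = 0$, where the estimate is
     $0 \le 0$. *)
  have [->|h0] := eqVneq h 0.
    move=> f g _; rewrite normr0 addr0 !mul0r mulr0 mul0r !subr0.
    have Z (k c : R -> R) : ip (fun x => k x - k x) c = 0.
      by rewrite /ip -[RHS](@intg0 R); congr intg; apply/funext => x; ring.
    by rewrite !Z normr0.
  have Hh : (Hm1norm (fun phi => Hm1_of (fun x => (h^-1)%:C * (u (t + h) x - u t x)) phi - ut phi)%R < e%:E)%E.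
    by apply: Hd => //=; rewrite /ball/= sub0r normrN.
  pose F := fun x => h^-1 * (p (t + h) x - p t x); pose G := fun x => h^-1 * (q (t + h) x - q t x).
  have hF : l2 F by apply: l2Z; exact: l2B. have hG : l2 G by apply: l2Z; exact: l2B.
  have main c cx : sd c cx -> n2 c + n2 cx <= 1 ->
     `|ip F c - (ip (qx t) cx + ip (fun x => V t x * q t x) c)| <= e /\
     `|ip G c - (ip (fun x => - px t x) cx + ip (fun x => - (V t x * p t x)) c)| <= e.
    move=> sc nc; have [h1 nE _ _] := test_rep sc; have [hc hcx _] := sc.
    have c0 := n2_ge0 c; have cx0 := n2_ge0 cx.
    (* The $H^1$ norm is the root of a sum of squares, hence at most the sum of the norms. *)
    have n1 : (H1norm (fun x => (c x)%:C) <= 1)%E.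
      rewrite nE lee_fin -(@ler_pXn2r _ 2)// ?nnegrE ?sqrtr_ge0// sqr_sqrtr ?addr_ge0 ?sqr_ge0//.
      nra.
    have cT : ((cabs (Hm1_of (fun x => (h^-1)%:C * (u (t + h) x - u t x)) (fun x => (c x)%:C) - ut (fun x => (c x)%:C)))%:E < e%:E)%E.
      by apply: le_lt_trans Hh; apply: ereal_sup_ubound; exists (fun x => (c x)%:C).
    rewrite lte_fin (time_derivative_test E sc) in cT.
    have TE : Hm1_of (fun x => (h^-1)%:C * (u (t + h) x - u t x)) (fun x => (c x)%:C) = ip F c +i* ip G c.
      rewrite /Hm1_of cintegralE.
      have -> : (fun x => Re ((h^-1)%:C * (u (t + h) x - u t x) * (c x)%:C)) =
         (fun x => h^-1 * (Re (u (t + h) x) - Re (u t x)) * c x).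
        by apply/funext => x; rewrite Re_mul_real Re_real_mul; case: (u (t + h) x) (u t x) => [? ?] [? ?].
      have -> : (fun x => Im ((h^-1)%:C * (u (t + h) x - u t x) * (c x)%:C)) =
         (fun x => h^-1 * (Im (u (t + h) x) - Im (u t x)) * c x).
        by apply/funext => x; rewrite Im_mul_real Im_real_mul; case: (u (t + h) x) (u t x) => [? ?] [? ?].
      congr (_ +i* _); apply: aeq_intg.
      - by apply: mfunM; [apply: mfunM; [exact: mfun_cst|exact: mfunB]|exact: l2_mfun].
      - by apply: mfunM; exact: l2_mfun.
      - by apply: ae_sub (ae_and (ep t) (ep (t + h))) => x /= [-> ->].
      - by apply: mfunM; [apply: mfunM; [exact: mfun_cst|exact: mfunB]|exact: l2_mfun].
      - by apply: mfunM; exact: l2_mfun.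
      - by apply: ae_sub (ae_and (eq t) (eq (t + h))) => x /= [-> ->].
    rewrite TE in cT.
    by split; [apply: le_trans (ltW cT); apply: (le_trans _ (Re_le_cabs _))|
      apply: le_trans (ltW cT); apply: (le_trans _ (Im_le_cabs _))].
  have hVq := V_l2 t hq; have hVp := V_l2 t hp.
  have S1 := scale_bound hF hqx hVq (ltW e0) (fun c cx sc nc => (main c cx sc nc).1).
  have S2 := scale_bound hG (l2N hpx) (l2N hVp) (ltW e0) (fun c cx sc nc => (main c cx sc nc).2).
  have hn : 0 < `|h| by rewrite normr_gt0.
  move=> f g sf; have [hf hg _] := sf.
  have := S1 _ _ sf; have := S2 _ _ sf; rewrite /F /G !ipZl//; try exact: l2B.
  move: (ip (fun x => p (t + h) x - _) f) (ip (fun x => q (t + h) x - _) f) => D1 D2.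
  move: (ip (qx t) g + _) (ip (fun x => - px t x) g + _) => L1' L2' B2 B1.
  have M (D L N : R) : `|h^-1 * D - L| <= e * N -> `|D - h * L| <= e * `|h| * N.
    move=> b; have -> : D - h * L = h * (h^-1 * D - L) by field.
    by rewrite normrM -mulrA mulrCA ler_wpM2l.
  by split; exact: M.
split; split.
- by move=> t; have [] := solution_continuous t.
- by move=> t; have [_ [_ _ _ ?]] := solution_continuous t.
- by move=> t; exact: V_continuous (solution_continuous t).2.
- by move=> t e e0; have [d d0 H] := key t e e0; exists d => // h hd f g sf; have [] := H h hd f g sf.
- by move=> t; have [] := solution_continuous t.
- by move=> t; apply: cv2N; have [[_ _ _ ?] _] := solution_continuous t.
- by move=> t; apply: cv2N; exact: V_continuous (solution_continuous t).1.
- by move=> t e e0; have [d d0 H] := key t e e0; exists d => // h hd f g sf; have [] := H h hd f g sf.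
Qed.

Lemma solution_vanish0 t : p t 0 = 0 /\ q t 0 = 0.
Proof.
have [_ _ od] := hu; split.
  by apply: odd_rep0 (ep t) (fp t) => x; rewrite od; case: (u t x).
by apply: odd_rep0 (eq t) (fq t) => x; rewrite od; case: (u t x).
Qed.
End Reduction.

(** Both norms are compared with those of $e$ times the indicator of $[-L, L]$, whose $L^2$ norm is
    $\sqrt{2L}\,e$. *)
Lemma Lnorm_bound {R : realType} (I : set R) (f : R -> R[i]) (L e : R) :
  measurable I -> I `<=` [set x | `|x| <= L] -> 0 <= L -> 0 <= e ->
  (\forall x \ae (@lebesgue_measure R), I x -> cabs (f x) <= e) ->
  cmeasurable f ->
  (Lnorm_on 2%:E I f + Lnorm_on +oo I f <= (Num.sqrt (2 * L) * e + e)%:E)%E.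
Proof.
move=> mI IL L0 e0 H [mr mi].
have b : \forall x \ae (@lebesgue_measure R), ((cabs \o f) \_ I) x <= e * ind (- L) L x.
  apply: ae_sub H => x /= h; rewrite patchE indE; case: ifPn => [/set_mem Ix|_].
    by have := IL _ Ix; rewrite /= ler_norml => ->; rewrite mulr1 h.
  by rewrite mulr_ge0//; case: ifP.
have g0 x : 0 <= ((cabs \o f) \_ I) x.
  by rewrite patchE; case: ifPn => // _; exact: cabs_ge0.
have mg : mfun ((cabs \o f) \_ I).
  have mc : mfun (cabs \o f).
    have -> : cabs \o f = (fun x => Num.sqrt (complex.Re (f x) ^+ 2 + complex.Im (f x) ^+ 2)).
      by apply/funext => x /=; rewrite -cabs_sqr sqrtr_sqr ger0_norm ?cabs_ge0.
    apply: (@mfun_comp _ Num.sqrt); last by apply: mfunD; exact: mfunX.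
    by apply: continuous_measurable_fun; exact: sqrt_continuous.
  have -> : (cabs \o f) \_ I = (fun x => \1_I x * (cabs \o f) x).
    by apply/funext => x; rewrite patchE indicE; case: ifPn => _; rewrite ?mul1r ?mul0r.
  by apply: mfunM => //; exact: measurable_indic.
rewrite /Lnorm_on; move: ((cabs \o f) \_ I) b g0 mg => g b g0 mg.
have indE1 (x : R) : 0 <= e * ind (- L) L x <= e.
  by have /andP[i0 i1] := ind01 (- L) L x; rewrite mulr_ge0//= -[leRHS]mulr1 ler_wpM2l.
rewrite [X in (_ <= X)%E]EFinD; apply: leeD.
  rewrite unlock /Lnorm.
  have -> : (Num.sqrt (2 * L) * e)%:E = ((e ^+ 2 * (2 * L))%:E `^ 2^-1)%E.
    rewrite poweR_EFin powR12_sqrt ?mulr_ge0 ?sqr_ge0//.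
    by rewrite [in RHS]sqrtrM ?sqr_ge0// sqrtr_sqr ger0_norm// mulrC.
  apply: gt0_ler_poweR; rewrite ?in_itv/= ?leey ?andbT ?invr_ge0//.
  - by apply: integral_ge0 => x _; rewrite lee_fin powR_ge0.
  - by rewrite lee_fin !mulr_ge0.
  have L1i := L1Z (e ^+ 2) (L1_ind (- L) L).
  have -> : (e ^+ 2 * (2 * L))%:E = (\int[lebesgue_measure]_x (e ^+ 2 * ind (- L) L x)%:E)%E.
    by rewrite (intgE L1i) intgZ ?intg_ind//; [congr ((_ * _)%:E); ring|lra|exact: L1_ind].
  under eq_integral => x _ do rewrite ger0_norm ?g0// powR_mulrn ?g0//.
  apply: ae_ge0_le_integral => //.
  - by move=> x _; rewrite lee_fin sqr_ge0.
  - by apply/measurable_EFinP; exact: mfunX.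
  - by move=> x _; rewrite lee_fin mulr_ge0 ?sqr_ge0//; have /andP[] := ind01 (- L) L x.
  - by apply/measurable_EFinP; exact: L1_mfun L1i.
  apply: ae_sub b => x /= gx _; rewrite lee_fin.
  have -> : e ^+ 2 * ind (- L) L x = (e * ind (- L) L x) ^+ 2 by rewrite exprMn [ind _ _ _ ^+ 2]expr2 ind_sq.
  by rewrite ler_pXn2r// nnegrE; have /andP[] := indE1 x.
(* The sup norm is 0 by default over a space of measure 0, which is the second case. *)
rewrite unlock /Lnorm; case: ifPn => [_|_]; last by rewrite lee_fin.
apply/ess_supP; apply: ae_sub b => x /= gx; rewrite lee_fin ger0_norm//.
by apply: (le_trans gx); have /andP[] := indE1 x.
Qed.

Theorem theorem1p4 (R : realType) (a : R) (ha0 : 0 < a) (ha1 : a < 1)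
    (u : R -> R -> R[i]) (hu : global_odd_H1_solution a u)
    (I : set R) (hI : is_interval I) (bI : bounded_set I) :
  (Lnorm_on 2%:E I (u t) + Lnorm_on +oo I (u t))%E @[t --> +oo] --> 0%E.
Proof.
have [[hH1 _] _ _] := hu.
have ex t : exists P : (R -> R) * (R -> R) * ((R -> R) * (R -> R)),
    [/\ ftc P.1.1 P.1.2, ftc P.2.1 P.2.2,
     mfun (fun x => complex.Re (u t x)) /\ aeq (fun x => complex.Re (u t x)) P.1.1 &
     mfun (fun x => complex.Im (u t x)) /\ aeq (fun x => complex.Im (u t x)) P.2.1].
  by have [P [Px [Q [Qx H]]]] := H1_ftc (hH1 t); exists ((P, Px), (Q, Qx)).
(* Representatives are chosen separately at each time; their continuity in time is recovered from
   that of the classes. *)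
have [r Hr] := choice ex.
have fp t : ftc (r t).1.1 (r t).1.2 by have [] := Hr t.
have fq t : ftc (r t).2.1 (r t).2.2 by have [] := Hr t.
have mr t : mfun (fun x => complex.Re (u t x)) by have [_ _ []] := Hr t.
have mi t : mfun (fun x => complex.Im (u t x)) by have [_ _ _ []] := Hr t.
have ep t : aeq (fun x => complex.Re (u t x)) (r t).1.1 by have [_ _ []] := Hr t.
have eq t : aeq (fun x => complex.Im (u t x)) (r t).2.1 by have [_ _ _ []] := Hr t.
have hs := solution_evol ha0 ha1 hu fp fq mr mi ep eq.
have z0 t := solution_vanish0 hu fp fq ep eq t.
case: bI => M [_ HM].
pose L := `|M| + 1.
have L0 : 0 <= L by rewrite addr_ge0.
have IL : I `<=` [set x | `|x| <= L].
  by move=> x Ix; apply: (HM L _ x Ix); rewrite /L (le_lt_trans (ler_norm M))// ltrDl.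
have mI : measurable I by exact: is_interval_measurable.
have key e : 0 < e -> \forall t \near +oo,
    (Lnorm_on 2%:E I (u t) + Lnorm_on +oo I (u t) <= e%:E)%E.
  move=> e0; pose c := Num.sqrt (2 * L) + 1.
  have c0 : 0 < c by rewrite ltr_wpDl ?sqrtr_ge0.
  (* The real and imaginary parts get half of $e/c$ each, so the modulus is at most $e/c$ and the
     two norms add up to at most $c \cdot e/c$. *)
  have e20 : 0 < e / c / 2 by rewrite !divr_gt0.
  have := locally_uniform_decay ha0 ha1 hs (fun t => (z0 t).1) (fun t => (z0 t).2) L0 e20.
  apply: filterS => t Ht.
  have -> : e%:E = (Num.sqrt (2 * L) * (e / c) + e / c)%:E.
    by congr EFin; rewrite -[X in _ + X]mul1r -mulrDl -/c mulrC divfK// gt_eqF.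
  apply: Lnorm_bound => //; [by rewrite divr_ge0 ?ltW| |exact: conj (mr t) (mi t)].
  apply: ae_sub (ae_and (ep t) (eq t)) => x /= [h1 h2] Ix.
  have [k1 k2] := Ht x (IL _ Ix).
  rewrite (le_trans (cabs_le _))// h1 h2; lra.
have ge0 t : (0 <= Lnorm_on 2%:E I (u t) + Lnorm_on +oo I (u t))%E.
  by apply: adde_ge0; exact: Lnorm_ge0.
apply/fine_cvgP; split.
  apply: filterS (key 1 ltr01) => t Ht; rewrite ge0_fin_numE//.
  by apply: le_lt_trans Ht _; rewrite ltry.
apply/cvgrPdist_le => e e0; apply: filterS (key e e0) => t Ht.
rewrite /= sub0r normrN ger0_norm ?fine_ge0//.
by rewrite -lee_fin fineK// ge0_fin_numE// (le_lt_trans Ht)// ltry.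
Qed.
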